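(* Let $D$ be a lax-idempotent pseudomonad on a 2-category $\mathcal K$ and let $T$ be a pseudomonad on a 2-category $\mathcal L$. Assume that: (1) there is a biadjunction in which $L:\mathcal K\to\mathcal L$ is left biadjoint to $R:\mathcal L\to\mathcal K$; (2) the left biadjoint admits an extension to the Kleisli 2-categories, i.e. there is a pseudofunctor $L^{\#}:\mathcal K_D\to\mathcal L_T$ with $L^{\#}\circ J_D=J_T\circ L$, where $J_D:\mathcal K\to\mathcal K_D$ and $J_T:\mathcal L\to\mathcal L_T$ are the canonical pseudofunctors. Then there is an induced colax adjunction between the Kleisli 2-categories in which $L^{\#}:\mathcal K_D\to\mathcal L_T$ is the left colax adjoint.
   Context: Kleisli 2-categories. For a pseudomonad $T$ on $\mathcal L$, the Kleisli 2-category $\mathcal L_T$ is the full sub-2-category of the 2-category of pseudo-$T$-algebras, pseudomorphisms and algebra 2-cells spanned by the free algebras; $J_T:\mathcal L\to\mathcal L_T$ is the free-algebra pseudofunctor, and it has a right biadjoint, the forgetful 2-functor $\mathcal L_T\to\mathcal L$. Lax-idempotent pseudomonads are used in the following equivalent form. A left Kan pseudomonad $(D,y)$ on a 2-category $\mathcal K$ (equivalently, a lax-idempotent pseudomonad) consists of: a function $D$ on objects; 1-cells $y_A:A\to DA$; and for each 1-cell $f:A\to DB$ a 1-cell $f^{\mathbb D}:DA\to DB$ and an invertible 2-cell $\mathbb D_f:f\Rightarrow f^{\mathbb D}y_A$ exhibiting $f^{\mathbb D}$ as a left Kan extension of $f$ along $y_A$; such that (i) the identity 2-cell exhibits $1_{DA}$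 as a left Kan extension of $y_A$ along $y_A$; (ii) for all $g:B\to DC$, $f:A\to DB$, $g^{\mathbb D}$ preserves the left Kan extension $(f^{\mathbb D},\mathbb D_f)$. A pseudo-$D$-algebra is an object $C$ with, for each $f:B\to C$, a 1-cell $f^{\mathbb C}:DB\to C$ and an invertible 2-cell $\mathbb C_f:f\Rightarrow f^{\mathbb C}y_B$ exhibiting $f^{\mathbb C}$ as a left Kan extension of $f$ along $y_B$, such that each $g^{\mathbb C}$ ($g:B\to C$) preserves each $(f^{\mathbb D},\mathbb D_f)$ ($f:A\to DB$). A $D$-pseudomorphism $h:C\to X$ is a 1-cell preserving the left Kan extensions $(f^{\mathbb C},\mathbb C_f)$; 2-cells are all 2-cells of $\mathcal K$. $\mathcal K_D$ is the full sub-2-category on the free algebras $(DA,(-)^{\mathbb D})$, and $J_D:\mathcal K\to\mathcal K_D$ sends $A\mapsto DA$, $(f:A\to B)\mapsto(y_Bf)^{\mathbb D}$. Colax adjunctions. For a pseudofunctor $K$ the structure isomorphisms are $\gamma:K(gf)\Rightarrow Kg\circ Kf$ and $\iota:K1_A\Rightarrow 1_{KA}$. A colax natural transformation $\alpha:K\Rightarrow K'$ consists of 1-cells $\alpha_A:KA\to K'A$ and 2-cells $\alpha_f:\alpha_B\circ Kf\Rightarrow K'f\circ\alpha_A$ for $f:A\to B$, subject to the usual unit, composition and local naturality axioms. A colax adjunction exhibiting $F:\mathcal X\to\mathcal Y$ as left colax adjoint to $U:\mathcal Y\to\mathcal X$ consists of pseudofunctors $F,U$, colax natural transformations $\eta:1_{\mathcal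 X}\Rightarrow UF$, $\epsilon:FU\Rightarrow 1_{\mathcal Y}$ and modifications $\Psi:\epsilon F\circ F\eta\to 1_F$, $\Phi:1_U\to U\epsilon\circ\eta U$ such that for all $A\in\mathcal X$, $B\in\mathcal Y$ the following composites are identities: $$\eta_A\xrightarrow{\Phi_{FA}\eta_A}U\epsilon_{FA}\,\eta_{UFA}\,\eta_A\xrightarrow{U\epsilon_{FA}\,\eta_{\eta_A}}U\epsilon_{FA}\,UF\eta_A\,\eta_A\xrightarrow{(U\Psi)_A\eta_A}\eta_A,$$ $$\epsilon_B\xrightarrow{\epsilon_B(F\Phi)_B}\epsilon_B\,FU\epsilon_B\,F\eta_{UB}\xrightarrow{\epsilon_{\epsilon_B}F\eta_{UB}}\epsilon_B\,\epsilon_{FUB}\,F\eta_{UB}\xrightarrow{\epsilon_B\Psi_{UB}}\epsilon_B,$$ where $(U\Psi)_A=\iota\circ U\Psi_A\circ\gamma^{-1}$ and $(F\Phi)_B=\gamma\circ F\Phi_B\circ\iota^{-1}$. A biadjunction is a colax adjunction in which $\eta,\epsilon$ are pseudonatural (2-cell components invertible) and $\Psi,\Phi$ are invertible. *)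

(* Defs.v *)
From Stdlib Require Import ssreflect ProofIrrelevance IndefiniteDescription.

Set Implicit Arguments.
Unset Strict Implicit.
Unset Printing Implicit Defensive.

Reserved Notation "g ∘ f" (at level 40, left associativity).
Reserved Notation "f ⇒ g" (at level 70, no associativity).
Reserved Notation "g ◁ s" (at level 42, right associativity).
Reserved Notation "s ▷ f" (at level 43, left associativity).
Reserved Notation "t • s" (at level 51, right associativity).

(** Composition of 1-cells [g ∘ f] and vertical composition of 2-cells [t • s]
    are written in the applicative order ("g after f", "t after s");
    [g ◁ s] and [s ▷ f] are the two whiskerings. *)
Record bicat := Bicat {
  ob :> Type;
  hom : ob -> ob -> Type;
  cell : forall A B, hom A B -> hom A B -> Type
    where "f ⇒ g" := (cell f g);
  id1 : forall A, hom A A;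
  comp1 : forall A B C, hom B C -> hom A B -> hom A C
    where "g ∘ f" := (comp1 g f);
  id2 : forall A B (f : hom A B), f ⇒ f;
  vcomp : forall A B (f g h : hom A B), g ⇒ h -> f ⇒ g -> f ⇒ h
    where "t • s" := (vcomp t s);
  lw : forall A B C (g : hom B C) (f f' : hom A B), f ⇒ f' -> g ∘ f ⇒ g ∘ f'
    where "g ◁ s" := (@lw _ _ _ g _ _ s);
  rw : forall A B C (g g' : hom B C), g ⇒ g' -> forall f : hom A B, g ∘ f ⇒ g' ∘ f
    where "s ▷ f" := (@rw _ _ _ _ _ s f);
  lu : forall A B (f : hom A B), id1 B ∘ f ⇒ f;
  lui : forall A B (f : hom A B), f ⇒ id1 B ∘ f;
  ru : forall A B (f : hom A B), f ∘ id1 A ⇒ f;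
  rui : forall A B (f : hom A B), f ⇒ f ∘ id1 A;
  asc : forall A B C E (h : hom C E) (g : hom B C) (f : hom A B),
    (h ∘ g) ∘ f ⇒ h ∘ (g ∘ f);
  asci : forall A B C E (h : hom C E) (g : hom B C) (f : hom A B),
    h ∘ (g ∘ f) ⇒ (h ∘ g) ∘ f;
  vid_l : forall A B (f g : hom A B) (s : f ⇒ g), id2 g • s = s;
  vid_r : forall A B (f g : hom A B) (s : f ⇒ g), s • id2 f = s;
  vassoc : forall A B (f g h k : hom A B) (r : h ⇒ k) (t : g ⇒ h) (s : f ⇒ g),
    (r • t) • s = r • (t • s);
  lw_id : forall A B C (g : hom B C) (f : hom A B), g ◁ id2 f = id2 (g ∘ f);
  lw_v : forall A B C (g : hom B C) (f f' f'' : hom A B) (t : f' ⇒ f'') (s : f ⇒ f'),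
    g ◁ (t • s) = (g ◁ t) • (g ◁ s);
  rw_id : forall A B C (g : hom B C) (f : hom A B), id2 g ▷ f = id2 (g ∘ f);
  rw_v : forall A B C (g g' g'' : hom B C) (t : g' ⇒ g'') (s : g ⇒ g') (f : hom A B),
    (t • s) ▷ f = (t ▷ f) • (s ▷ f);
  exch : forall A B C (g g' : hom B C) (f f' : hom A B) (t : g ⇒ g') (s : f ⇒ f'),
    (g' ◁ s) • (t ▷ f) = (t ▷ f') • (g ◁ s);
  lu_nat : forall A B (f g : hom A B) (s : f ⇒ g), lu g • (id1 B ◁ s) = s • lu f;
  ru_nat : forall A B (f g : hom A B) (s : f ⇒ g), ru g • (s ▷ id1 A) = s • ru f;
  asc_nat_l : forall A B C E (h : hom C E) (g : hom B C) (f f' : hom A B) (s : f ⇒ f'),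
    asc h g f' • ((h ∘ g) ◁ s) = (h ◁ (g ◁ s)) • asc h g f;
  asc_nat_m : forall A B C E (h : hom C E) (g g' : hom B C) (f : hom A B) (s : g ⇒ g'),
    asc h g' f • ((h ◁ s) ▷ f) = (h ◁ (s ▷ f)) • asc h g f;
  asc_nat_r : forall A B C E (h h' : hom C E) (g : hom B C) (f : hom A B) (s : h ⇒ h'),
    asc h' g f • ((s ▷ g) ▷ f) = (s ▷ (g ∘ f)) • asc h g f;
  lu_lui : forall A B (f : hom A B), lu f • lui f = id2 f;
  lui_lu : forall A B (f : hom A B), lui f • lu f = id2 _;
  ru_rui : forall A B (f : hom A B), ru f • rui f = id2 f;
  rui_ru : forall A B (f : hom A B), rui f • ru f = id2 _;
  asc_asci : forall A B C E (h : hom C E) (g : hom B C) (f : hom A B),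
    asc h g f • asci h g f = id2 _;
  asci_asc : forall A B C E (h : hom C E) (g : hom B C) (f : hom A B),
    asci h g f • asc h g f = id2 _;
  triangle : forall A B C (g : hom B C) (f : hom A B),
    (g ◁ lu f) • asc g (id1 B) f = ru g ▷ f;
  pentagon : forall A B C E G (k : hom E G) (h : hom C E) (g : hom B C) (f : hom A B),
    (k ◁ asc h g f) • asc k (h ∘ g) f • (asc k h g ▷ f) = asc k h (g ∘ f) • asc (k ∘ h) g f
}.

Arguments hom {b}.
Arguments cell {b A B}.
Arguments id1 {b}.
Arguments comp1 {b A B C}.
Arguments id2 {b A B}.
Arguments vcomp {b A B f g h}.
Arguments lw {b A B C} g {f f'}.
Arguments rw {b A B C g g'} _ f.
Arguments lu {b A B}.
Arguments lui {b A B}.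
Arguments ru {b A B}.
Arguments rui {b A B}.
Arguments asc {b A B C E}.
Arguments asci {b A B C E}.

Notation "g ∘ f" := (comp1 g f).
Notation "f ⇒ g" := (cell f g).
Notation "t • s" := (vcomp t s).
Notation "g ◁ s" := (lw g s).
Notation "s ▷ f" := (rw s f).

Definition idtocell {X : bicat} {A B : X} {f g : hom A B} (e : f = g) : f ⇒ g :=
  match e in _ = g' return f ⇒ g' with eq_refl => id2 f end.

(** A 2-category is a bicategory in which composition of 1-cells is associative
    and unital up to equality, the associator and the unitors being the
    identities induced by these equalities. *)
Record is_strict (X : bicat) : Prop := {
  strict_lu : forall (A B : X) (f : hom A B),
    exists e : id1 B ∘ f = f, lu f = idtocell e;
  strict_ru : forall (A B : X) (f : hom A B),
    exists e : f ∘ id1 A = f, ru f = idtocell e;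
  strict_asc : forall (A B C E : X) (h : hom C E) (g : hom B C) (f : hom A B),
    exists e : (h ∘ g) ∘ f = h ∘ (g ∘ f), asc h g f = idtocell e
}.

Record two_cat := TwoCat {
  tc_bicat :> bicat;
  tc_strict : is_strict tc_bicat
}.

Definition is_inv2 {X : bicat} {A B : X} {f g : hom A B} (s : f ⇒ g) : Prop :=
  exists t : g ⇒ f, t • s = id2 f /\ s • t = id2 g.

Section BicatLemmas.
Context {X : bicat}.

Lemma lw_id1_inj (A B : X) (f g : hom A B) (s t : f ⇒ g) :
  id1 B ◁ s = id1 B ◁ t -> s = t.
Proof.
move=> H; have := lu_nat s; rewrite H lu_nat => /(f_equal (fun z => z • lui f)).
by rewrite !vassoc lu_lui !vid_r.
Qed.

Lemma rw_id1_inj (A B : X) (f g : hom A B) (s t : f ⇒ g) :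
  s ▷ id1 A = t ▷ id1 A -> s = t.
Proof.
move=> H; have := ru_nat s; rewrite H ru_nat => /(f_equal (fun z => z • rui f)).
by rewrite !vassoc ru_rui !vid_r.
Qed.

Lemma asc_epi (A B C E : X) (h : hom C E) (g : hom B C) (f : hom A B) k
  (s t : h ∘ (g ∘ f) ⇒ k) : s • asc h g f = t • asc h g f -> s = t.
Proof.
move=> /(f_equal (fun z => z • asci h g f)).
by rewrite !vassoc asc_asci !vid_r.
Qed.

Lemma lu_comp (A B C : X) (f : hom B C) (u : hom A B) :
  lu f ▷ u = lu (f ∘ u) • asc (id1 C) f u.
Proof.
apply: lw_id1_inj; symmetry.
suff H : (id1 C ◁ (lu (f ∘ u) • asc (id1 C) f u)) • asc _ _ _ • (asc _ _ _ ▷ u) =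
  (id1 C ◁ (lu f ▷ u)) • asc _ _ _ • (asc _ _ _ ▷ u).
  have /(f_equal (fun z => z • (asci (id1 C) (id1 C) f ▷ u))) := H.
  rewrite !vassoc -!rw_v asc_asci rw_id !vid_r. exact: asc_epi.
rewrite lw_v !vassoc pentagon -!vassoc triangle -asc_nat_r -asc_nat_m.
by rewrite !vassoc -rw_v triangle.
Qed.

(** Expressions for 1-cells and 2-cells, and their normal forms: the 2-cell
    denoted by an expression is determined by its component on [u], which no
    longer contains structural cells. *)
Inductive e1 : X -> X -> Type :=
| A1 a b (f : hom a b) : e1 a b
| I1 a : e1 a a
| C1 a b c (g : e1 b c) (f : e1 a b) : e1 a c.

Fixpoint ev1 a b (e : e1 a b) : hom a b :=
  match e with A1 f => f | I1 a => id1 a | C1 g f => ev1 g ∘ ev1 f end.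

Fixpoint nf a b (e : e1 a b) x : hom x a -> hom x b :=
  match e with
  | A1 f => fun u => f ∘ u
  | I1 _ => fun u => u
  | C1 g f => fun u => nf g (nf f u)
  end.

Fixpoint nfm a b (e : e1 a b) x : forall u v : hom x a, u ⇒ v -> nf e u ⇒ nf e v :=
  match e with
  | A1 f => fun u v s => f ◁ s
  | I1 _ => fun u v s => s
  | C1 g f => fun u v s => nfm g (nfm f s)
  end.

Fixpoint cc a b (e : e1 a b) x : forall u : hom x a, ev1 e ∘ u ⇒ nf e u :=
  match e with
  | A1 f => fun u => id2 _
  | I1 _ => fun u => lu u
  | C1 g f => fun u => cc g (nf f u) • (ev1 g ◁ cc f u) • asc _ _ _
  end.

Fixpoint cci a b (e : e1 a b) x : forall u : hom x a, nf e u ⇒ ev1 e ∘ u :=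
  match e with
  | A1 f => fun u => id2 _
  | I1 _ => fun u => lui u
  | C1 g f => fun u => asci _ _ _ • (ev1 g ◁ cci f u) • cci g (nf f u)
  end.

Lemma nfm_id a b (e : e1 a b) x (u : hom x a) : nfm e (id2 u) = id2 _.
Proof. by elim: e u => //= *; rewrite ?lw_id // => *; congruence. Qed.

Lemma nfm_v a b (e : e1 a b) x (u v w : hom x a) (t : v ⇒ w) (s : u ⇒ v) :
  nfm e (t • s) = nfm e t • nfm e s.
Proof.
elim: e u v w t s => //= [|a' b' c' g IHg f IHf] *; first exact: lw_v.
by rewrite IHf IHg.
Qed.

Lemma cc_cci a b (e : e1 a b) x (u : hom x a) : cc e u • cci e u = id2 _.
Proof.
elim: e u => //= [*|*|a' b' c' g IHg f IHf u]; rewrite ?vid_l ?lu_lui //.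
rewrite !vassoc -(vassoc (asc _ _ _)) asc_asci vid_l.
by rewrite -(vassoc (ev1 g ◁ _)) -lw_v IHf lw_id vid_l IHg.
Qed.

Lemma cci_cc a b (e : e1 a b) x (u : hom x a) : cci e u • cc e u = id2 _.
Proof.
elim: e u => //= [*|*|a' b' c' g IHg f IHf u]; rewrite ?vid_l ?lui_lu //.
rewrite !vassoc -(vassoc (cci g _)) IHg vid_l.
by rewrite -(vassoc (ev1 g ◁ _)) -lw_v IHf lw_id vid_l asci_asc.
Qed.

Lemma cc_nat a b (e : e1 a b) x (u v : hom x a) (s : u ⇒ v) :
  cc e v • (ev1 e ◁ s) = nfm e s • cc e u.
Proof.
elim: e u v s => //= [*|*|a' b' c' g IHg f IHf u v s]; rewrite ?vid_l ?vid_r ?lu_nat //.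
rewrite !vassoc asc_nat_l -(vassoc (ev1 g ◁ _)) -lw_v IHf lw_v.
by rewrite -!vassoc IHg.
Qed.

Lemma cc_epi a b (e : e1 a b) x (u : hom x a) k (s t : nf e u ⇒ k) :
  s • cc e u = t • cc e u -> s = t.
Proof.
move=> /(f_equal (fun z => z • cci e u)).
by rewrite !vassoc cc_cci !vid_r.
Qed.

Lemma cc_mono a b (e : e1 a b) x (u : hom x a) k (s t : k ⇒ ev1 e ∘ u) :
  cc e u • s = cc e u • t -> s = t.
Proof.
move=> /(f_equal (fun z => cci e u • z)).
by rewrite -!vassoc cci_cc !vid_l.
Qed.

Fact act_key : unit. Proof. exact: tt. Qed.

Definition act_def a b (f g : e1 a b) (s : ev1 f ⇒ ev1 g) x (u : hom x a) : nf f u ⇒ nf g u :=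
  cc g u • (s ▷ u) • cci f u.

Definition act := locked_with act_key act_def.
Arguments act {a b f g} s {x} u.

Lemma act_cc a b (f g : e1 a b) (s : ev1 f ⇒ ev1 g) x (u : hom x a) :
  act s u • cc f u = cc g u • (s ▷ u).
Proof. by rewrite [@act]unlock /act_def !vassoc cci_cc vid_r. Qed.

Lemma act_nat a b (f g : e1 a b) (s : ev1 f ⇒ ev1 g) x (u v : hom x a) (t : u ⇒ v) :
  act s v • nfm f t = nfm g t • act s u.
Proof.
apply: cc_epi; rewrite !vassoc -cc_nat -(vassoc (act s v)) !act_cc !vassoc.
by rewrite -(vassoc (nfm g t)) -cc_nat !vassoc exch.
Qed.

Inductive e2 : forall a b, e1 a b -> e1 a b -> Type :=
| G2 a b (f g : e1 a b) (s : ev1 f ⇒ ev1 g) : e2 f g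
| I2 a b (f : e1 a b) : e2 f f
| V2 a b (f g h : e1 a b) (t : e2 g h) (s : e2 f g) : e2 f h
| L2 a b c (g : e1 b c) (f f' : e1 a b) (s : e2 f f') : e2 (C1 g f) (C1 g f')
| R2 a b c (g g' : e1 b c) (s : e2 g g') (f : e1 a b) : e2 (C1 g f) (C1 g' f)
| LU a b (f : e1 a b) : e2 (C1 (I1 b) f) f
| LUI a b (f : e1 a b) : e2 f (C1 (I1 b) f)
| RU a b (f : e1 a b) : e2 (C1 f (I1 a)) f
| RUI a b (f : e1 a b) : e2 f (C1 f (I1 a))
| AS a b c d (h : e1 c d) (g : e1 b c) (f : e1 a b) : e2 (C1 (C1 h g) f) (C1 h (C1 g f))
| ASI a b c d (h : e1 c d) (g : e1 b c) (f : e1 a b) : e2 (C1 h (C1 g f)) (C1 (C1 h g) f).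

Fixpoint ev2 a b (f g : e1 a b) (t : e2 f g) : ev1 f ⇒ ev1 g :=
  match t in @e2 a b f g return ev1 f ⇒ ev1 g with
  | G2 s => s
  | I2 f => id2 _
  | V2 t s => ev2 t • ev2 s
  | L2 g s => ev1 g ◁ ev2 s
  | R2 s f => ev2 s ▷ ev1 f
  | LU f => lu _
  | LUI f => lui _
  | RU f => ru _
  | RUI f => rui _
  | AS h g f => asc _ _ _
  | ASI h g f => asci _ _ _
  end.

Fixpoint nf2 a b (f g : e1 a b) (t : e2 f g) x : forall u : hom x a, nf f u ⇒ nf g u :=
  match t in @e2 a b f g return forall u : hom x a, nf f u ⇒ nf g u with
  | G2 s => fun u => act s u
  | I2 f => fun u => id2 _
  | V2 t s => fun u => nf2 t u • nf2 s u
  | L2 g s => fun u => nfm g (nf2 s u)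
  | R2 s f => fun u => nf2 s (nf f u)
  | LU f => fun u => id2 _
  | LUI f => fun u => id2 _
  | RU f => fun u => id2 _
  | RUI f => fun u => id2 _
  | AS h g f => fun u => id2 _
  | ASI h g f => fun u => id2 _
  end.

Lemma lu_cc a b (f : e1 a b) x (u : hom x a) :
  cc f u • (lu (ev1 f) ▷ u) = cc (C1 (I1 b) f) u.
Proof. by rewrite /= -vassoc lu_nat vassoc lu_comp. Qed.

Lemma ru_cc a b (f : e1 a b) x (u : hom x a) :
  cc f u • (ru (ev1 f) ▷ u) = cc (C1 f (I1 a)) u.
Proof. by rewrite /= triangle. Qed.

Lemma asc_cc a b c d (h : e1 c d) (g : e1 b c) (f : e1 a b) x (u : hom x a) :
  cc (C1 h (C1 g f)) u • (asc _ _ _ ▷ u) = cc (C1 (C1 h g) f) u.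
Proof.
rewrite /= !lw_v !vassoc pentagon; do 2 f_equal.
by rewrite -!vassoc; f_equal; rewrite asc_nat_l.
Qed.

Lemma nf2E a b (f g : e1 a b) (t : e2 f g) x (u : hom x a) :
  nf2 t u • cc f u = cc g u • (ev2 t ▷ u).
Proof.
elim: t x u => {a b f g}
  [a b f g s|a b f|a b f g h t IHt s IHs|a b c g f f' s IHs|a b c g g' s IHs f
  |a b f|a b f|a b f|a b f|a b c d h g f|a b c d h g f] x u.
- exact: act_cc.
- by rewrite /= vid_l rw_id vid_r.
- by rewrite /= vassoc IHs -vassoc IHt vassoc rw_v.
- rewrite /= -vassoc -cc_nat !vassoc asc_nat_m; f_equal; rewrite -!vassoc; f_equal.
  by rewrite -!lw_v IHs.
- rewrite /= -vassoc IHs !vassoc asc_nat_r; f_equal; rewrite -!vassoc; f_equal.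
  by rewrite exch.
- by rewrite [nf2 _ _]/= vid_l [ev2 _]/= lu_cc.
- by rewrite [nf2 _ _]/= vid_l [ev2 _]/= -lu_cc vassoc -rw_v lu_lui rw_id vid_r.
- by rewrite [nf2 _ _]/= vid_l [ev2 _]/= ru_cc.
- by rewrite [nf2 _ _]/= vid_l [ev2 _]/= -ru_cc vassoc -rw_v ru_rui rw_id vid_r.
- by rewrite [nf2 _ _]/= vid_l [ev2 _]/= asc_cc.
- by rewrite [nf2 _ _]/= vid_l [ev2 _]/= -asc_cc vassoc -rw_v asc_asci rw_id vid_r.
Qed.

Lemma nf2_eq a b (f g : e1 a b) (t t' : e2 f g) :
  ev2 t = ev2 t' -> forall x (u : hom x a), nf2 t u = nf2 t' u.
Proof. by move=> H x u; apply: cc_epi; rewrite !nf2E H. Qed.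

Lemma eq_nf2 a b (f g : e1 a b) (t t' : e2 f g) :
  (forall x (u : hom x a), nf2 t u = nf2 t' u) -> ev2 t = ev2 t'.
Proof. by move=> H; apply: rw_id1_inj; apply: (@cc_mono _ _ g); rewrite -!nf2E H. Qed.

End BicatLemmas.

Section Chains.
Context {X : bicat}.

Lemma ch2 (A B : X) (f g h k : hom A B) (a : h ⇒ k) (b : g ⇒ h) (r : g ⇒ k) :
  a • b = r -> forall s : f ⇒ g, a • b • s = r • s.
Proof. by move=> <- s; rewrite vassoc. Qed.

Lemma ch3 (A B : X) (f g h k l : hom A B) (a : k ⇒ l) (b : h ⇒ k) (c : g ⇒ h) (r : g ⇒ l) :
  a • b • c = r -> forall s : f ⇒ g, a • b • c • s = r • s.
Proof. by move=> <- s; rewrite !vassoc. Qed.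

Lemma ch5 (A B : X) (e f g h k l m : hom A B) (z : l ⇒ m) (a : k ⇒ l)
  (b : h ⇒ k) (c : g ⇒ h) (d : f ⇒ g) (r : f ⇒ m) : z • a • b • c • d = r ->
  forall s : e ⇒ f, z • a • b • c • d • s = r • s.
Proof. by move=> <- s; rewrite !vassoc. Qed.

Lemma lch (A B C : X) (p : hom B C) (f g h : hom A B) (a : g ⇒ h) (b : f ⇒ g) (r : f ⇒ h) :
  a • b = r -> (p ◁ a) • (p ◁ b) = p ◁ r.
Proof. by move=> <-; rewrite lw_v. Qed.

Lemma lch3 (A B C : X) (p : hom B C) (f g h k : hom A B) (a : h ⇒ k) (b : g ⇒ h) (c : f ⇒ g)
  (r : f ⇒ k) : a • b • c = r -> (p ◁ a) • (p ◁ b) • (p ◁ c) = p ◁ r.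
Proof. by move=> <-; rewrite !lw_v. Qed.

Lemma lch4 (A B C : X) (p : hom B C) (f g h k l : hom A B) (a : k ⇒ l) (b : h ⇒ k)
  (c : g ⇒ h) (d : f ⇒ g) (r : f ⇒ l) : a • b • c • d = r ->
  (p ◁ a) • (p ◁ b) • (p ◁ c) • (p ◁ d) = p ◁ r.
Proof. by move=> <-; rewrite !lw_v. Qed.

Lemma lch5 (A B C : X) (p : hom B C) (f g h k l m : hom A B) (z : l ⇒ m) (a : k ⇒ l)
  (b : h ⇒ k) (c : g ⇒ h) (d : f ⇒ g) (r : f ⇒ m) : z • a • b • c • d = r ->
  (p ◁ z) • (p ◁ a) • (p ◁ b) • (p ◁ c) • (p ◁ d) = p ◁ r.
Proof. by move=> <-; rewrite !lw_v. Qed.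

Lemma act_natk (a b : X) (f g : e1 a b) (s : ev1 f ⇒ ev1 g) x (u v : hom x a)
  (t : u ⇒ v) k (r : k ⇒ _) :
  act s v • nfm f t • r = nfm g t • act s u • r.
Proof. by rewrite -!vassoc act_nat. Qed.

End Chains.

Arguments lch {X A B C p f g h a b r}.
Arguments lch3 {X A B C p f g h k a b c r}.
Arguments lch4 {X A B C p f g h k l a b c d r}.

Arguments lch5 {X A B C p f g h k l m z a b c d r}.

Ltac reify1 f :=
  lazymatch f with
  | comp1 ?g ?h => let g' := reify1 g in let h' := reify1 h in constr:(C1 g' h')
  | id1 ?a => constr:(I1 a)
  | _ => constr:(A1 f)
  end.

Ltac reify2 t :=
  lazymatch t with
  | vcomp ?t ?s => let t' := reify2 t in let s' := reify2 s in constr:(V2 t' s')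
  | id2 ?f => let f' := reify1 f in constr:(I2 f')
  | lw ?g ?s => let g' := reify1 g in let s' := reify2 s in constr:(L2 g' s')
  | rw ?s ?f => let s' := reify2 s in let f' := reify1 f in constr:(R2 s' f')
  | lu ?f => let f' := reify1 f in constr:(LU f')
  | lui ?f => let f' := reify1 f in constr:(LUI f')
  | ru ?f => let f' := reify1 f in constr:(RU f')
  | rui ?f => let f' := reify1 f in constr:(RUI f')
  | asc ?h ?g ?f =>
    let h' := reify1 h in let g' := reify1 g in let f' := reify1 f in constr:(AS h' g' f')
  | asci ?h ?g ?f =>
    let h' := reify1 h in let g' := reify1 g in let f' := reify1 f in constr:(ASI h' g' f')
  | _ =>
    let ty := type of t in
    let ty := eval cbn in ty in
    lazymatch ty with
    | cell ?f ?g =>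
      let f' := reify1 f in let g' := reify1 g in constr:(@G2 _ _ _ f' g' t)
    end
  end.

Ltac simp2 := rewrite ?(lw_v, lw_id, vid_l, vid_r, vassoc).

(** [bicat_nf] reduces an equation of 2-cells to the equation between the
    components of both sides, free of structural cells; [bicat_use H F] turns the
    equation [H] into the equation [F] between components. *)
Ltac bicat_nf :=
  lazymatch goal with
  | |- ?l = ?r =>
    let l' := reify2 l in let r' := reify2 r in
    change (ev2 l' = ev2 r');
    let x := fresh "x" in let u := fresh "u" in
    apply: eq_nf2 => x u; cbn [nf2 nf nfm]; simp2
  end.

Ltac bicat_use H F' :=
  let E := fresh in
  pose proof H as E;
  lazymatch type of E with
  | ?l = ?r =>
    let l' := reify2 l in let r' := reify2 r in
    change (ev2 l' = ev2 r') in E;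
    let F := fresh in
    pose proof (nf2_eq E) as F; clear E;
    eassert (F' : forall x (u : hom x _), _);
      [ let x := fresh "x" in let u := fresh "u" in
        intros x u; specialize (F x u); cbn [nf2 nf nfm] in F;
        repeat (rewrite -> lw_v in F || rewrite -> lw_id in F || rewrite -> vid_l in F
                || rewrite -> vid_r in F || rewrite -> vassoc in F);
        exact F
      | clear F ]
  end.

(** [bicat_nat s N Nk] gives the naturality of the components of the 2-cell [s]
    as [N], and the same equation followed by a further 2-cell as [Nk]. *)
Ltac bicat_nat s N Nk :=
  let s' := reify2 s in
  lazymatch s' with
  | @G2 _ ?a ?b ?f ?g _ =>
    pose proof (@act_nat _ a b f g s) as N;
    pose proof (@act_natk _ a b f g s) as Nk;
    cbn [nf nfm] in N; cbn [nf nfm] in Nk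
  end.

#[local] Set Primitive Projections.
Record prefun (X Y : bicat) := Prefun {
  fo :> X -> Y;
  fm : forall A B : X, hom A B -> hom (fo A) (fo B)
}.
#[local] Unset Primitive Projections.

Arguments fm {X Y} p {A B} f.

(** [pfc] and [pfu] are the comparison cells [K (g f) ⇒ K g ∘ K f] and
    [K 1 ⇒ 1], with inverses [pfci] and [pfui]. *)
Record pseudofunctor (X Y : bicat) := Pseudofunctor {
  pf_pre :> prefun X Y;
  pf2 : forall (A B : X) (f g : hom A B), f ⇒ g -> fm pf_pre f ⇒ fm pf_pre g;
  pfc : forall (A B C : X) (g : hom B C) (f : hom A B),
    fm pf_pre (g ∘ f) ⇒ fm pf_pre g ∘ fm pf_pre f;
  pfci : forall (A B C : X) (g : hom B C) (f : hom A B),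
    fm pf_pre g ∘ fm pf_pre f ⇒ fm pf_pre (g ∘ f);
  pfu : forall A : X, fm pf_pre (id1 A) ⇒ id1 (pf_pre A);
  pfui : forall A : X, id1 (pf_pre A) ⇒ fm pf_pre (id1 A);
  pf2_id : forall (A B : X) (f : hom A B), pf2 (id2 f) = id2 _;
  pf2_v : forall (A B : X) (f g h : hom A B) (t : g ⇒ h) (s : f ⇒ g),
    pf2 (t • s) = pf2 t • pf2 s;
  pfc_natl : forall (A B C : X) (g : hom B C) (f f' : hom A B) (s : f ⇒ f'),
    pfc g f' • pf2 (g ◁ s) = (fm pf_pre g ◁ pf2 s) • pfc g f;
  pfc_natr : forall (A B C : X) (g g' : hom B C) (s : g ⇒ g') (f : hom A B),
    pfc g' f • pf2 (s ▷ f) = (pf2 s ▷ fm pf_pre f) • pfc g f;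
  pfc_pfci : forall (A B C : X) (g : hom B C) (f : hom A B), pfc g f • pfci g f = id2 _;
  pfci_pfc : forall (A B C : X) (g : hom B C) (f : hom A B), pfci g f • pfc g f = id2 _;
  pfu_pfui : forall A : X, pfu A • pfui A = id2 _;
  pfui_pfu : forall A : X, pfui A • pfu A = id2 _;
  pf_asc : forall (A B C E : X) (h : hom C E) (g : hom B C) (f : hom A B),
    asc _ _ _ • (pfc h g ▷ fm pf_pre f) • pfc (h ∘ g) f
    = (fm pf_pre h ◁ pfc g f) • pfc h (g ∘ f) • pf2 (asc h g f);
  pf_lu : forall (A B : X) (f : hom A B),
    lu _ • (pfu B ▷ fm pf_pre f) • pfc (id1 B) f = pf2 (lu f);
  pf_ru : forall (A B : X) (f : hom A B),
    ru _ • (fm pf_pre f ◁ pfu A) • pfc f (id1 A) = pf2 (ru f)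
}.

Arguments pf2 {X Y} p {A B f g} s.
Arguments pfc {X Y} p {A B C} g f.
Arguments pfci {X Y} p {A B C} g f.
Arguments pfu {X Y} p A.
Arguments pfui {X Y} p A.

Definition pre_id (X : bicat) : prefun X X := Prefun (fun A B (f : hom A B) => f).

Definition pre_comp (X Y Z : bicat) (G : prefun Y Z) (F : prefun X Y) : prefun X Z :=
  Prefun (fun A B (f : hom A B) => fm G (fm F f)).

Program Definition pf_id (X : bicat) : pseudofunctor X X :=
  {| pf_pre := pre_id X;
     pf2 := fun _ _ _ _ s => s;
     pfc := fun _ _ _ g f => id2 (g ∘ f);
     pfci := fun _ _ _ g f => id2 (g ∘ f);
     pfu := fun A => id2 (id1 A);
     pfui := fun A => id2 (id1 A) |}.
Solve All Obligations with
  (move=> *; cbn; by rewrite ?(lw_id, rw_id, vid_l, vid_r)).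

Program Definition pf_comp (X Y Z : bicat) (G : pseudofunctor Y Z) (F : pseudofunctor X Y) :
  pseudofunctor X Z :=
  {| pf_pre := pre_comp G F;
     pf2 := fun _ _ _ _ s => pf2 G (pf2 F s);
     pfc := fun _ _ _ g f => pfc G (fm F g) (fm F f) • pf2 G (pfc F g f);
     pfci := fun _ _ _ g f => pf2 G (pfci F g f) • pfci G (fm F g) (fm F f);
     pfu := fun A => pfu G (F A) • pf2 G (pfu F A);
     pfui := fun A => pf2 G (pfui F A) • pfui G (F A) |}.
Next Obligation. by move=> *; rewrite !pf2_id. Qed.
Next Obligation. by move=> *; rewrite !pf2_v. Qed.
Next Obligation.
by move=> *; rewrite !vassoc -pf2_v pfc_natl pf2_v -!vassoc pfc_natl.
Qed.
Next Obligation.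
by move=> *; rewrite !vassoc -pf2_v pfc_natr pf2_v -!vassoc pfc_natr.
Qed.
Next Obligation.
by move=> *; rewrite vassoc -(vassoc (pf2 G _)) -pf2_v pfc_pfci pf2_id vid_l pfc_pfci.
Qed.
Next Obligation.
by move=> *; rewrite vassoc -(vassoc (pfci G _ _)) pfci_pfc vid_l -pf2_v pfci_pfc pf2_id.
Qed.
Next Obligation.
by move=> *; rewrite vassoc -(vassoc (pf2 G _)) -pf2_v pfu_pfui pf2_id vid_l pfu_pfui.
Qed.
Next Obligation.
by move=> *; rewrite vassoc -(vassoc (pfui G _)) pfui_pfu vid_l -pf2_v pfui_pfu pf2_id.
Qed.
Next Obligation.
move=> *; cbn.
rewrite rw_v lw_v !vassoc (ch2 (eq_sym (pfc_natr _ _ _))) vassoc.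
rewrite (ch3 (pf_asc G _ _ _)) !vassoc -!pf2_v pf_asc !pf2_v.
by rewrite (ch2 (pfc_natl _ _ _)) vassoc.
Qed.
Next Obligation.
move=> *; cbn.
rewrite rw_v !vassoc (ch2 (eq_sym (pfc_natr _ _ _))) vassoc.
by rewrite (ch3 (pf_lu G _)) -!pf2_v pf_lu.
Qed.
Next Obligation.
move=> *; cbn.
rewrite lw_v !vassoc (ch2 (eq_sym (pfc_natl _ _ _))) vassoc.
by rewrite (ch3 (pf_ru G _)) -!pf2_v pf_ru.
Qed.

Section PseudofunctorLemmas.
Context {X Y : bicat} (K : pseudofunctor X Y).

Lemma pf_lui (A B : X) (f : hom A B) :
  (pfu K B ▷ fm K f) • pfc K (id1 B) f • pf2 K (lui f) = lui (fm K f).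
Proof.
rewrite -[LHS]vid_l -lui_lu !vassoc (ch3 (pf_lu K f)) -pf2_v lu_lui pf2_id.
by rewrite vid_r.
Qed.

Lemma pf_asci (A B C E : X) (h : hom C E) (g : hom B C) (f : hom A B) :
  (pfc K h g ▷ fm K f) • pfc K (h ∘ g) f • pf2 K (asci h g f)
  = asci _ _ _ • (fm K h ◁ pfc K g f) • pfc K h (g ∘ f).
Proof.
rewrite -[LHS]vid_l -asci_asc !vassoc (ch3 (pf_asc K h g f)) !vassoc -pf2_v asc_asci.
by rewrite pf2_id vid_r.
Qed.

Lemma pf_asc' (A B C E : X) (h : hom C E) (g : hom B C) (f : hom A B) :
  pfc K h (g ∘ f) • pf2 K (asc h g f)
  = (fm K h ◁ pfci K g f) • asc _ _ _ • (pfc K h g ▷ fm K f) • pfc K (h ∘ g) f.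
Proof. by rewrite pf_asc -(vassoc (_ ◁ _)) -lw_v pfci_pfc lw_id vid_l. Qed.

Lemma pf_asci' (A B C E : X) (h : hom C E) (g : hom B C) (f : hom A B) :
  pfc K (h ∘ g) f • pf2 K (asci h g f)
  = (pfci K h g ▷ fm K f) • asci _ _ _ • (fm K h ◁ pfc K g f) • pfc K h (g ∘ f).
Proof. by rewrite -pf_asci -(vassoc (_ ▷ _)) -rw_v pfci_pfc rw_id vid_l. Qed.

End PseudofunctorLemmas.

Lemma pf_id_conj (X : bicat) (T : pseudofunctor X X) (A : X) (a : hom (T A) A) :
  (pfu T A ▷ fm T a) • pfc T (id1 A) a • pf2 T (lui a • ru a • (a ◁ pfu T A))
    • pfci T a (fm T (id1 A))
  = lui (fm T a) • ru (fm T a) • (fm T a ◁ (pfu T (T A) • pf2 T (pfu T A))).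
Proof.
rewrite !pf2_v !vassoc (ch3 (pf_lui T a)) -pf_ru !vassoc (ch2 (pfc_natl T _ _)).
by rewrite vassoc pfc_pfci vid_r -lw_v.
Qed.

Lemma pf_comp_conj (X : bicat) (T : pseudofunctor X X) (A B C : X)
  (a : hom (T A) A) (b : hom (T B) B) (c : hom (T C) C) (f : hom A B) (g : hom B C)
  (s : b ∘ fm T f ⇒ f ∘ a) (t : c ∘ fm T g ⇒ g ∘ b) :
  (pfc T g f ▷ fm T a) • pfc T (g ∘ f) a
    • pf2 T (asci g f a • (g ◁ s) • asc g b (fm T f) • (t ▷ fm T f)
             • asci c (fm T g) (fm T f) • (c ◁ pfc T g f))
    • pfci T c (fm T (g ∘ f))
  = asci _ _ _ • (fm T g ◁ (pfc T f a • pf2 T s • pfci T b (fm T f))) • asc _ _ _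
    • ((pfc T g b • pf2 T t • pfci T c (fm T g)) ▷ fm T (fm T f)) • asci _ _ _
    • (fm T c ◁ (pfc T (fm T g) (fm T f) • pf2 T (pfc T g f))).
Proof.
rewrite !pf2_v !vassoc (ch3 (pf_asci T _ _ _)) !vassoc (ch2 (pfc_natl T _ _)) vassoc.
rewrite (ch2 (pf_asc' T _ _ _)) !vassoc (ch2 (pfc_natr T _ _)) vassoc.
rewrite (ch2 (pf_asci' T _ _ _)) !vassoc (ch2 (pfc_natl T _ _)) vassoc.
by rewrite pfc_pfci vid_r !(lw_v, rw_v) !vassoc.
Qed.

(** The 1-cell and 2-cell components of a colax natural transformation. As
    [pre_comp] is strictly associative and unital up to conversion, whiskered
    and composite transformations can be compared without coercions. *)
Record colax_data (X Y : bicat) (K K' : prefun X Y) := ColaxData {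
  cx1 :> forall A : X, hom (K A) (K' A);
  cx2 : forall (A B : X) (f : hom A B), cx1 B ∘ fm K f ⇒ fm K' f ∘ cx1 A
}.

Arguments cx1 {X Y K K'} c A.
Arguments cx2 {X Y K K'} c {A B} f.

Record colax_nat (X Y : bicat) (K K' : pseudofunctor X Y) := ColaxNat {
  cn_data :> colax_data K K';
  cn_unit : forall A : X,
    (pfu K' A ▷ cn_data A) • cx2 cn_data (id1 A)
    = lui _ • ru _ • (cn_data A ◁ pfu K A);
  cn_comp : forall (A B C : X) (g : hom B C) (f : hom A B),
    (pfc K' g f ▷ cn_data A) • cx2 cn_data (g ∘ f)
    = asci _ _ _ • (fm K' g ◁ cx2 cn_data f) • asc _ _ _ • (cx2 cn_data g ▷ fm K f)
      • asci _ _ _ • (cn_data C ◁ pfc K g f);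
  cn_nat : forall (A B : X) (f g : hom A B) (s : f ⇒ g),
    (pf2 K' s ▷ cn_data A) • cx2 cn_data f = cx2 cn_data g • (cn_data B ◁ pf2 K s)
}.

Definition is_pseudonatural (X Y : bicat) (K K' : prefun X Y) (a : colax_data K K') : Prop :=
  forall (A B : X) (f : hom A B), is_inv2 (cx2 a f).

Definition cx_id (X Y : bicat) (K : prefun X Y) : colax_data K K :=
  {| cx1 := fun A => id1 (K A);
     cx2 := fun _ _ f => rui (fm K f) • lu (fm K f) |}.

Definition cx_comp (X Y : bicat) (K K' K'' : prefun X Y)
  (b : colax_data K' K'') (a : colax_data K K') : colax_data K K'' :=
  {| cx1 := fun A => b A ∘ a A;
     cx2 := fun A B f => asc (fm K'' f) (b A) (a A) • (cx2 b f ▷ a A)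
       • asci (b B) (fm K' f) (a A) • (b B ◁ cx2 a f) • asc (b B) (a B) (fm K f) |}.

Definition cx_pre (X Y Z : bicat) (K K' : prefun Y Z) (a : colax_data K K')
  (G : prefun X Y) : colax_data (pre_comp K G) (pre_comp K' G) :=
  @ColaxData X Z (pre_comp K G) (pre_comp K' G)
    (fun A => a (G A)) (fun A B f => cx2 a (fm G f)).

Definition cx_post (X Y Z : bicat) (H : pseudofunctor Y Z) (K K' : prefun X Y)
  (a : colax_data K K') : colax_data (pre_comp H K) (pre_comp H K') :=
  @ColaxData X Z (pre_comp H K) (pre_comp H K')
    (fun A => fm H (a A))
    (fun A B f => pfc H (fm K' f) (a A) • pf2 H (cx2 a f) • pfci H (a B) (fm K f)).

Record modification (X Y : bicat) (K K' : prefun X Y) (a b : colax_data K K') :=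
  Modification {
  md1 :> forall A : X, a A ⇒ b A;
  md_nat : forall (A B : X) (f : hom A B),
    (fm K' f ◁ md1 A) • cx2 a f = cx2 b f • (md1 B ▷ fm K f)
}.

Definition is_inv_modification (X Y : bicat) (K K' : prefun X Y) (a b : colax_data K K')
  (m : modification a b) : Prop :=
  forall A : X, is_inv2 (m A).

(** Colax adjunctions exhibiting [F] as left colax adjoint to [U]. The inner
    composites in the two swallowtail equations are [U Psi] and [F Phi]. *)
Record colax_adjunction (X Y : bicat) (F : pseudofunctor X Y) (U : pseudofunctor Y X) :=
  ColaxAdjunction {
  ca_unit : colax_nat (pf_id X) (pf_comp U F);
  ca_counit : colax_nat (pf_comp F U) (pf_id Y);
  ca_Psi : modification (K := F) (K' := F)
    (cx_comp (cx_pre ca_counit F) (cx_post F ca_unit)) (cx_id F);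
  ca_Phi : modification (K := U) (K' := U)
    (cx_id U) (cx_comp (cx_post U ca_counit) (cx_pre ca_unit U));
  ca_swallowtail1 : forall A : X,
    lu (ca_unit A)
    • ((pfu U (F A) • pf2 U (ca_Psi A) • pfci U (ca_counit (F A)) (fm F (ca_unit A)))
       ▷ ca_unit A)
    • asci _ _ _
    • (fm U (ca_counit (F A)) ◁ cx2 ca_unit (ca_unit A))
    • asc _ _ _
    • (ca_Phi (F A) ▷ ca_unit A)
    • lui (ca_unit A)
    = id2 (ca_unit A);
  ca_swallowtail2 : forall B : Y,
    ru (ca_counit B)
    • (ca_counit B ◁ ca_Psi (U B))
    • asc _ _ _
    • (cx2 ca_counit (ca_counit B) ▷ fm F (ca_unit (U B)))
    • asci _ _ _
    • (ca_counit B
       ◁ (pfc F (fm U (ca_counit B)) (ca_unit (U B)) • pf2 F (ca_Phi B) • pfui F (U B)))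
    • rui (ca_counit B)
    = id2 (ca_counit B)
}.

Record biadjunction (X Y : bicat) (F : pseudofunctor X Y) (U : pseudofunctor Y X) :=
  Biadjunction {
  ba_colax :> colax_adjunction F U;
  ba_unit_inv : is_pseudonatural (ca_unit ba_colax);
  ba_counit_inv : is_pseudonatural (ca_counit ba_colax);
  ba_Psi_inv : is_inv_modification (ca_Psi ba_colax);
  ba_Phi_inv : is_inv_modification (ca_Phi ba_colax)
}.

(** The full sub-2-category spanned by a family [f] of objects; its objects are
    the indices of the family, so that repeated values remain distinct. *)
Definition full_sub_bicat (X : bicat) (I : Type) (f : I -> X) : bicat :=
  @Bicat I (fun i j => hom (f i) (f j)) (fun i j => @cell X (f i) (f j))
    (fun i => id1 (f i)) (fun i j k => @comp1 X (f i) (f j) (f k))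
    (fun i j => @id2 X (f i) (f j)) (fun i j => @vcomp X (f i) (f j))
    (fun i j k => @lw X (f i) (f j) (f k)) (fun i j k => @rw X (f i) (f j) (f k))
    (fun i j => @lu X (f i) (f j)) (fun i j => @lui X (f i) (f j))
    (fun i j => @ru X (f i) (f j)) (fun i j => @rui X (f i) (f j))
    (fun i j k l => @asc X (f i) (f j) (f k) (f l))
    (fun i j k l => @asci X (f i) (f j) (f k) (f l))
    (fun i j => @vid_l X (f i) (f j)) (fun i j => @vid_r X (f i) (f j))
    (fun i j => @vassoc X (f i) (f j))
    (fun i j k => @lw_id X (f i) (f j) (f k)) (fun i j k => @lw_v X (f i) (f j) (f k))
    (fun i j k => @rw_id X (f i) (f j) (f k)) (fun i j k => @rw_v X (f i) (f j) (f k))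
    (fun i j k => @exch X (f i) (f j) (f k))
    (fun i j => @lu_nat X (f i) (f j)) (fun i j => @ru_nat X (f i) (f j))
    (fun i j k l => @asc_nat_l X (f i) (f j) (f k) (f l))
    (fun i j k l => @asc_nat_m X (f i) (f j) (f k) (f l))
    (fun i j k l => @asc_nat_r X (f i) (f j) (f k) (f l))
    (fun i j => @lu_lui X (f i) (f j)) (fun i j => @lui_lu X (f i) (f j))
    (fun i j => @ru_rui X (f i) (f j)) (fun i j => @rui_ru X (f i) (f j))
    (fun i j k l => @asc_asci X (f i) (f j) (f k) (f l))
    (fun i j k l => @asci_asc X (f i) (f j) (f k) (f l))
    (fun i j k => @triangle X (f i) (f j) (f k))
    (fun i j k l m => @pentagon X (f i) (f j) (f k) (f l) (f m)).

Lemma full_sub_strict (X : two_cat) (I : Type) (f : I -> X) : is_strict (full_sub_bicat f).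
Proof.
by split=> *; [apply: (strict_lu (tc_strict X))|apply: (strict_ru (tc_strict X))|apply: (strict_asc (tc_strict X))].
Qed.

Definition full_sub (X : two_cat) (I : Type) (f : I -> X) : two_cat :=
  TwoCat (full_sub_strict f).

Section Inv.
Context {X : bicat}.

Lemma inv_id2 (A B : X) (f : hom A B) : is_inv2 (id2 f).
Proof. by exists (id2 f); rewrite vid_l. Qed.

Lemma inv_vcomp (A B : X) (f g h : hom A B) (t : g ⇒ h) (s : f ⇒ g) :
  is_inv2 t -> is_inv2 s -> is_inv2 (t • s).
Proof.
move=> [t' [t1 t2]] [s' [s1 s2]]; exists (s' • t'); split.
- by rewrite vassoc (ch2 t1) vid_l.
- by rewrite vassoc (ch2 s2) vid_l.
Qed.

Lemma inv_lw (A B C : X) (g : hom B C) (f f' : hom A B) (s : f ⇒ f') :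
  is_inv2 s -> is_inv2 (g ◁ s).
Proof. by move=> [t [H1 H2]]; exists (g ◁ t); rewrite -!lw_v H1 H2 !lw_id. Qed.

Lemma inv_rw (A B C : X) (g g' : hom B C) (s : g ⇒ g') (f : hom A B) :
  is_inv2 s -> is_inv2 (s ▷ f).
Proof. by move=> [t [H1 H2]]; exists (t ▷ f); rewrite -!rw_v H1 H2 !rw_id. Qed.

Lemma inv_lu (A B : X) (f : hom A B) : is_inv2 (lu f).
Proof. by exists (lui f); rewrite lu_lui lui_lu. Qed.
Lemma inv_lui (A B : X) (f : hom A B) : is_inv2 (lui f).
Proof. by exists (lu f); rewrite lu_lui lui_lu. Qed.
Lemma inv_ru (A B : X) (f : hom A B) : is_inv2 (ru f).
Proof. by exists (rui f); rewrite ru_rui rui_ru. Qed.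
Lemma inv_rui (A B : X) (f : hom A B) : is_inv2 (rui f).
Proof. by exists (ru f); rewrite ru_rui rui_ru. Qed.
Lemma inv_asc (A B C E : X) (h : hom C E) (g : hom B C) (f : hom A B) :
  is_inv2 (asc h g f).
Proof. by exists (asci h g f); rewrite asc_asci asci_asc. Qed.
Lemma inv_asci (A B C E : X) (h : hom C E) (g : hom B C) (f : hom A B) :
  is_inv2 (asci h g f).
Proof. by exists (asc h g f); rewrite asc_asci asci_asc. Qed.

Lemma inv_pfc (Y : bicat) (K : pseudofunctor Y X) (A B C : Y) (g : hom B C) (f : hom A B) :
  is_inv2 (pfc K g f).
Proof. by exists (pfci K g f); rewrite pfc_pfci pfci_pfc. Qed.
Lemma inv_pfu (Y : bicat) (K : pseudofunctor Y X) (A : Y) : is_inv2 (pfu K A).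
Proof. by exists (pfui K A); rewrite pfu_pfui pfui_pfu. Qed.

End Inv.

Create HintDb inv2.
#[export] Hint Resolve inv_id2 inv_vcomp inv_lw inv_rw inv_lu inv_lui inv_ru inv_rui
  inv_asc inv_asci inv_pfc inv_pfu : inv2.

(** The unit [1 ⇒ T] and the multiplication [T T ⇒ T] are pseudonatural; the
    modifications express associativity [m ∘ T m ≅ m ∘ m T] and the two unit
    laws [m ∘ u T ≅ 1], [m ∘ T u ≅ 1]. The equations are the pentagon for the
    two 2-cells [m ∘ T m ∘ T T m ⇒ m ∘ m T ∘ m T T] and the triangle for the two
    2-cells [m ∘ T m ∘ T u T ⇒ m]. *)
Record pseudomonad (X : bicat) := Pseudomonad {
  pm_fun :> pseudofunctor X X;
  pm_unit : colax_nat (pf_id X) pm_fun;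
  pm_mult : colax_nat (pf_comp pm_fun pm_fun) pm_fun;
  pm_unit_inv : is_pseudonatural pm_unit;
  pm_mult_inv : is_pseudonatural pm_mult;
  pm_asc : modification (K' := pm_fun)
    (cx_comp pm_mult (cx_post pm_fun pm_mult)) (cx_comp pm_mult (cx_pre pm_mult pm_fun));
  pm_lunit : modification (K := pm_fun) (K' := pm_fun)
    (cx_comp pm_mult (cx_pre pm_unit pm_fun)) (cx_id pm_fun);
  pm_runit : modification (K := pm_fun) (K' := pm_fun)
    (cx_comp pm_mult (cx_post pm_fun pm_unit)) (cx_id pm_fun);
  pm_asc_inv : is_inv_modification pm_asc;
  pm_lunit_inv : is_inv_modification pm_lunit;
  pm_runit_inv : is_inv_modification pm_runit;
  pm_pentagon : forall A : X,
    asc (pm_mult A) (pm_mult (pm_fun A)) (pm_mult (pm_fun (pm_fun A)))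
    • (pm_asc A ▷ pm_mult (pm_fun (pm_fun A)))
    • asci _ _ _
    • (pm_mult A ◁ cx2 pm_mult (pm_mult A))
    • asc _ _ _
    • (pm_asc A ▷ fm pm_fun (fm pm_fun (pm_mult A)))
    • asci _ _ _
    = (pm_mult A ◁ pm_asc (pm_fun A))
    • asc _ _ _
    • (pm_asc A ▷ fm pm_fun (pm_mult (pm_fun A)))
    • asci _ _ _
    • (pm_mult A ◁ (pfc pm_fun (pm_mult A) (pm_mult (pm_fun A))
                     • pf2 pm_fun (pm_asc A)
                     • pfci pm_fun (pm_mult A) (fm pm_fun (pm_mult A))));
  pm_triangle : forall A : X,
    (pm_mult A ◁ pm_runit (pm_fun A))
    • asc (pm_mult A) (pm_mult (pm_fun A)) (fm pm_fun (pm_unit (pm_fun A)))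
    • (pm_asc A ▷ fm pm_fun (pm_unit (pm_fun A)))
    • asci _ _ _
    = pm_mult A ◁ (pfu pm_fun (pm_fun A) • pf2 pm_fun (pm_lunit A)
                    • pfci pm_fun (pm_mult A) (pm_unit (pm_fun A)))
}.

Section Algebras.
Context {X : bicat} (T : pseudomonad X).

(** Pseudo-[T]-algebras [a : T A → A], with invertible 2-cells [a ∘ T a ⇒ a ∘ m_A]
    and [a ∘ u_A ⇒ 1] subject to the pentagon and the triangle of [pseudomonad];
    the other unit law is a consequence of these. *)
Record ps_alg := PsAlg {
  pa_ob :> X;
  pa_act : hom (T pa_ob) pa_ob;
  pa_mult : pa_act ∘ fm T pa_act ⇒ pa_act ∘ pm_mult T pa_ob;
  pa_unit : pa_act ∘ pm_unit T pa_ob ⇒ id1 pa_ob;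
  pa_mult_inv : is_inv2 pa_mult;
  pa_unit_inv : is_inv2 pa_unit;
  pa_pentagon :
    asc pa_act (pm_mult T pa_ob) (pm_mult T (T pa_ob))
    • (pa_mult ▷ pm_mult T (T pa_ob))
    • asci _ _ _
    • (pa_act ◁ cx2 (pm_mult T) pa_act)
    • asc _ _ _
    • (pa_mult ▷ fm T (fm T pa_act))
    • asci _ _ _
    = (pa_act ◁ pm_asc T pa_ob)
    • asc _ _ _
    • (pa_mult ▷ fm T (pm_mult T pa_ob))
    • asci _ _ _
    • (pa_act ◁ (pfc T pa_act (pm_mult T pa_ob) • pf2 T pa_mult
                  • pfci T pa_act (fm T pa_act)));
  pa_triangle :
    (pa_act ◁ pm_runit T pa_ob)
    • asc pa_act (pm_mult T pa_ob) (fm T (pm_unit T pa_ob))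
    • (pa_mult ▷ fm T (pm_unit T pa_ob))
    • asci _ _ _
    = pa_act ◁ (pfu T pa_ob • pf2 T pa_unit • pfci T pa_act (pm_unit T pa_ob))
}.

Record ps_mor (A B : ps_alg) := PsMor {
  pm1 :> hom (pa_ob A) (pa_ob B);
  pm2 : pa_act B ∘ fm T pm1 ⇒ pm1 ∘ pa_act A;
  pm2_inv : is_inv2 pm2;
  pm2_mult :
    (pm1 ◁ pa_mult A)
    • asc pm1 (pa_act A) (fm T (pa_act A))
    • (pm2 ▷ fm T (pa_act A))
    • asci _ _ _
    • (pa_act B ◁ (pfc T pm1 (pa_act A) • pf2 T pm2 • pfci T (pa_act B) (fm T pm1)))
    = asc pm1 (pa_act A) (pm_mult T A)
    • (pm2 ▷ pm_mult T A)
    • asci _ _ _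
    • (pa_act B ◁ cx2 (pm_mult T) pm1)
    • asc _ _ _
    • (pa_mult B ▷ fm T (fm T pm1))
    • asci _ _ _;
  pm2_unit :
    (pm1 ◁ pa_unit A)
    • asc pm1 (pa_act A) (pm_unit T A)
    • (pm2 ▷ pm_unit T A)
    • asci _ _ _
    • (pa_act B ◁ cx2 (pm_unit T) pm1)
    = rui pm1 • lu pm1 • (pa_unit B ▷ pm1) • asci (pa_act B) (pm_unit T B) pm1
}.

Record ps_cell (A B : ps_alg) (f g : ps_mor A B) := PsCell {
  pc :> pm1 f ⇒ pm1 g;
  pc_eq : (pc ▷ pa_act A) • pm2 f = pm2 g • (pa_act B ◁ pf2 T pc)
}.

Lemma ps_cell_ext (A B : ps_alg) (f g : ps_mor A B) (s t : ps_cell f g) :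
  pc s = pc t -> s = t.
Proof.
case: s t => s Hs [t Ht] /= H; subst t; by rewrite (proof_irrelevance _ Hs Ht).
Qed.

Definition ps_id2 (A B : ps_alg) (f : ps_mor A B) : ps_cell f f.
Proof. by exists (id2 f); rewrite pf2_id rw_id lw_id vid_l vid_r. Defined.

Definition ps_vcomp (A B : ps_alg) (f g h : ps_mor A B) (t : ps_cell g h) (s : ps_cell f g) :
  ps_cell f h.
Proof.
exists (t • s); rewrite pf2_v rw_v lw_v vassoc pc_eq -vassoc pc_eq.
by rewrite vassoc.
Defined.

Definition ps_id1_cell (A : ps_alg) :
  pa_act A ∘ fm T (id1 (pa_ob A)) ⇒ id1 (pa_ob A) ∘ pa_act A :=
  lui (pa_act A) • ru (pa_act A) • (pa_act A ◁ pfu T A).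

Lemma ps_id1_mult (A : ps_alg) :
  (id1 (pa_ob A) ◁ pa_mult A)
    • asc (id1 (pa_ob A)) (pa_act A) (fm T (pa_act A))
    • (ps_id1_cell A ▷ fm T (pa_act A))
    • asci _ _ _
    • (pa_act A ◁ (pfc T (id1 (pa_ob A)) (pa_act A) • pf2 T (ps_id1_cell A)
                    • pfci T (pa_act A) (fm T (id1 (pa_ob A)))))
    = asc (id1 (pa_ob A)) (pa_act A) (pm_mult T A)
    • (ps_id1_cell A ▷ pm_mult T A)
    • asci _ _ _
    • (pa_act A ◁ cx2 (pm_mult T) (id1 (pa_ob A)))
    • asc _ _ _
    • (pa_mult A ▷ fm T (fm T (id1 (pa_ob A))))
    • asci _ _ _.
Proof.
rewrite /ps_id1_cell.
bicat_use (pf_id_conj (T := T) (pa_act A)) E.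
have /= H := cn_unit (pm_mult T) A.
bicat_use H E'.
bicat_nat (pa_mult A) N Nk.
bicat_nf.
rewrite (lch4 (E _ _)) !(lw_v, Nk, N).
by rewrite -[RHS]vassoc (lch (E' _ _)) lw_v vassoc.
Qed.

Lemma ps_id1_unit (A : ps_alg) :
  (id1 (pa_ob A) ◁ pa_unit A)
    • asc (id1 (pa_ob A)) (pa_act A) (pm_unit T A)
    • (ps_id1_cell A ▷ pm_unit T A)
    • asci _ _ _
    • (pa_act A ◁ cx2 (pm_unit T) (id1 (pa_ob A)))
    = rui _ • lu _ • (pa_unit A ▷ id1 (pa_ob A))
      • asci (pa_act A) (pm_unit T A) (id1 (pa_ob A)).
Proof.
rewrite /ps_id1_cell.
have /= H := cn_unit (pm_unit T) A.
bicat_use H E'.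
by bicat_nf; rewrite (lch (E' _ _)) lw_id vid_r.
Qed.

Lemma ps_id1_inv (A : ps_alg) : is_inv2 (ps_id1_cell A).
Proof. by rewrite /ps_id1_cell; auto with inv2. Qed.

Definition ps_id1 (A : ps_alg) : ps_mor A A :=
  PsMor (ps_id1_inv A) (ps_id1_mult A) (ps_id1_unit A).

Section Composition.
Context (A B C : ps_alg) (g : ps_mor B C) (f : ps_mor A B).

Definition ps_comp1_cell : pa_act C ∘ fm T (pm1 g ∘ pm1 f) ⇒ (pm1 g ∘ pm1 f) ∘ pa_act A :=
  asci (pm1 g) (pm1 f) (pa_act A) • (pm1 g ◁ pm2 f) • asc (pm1 g) (pa_act B) (fm T f)
  • (pm2 g ▷ fm T f) • asci (pa_act C) (fm T g) (fm T f) • (pa_act C ◁ pfc T g f).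

Lemma ps_comp1_inv : is_inv2 ps_comp1_cell.
Proof. by rewrite /ps_comp1_cell; move: (pm2_inv f) (pm2_inv g); auto 10 with inv2. Qed.

Lemma ps_comp1_mult :
  ((pm1 g ∘ pm1 f) ◁ pa_mult A)
    • asc (pm1 g ∘ pm1 f) (pa_act A) (fm T (pa_act A))
    • (ps_comp1_cell ▷ fm T (pa_act A))
    • asci _ _ _
    • (pa_act C ◁ (pfc T (pm1 g ∘ pm1 f) (pa_act A) • pf2 T ps_comp1_cell
                    • pfci T (pa_act C) (fm T (pm1 g ∘ pm1 f))))
    = asc (pm1 g ∘ pm1 f) (pa_act A) (pm_mult T A)
    • (ps_comp1_cell ▷ pm_mult T A)
    • asci _ _ _
    • (pa_act C ◁ cx2 (pm_mult T) (pm1 g ∘ pm1 f))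
    • asc _ _ _
    • (pa_mult C ▷ fm T (fm T (pm1 g ∘ pm1 f)))
    • asci _ _ _.
Proof.
rewrite /ps_comp1_cell.
bicat_use (pf_comp_conj (T := T) (pm2 f) (pm2 g)) E.
have /= H := cn_comp (pm_mult T) g f.
bicat_use H E'.
bicat_use (pm2_mult f) F.
bicat_use (pm2_mult g) G.
bicat_nat (pa_mult C) N Nk.
bicat_nat (pm2 g) M Mk.
bicat_nf.
rewrite (lch4 (E _ _)); simp2; rewrite !Mk (ch5 (lch5 (F _ _))); simp2.
rewrite (ch5 (G _ _)); simp2; rewrite -Mk Nk N.
by rewrite (ch2 (lch (E' _ _))); simp2.
Qed.

Lemma ps_comp1_unit :
  ((pm1 g ∘ pm1 f) ◁ pa_unit A)
    • asc (pm1 g ∘ pm1 f) (pa_act A) (pm_unit T A)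
    • (ps_comp1_cell ▷ pm_unit T A)
    • asci _ _ _
    • (pa_act C ◁ cx2 (pm_unit T) (pm1 g ∘ pm1 f))
    = rui _ • lu _ • (pa_unit C ▷ (pm1 g ∘ pm1 f))
      • asci (pa_act C) (pm_unit T C) (pm1 g ∘ pm1 f).
Proof.
rewrite /ps_comp1_cell.
have /= H := cn_comp (pm_unit T) g f.
bicat_use H E'.
bicat_use (pm2_unit f) F.
bicat_use (pm2_unit g) G.
bicat_nat (pm2 g) M Mk.
by bicat_nf; rewrite (lch (E' _ _)); simp2; rewrite Mk (ch3 (lch3 (F _ _))) G.
Qed.

Definition ps_comp1 : ps_mor A C := PsMor ps_comp1_inv ps_comp1_mult ps_comp1_unit.

End Composition.

Definition is_alg_cell (A B : ps_alg) (f g : ps_mor A B) (s : pm1 f ⇒ pm1 g) : Prop :=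
  (s ▷ pa_act A) • pm2 f = pm2 g • (pa_act B ◁ pf2 T s).

Lemma ps_cell_inv (A B : ps_alg) (f g : ps_mor A B) (s : ps_cell f g) (t : pm1 g ⇒ pm1 f) :
  t • pc s = id2 _ -> pc s • t = id2 _ -> is_alg_cell t.
Proof.
move=> ts st; rewrite /is_alg_cell.
rewrite -[pm2 g]vid_r -lw_id -pf2_id -st pf2_v lw_v -(vassoc (pm2 g)) -pc_eq.
by rewrite !vassoc -(vassoc (t ▷ _)) -rw_v ts rw_id vid_l.
Qed.

Lemma ps_lw_eq (A B C : ps_alg) (g : ps_mor B C) (f f' : ps_mor A B) (s : ps_cell f f') :
  @is_alg_cell _ _ (ps_comp1 g f) (ps_comp1 g f') (g ◁ pc s).
Proof.
rewrite /is_alg_cell /= /ps_comp1_cell.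
bicat_use (pc_eq s) E.
bicat_use (pfc_natl T g (pc s)) F.
bicat_nat (pm2 g) M Mk.
bicat_nf; rewrite (lch (F _ _)); simp2; rewrite Mk.
by rewrite (ch2 (lch (E _ _))); simp2.
Qed.

Lemma ps_rw_eq (A B C : ps_alg) (g g' : ps_mor B C) (s : ps_cell g g') (f : ps_mor A B) :
  @is_alg_cell _ _ (ps_comp1 g f) (ps_comp1 g' f) (pc s ▷ f).
Proof.
rewrite /is_alg_cell /= /ps_comp1_cell.
bicat_use (pc_eq s) E.
bicat_use (pfc_natr T (pc s) f) F.
bicat_nat (pc s) M Mk.
bicat_nf; rewrite (lch (F _ _)); simp2; rewrite Mk.
by rewrite (ch2 (E _ _)); simp2.
Qed.

Lemma ps_lu_eq (A B : ps_alg) (f : ps_mor A B) :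
  @is_alg_cell _ _ (ps_comp1 (ps_id1 B) f) f (lu f).
Proof.
rewrite /is_alg_cell /= /ps_comp1_cell /= /ps_id1_cell.
bicat_use (pf_lu T f) E.
by bicat_nf; rewrite -E; simp2.
Qed.

Lemma ps_ru_eq (A B : ps_alg) (f : ps_mor A B) :
  @is_alg_cell _ _ (ps_comp1 f (ps_id1 A)) f (ru f).
Proof.
rewrite /is_alg_cell /= /ps_comp1_cell /= /ps_id1_cell.
bicat_use (pf_ru T f) E.
bicat_nat (pm2 f) M Mk.
by bicat_nf; rewrite -E; simp2; rewrite Mk.
Qed.

Lemma ps_asc_eq (A B C D : ps_alg) (h : ps_mor C D) (g : ps_mor B C) (f : ps_mor A B) :
  @is_alg_cell _ _ (ps_comp1 (ps_comp1 h g) f) (ps_comp1 h (ps_comp1 g f)) (asc h g f).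
Proof.
rewrite /is_alg_cell /= /ps_comp1_cell /= /ps_comp1_cell.
bicat_use (pf_asc T h g f) E.
bicat_nat (pm2 h) M Mk.
by bicat_nf; rewrite (lch (E _ _)); simp2; rewrite Mk.
Qed.

Definition ps_lw (A B C : ps_alg) (g : ps_mor B C) (f f' : ps_mor A B) (s : ps_cell f f') :
  ps_cell (ps_comp1 g f) (ps_comp1 g f') := PsCell (ps_lw_eq g s).

Definition ps_rw (A B C : ps_alg) (g g' : ps_mor B C) (s : ps_cell g g') (f : ps_mor A B) :
  ps_cell (ps_comp1 g f) (ps_comp1 g' f) := PsCell (ps_rw_eq s f).

Definition ps_lu (A B : ps_alg) (f : ps_mor A B) : ps_cell (ps_comp1 (ps_id1 B) f) f :=
  PsCell (ps_lu_eq f).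

Definition ps_ru (A B : ps_alg) (f : ps_mor A B) : ps_cell (ps_comp1 f (ps_id1 A)) f :=
  PsCell (ps_ru_eq f).

Definition ps_asc (A B C D : ps_alg) (h : ps_mor C D) (g : ps_mor B C) (f : ps_mor A B) :
  ps_cell (ps_comp1 (ps_comp1 h g) f) (ps_comp1 h (ps_comp1 g f)) := PsCell (ps_asc_eq h g f).

Definition ps_lui (A B : ps_alg) (f : ps_mor A B) : ps_cell f (ps_comp1 (ps_id1 B) f) :=
  PsCell (@ps_cell_inv _ _ _ _ (ps_lu f) (lui _) (lui_lu _) (lu_lui _)).

Definition ps_rui (A B : ps_alg) (f : ps_mor A B) : ps_cell f (ps_comp1 f (ps_id1 A)) :=
  PsCell (@ps_cell_inv _ _ _ _ (ps_ru f) (rui _) (rui_ru _) (ru_rui _)).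

Definition ps_asci (A B C D : ps_alg) (h : ps_mor C D) (g : ps_mor B C) (f : ps_mor A B) :
  ps_cell (ps_comp1 h (ps_comp1 g f)) (ps_comp1 (ps_comp1 h g) f) :=
  PsCell (@ps_cell_inv _ _ _ _ (ps_asc h g f) (asci _ _ _) (asci_asc _ _ _) (asc_asci _ _ _)).

Program Definition ps_alg_bicat : bicat :=
  {| ob := ps_alg; hom := ps_mor; cell := ps_cell;
     id1 := ps_id1; comp1 := ps_comp1; id2 := ps_id2; vcomp := ps_vcomp;
     lw := ps_lw; rw := ps_rw; lu := ps_lu; lui := ps_lui; ru := ps_ru; rui := ps_rui;
     asc := ps_asc; asci := ps_asci |}.
Solve All Obligations with
  (intros; apply: ps_cell_ext; cbn;
   solve [apply: vid_l | apply: vid_r | apply: vassoc | apply: lw_id | apply: lw_v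
         | apply: rw_id | apply: rw_v | apply: exch | apply: lu_nat | apply: ru_nat
         | apply: asc_nat_l | apply: asc_nat_m | apply: asc_nat_r
         | apply: lu_lui | apply: lui_lu | apply: ru_rui | apply: rui_ru
         | apply: asc_asci | apply: asci_asc | apply: triangle | apply: pentagon]).

Lemma ps_idtocell (A B : ps_alg) (f g : ps_mor A B) (s : ps_cell f g) :
  (exists e : pm1 f = pm1 g, pc s = idtocell e) ->
  exists e : f = g, s = @idtocell ps_alg_bicat A B f g e.
Proof.
case: f g s => f f2 f2i fm fu [g g2 g2i gm gu] [s Hs] /= [e es].
subst s; destruct e; simpl in Hs |- *.
have H : f2 = g2 by have := Hs; rewrite pf2_id rw_id lw_id vid_l vid_r.
subst g2; move: Hs.
rewrite (proof_irrelevance _ g2i f2i) (proof_irrelevance _ gm fm) => Hs.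
move: Hs; rewrite (proof_irrelevance _ gu fu) => Hs.
by exists (eq_refl _); apply: ps_cell_ext.
Qed.

End Algebras.

Lemma ps_alg_strict (X : two_cat) (T : pseudomonad X) : is_strict (ps_alg_bicat T).
Proof.
split=> *; apply: ps_idtocell.
- exact: strict_lu (tc_strict X) _ _ _.
- exact: strict_ru (tc_strict X) _ _ _.
- exact: strict_asc (tc_strict X) _ _ _ _ _ _ _.
Qed.

Definition ps_alg_cat (X : two_cat) (T : pseudomonad X) : two_cat :=
  TwoCat (ps_alg_strict T).

Definition free_alg (X : bicat) (T : pseudomonad X) (A : X) : ps_alg T :=
  @PsAlg X T (T A) (pm_mult T A) (pm_asc T A) (pm_lunit T A)
    (pm_asc_inv T A) (pm_lunit_inv T A) (pm_pentagon T A) (pm_triangle T A).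

(** The objects of a Kleisli 2-category are the objects [A] of the base, standing
    for the free algebras on them. *)
Definition kleisli (X : two_cat) (T : pseudomonad X) : two_cat :=
  @full_sub (ps_alg_cat T) X (free_alg T).

Section Free.
Context {X : bicat} (T : pseudomonad X).

Lemma free_mor_mult (A B : X) (f : hom A B) :
  (fm T f ◁ pm_asc T A)
    • asc (fm T f) (pm_mult T A) (fm T (pm_mult T A))
    • (cx2 (pm_mult T) f ▷ fm T (pm_mult T A))
    • asci _ _ _
    • (pm_mult T B ◁ (pfc T (fm T f) (pm_mult T A) • pf2 T (cx2 (pm_mult T) f)
                       • pfci T (pm_mult T B) (fm T (fm T f))))
    = asc (fm T f) (pm_mult T A) (pm_mult T (T A))
    • (cx2 (pm_mult T) f ▷ pm_mult T (T A))
    • asci _ _ _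
    • (pm_mult T B ◁ cx2 (pm_mult T) (fm T f))
    • asc _ _ _
    • (pm_asc T B ▷ fm T (fm T (fm T f)))
    • asci _ _ _.
Proof.
have /= E := md_nat (pm_asc T) f.
bicat_use E E'.
by bicat_nf; apply: E'.
Qed.

Lemma free_mor_unit (A B : X) (f : hom A B) :
  (fm T f ◁ pm_lunit T A)
    • asc (fm T f) (pm_mult T A) (pm_unit T (T A))
    • (cx2 (pm_mult T) f ▷ pm_unit T (T A))
    • asci _ _ _
    • (pm_mult T B ◁ cx2 (pm_unit T) (fm T f))
    = rui (fm T f) • lu (fm T f) • (pm_lunit T B ▷ fm T f)
      • asci (pm_mult T B) (pm_unit T (T B)) (fm T f).
Proof.
have /= E := md_nat (pm_lunit T) f.
bicat_use E E'.
by bicat_nf; apply: E'.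
Qed.

Definition free_mor (A B : X) (f : hom A B) : ps_mor (free_alg T A) (free_alg T B) :=
  @PsMor X T (free_alg T A) (free_alg T B) (fm T f) (cx2 (pm_mult T) f)
    (pm_mult_inv T f) (free_mor_mult f) (free_mor_unit f).

Definition free_cell (A B : X) (f g : hom A B) (s : f ⇒ g) :
  ps_cell (free_mor f) (free_mor g) :=
  @PsCell X T _ _ (free_mor f) (free_mor g) (pf2 T s) (cn_nat (pm_mult T) s).

Lemma free_pfc_eq (A B C : X) (g : hom B C) (f : hom A B) :
  @is_alg_cell X T _ _ (free_mor (g ∘ f)) (ps_comp1 (free_mor g) (free_mor f)) (pfc T g f).
Proof.
rewrite /is_alg_cell /= /ps_comp1_cell /=.
have /= E := cn_comp (pm_mult T) g f.
by rewrite !vassoc -lw_v.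
Qed.

Lemma free_pfu_eq (A : X) :
  @is_alg_cell X T _ _ (free_mor (id1 A)) (ps_id1 (free_alg T A)) (pfu T A).
Proof.
rewrite /is_alg_cell /= /ps_id1_cell /=.
have /= E := cn_unit (pm_mult T) A.
by rewrite !vassoc -lw_v.
Qed.

Definition free_pfc (A B C : X) (g : hom B C) (f : hom A B) :
  ps_cell (free_mor (g ∘ f)) (ps_comp1 (free_mor g) (free_mor f)) :=
  PsCell (free_pfc_eq g f).

Definition free_pfci (A B C : X) (g : hom B C) (f : hom A B) :
  ps_cell (ps_comp1 (free_mor g) (free_mor f)) (free_mor (g ∘ f)) :=
  PsCell (@ps_cell_inv _ _ _ _ _ _ (free_pfc g f) (pfci T g f)
    (pfci_pfc T g f) (pfc_pfci T g f)).

Definition free_pfu (A : X) : ps_cell (free_mor (id1 A)) (ps_id1 (free_alg T A)) :=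
  PsCell (free_pfu_eq A).

Definition free_pfui (A : X) : ps_cell (ps_id1 (free_alg T A)) (free_mor (id1 A)) :=
  PsCell (@ps_cell_inv _ _ _ _ _ _ (free_pfu A) (pfui T A) (pfui_pfu T A) (pfu_pfui T A)).

End Free.

Program Definition free_pf (X : two_cat) (T : pseudomonad X) :
  pseudofunctor X (kleisli T) :=
  @Pseudofunctor X (kleisli T) (@Prefun X (kleisli T) (fun A => A) (free_mor T))
    (@free_cell X T) (@free_pfc X T) (@free_pfci X T) (@free_pfu X T) (@free_pfui X T)
    _ _ _ _ _ _ _ _ _ _ _.
Solve All Obligations with
  (intros; apply: ps_cell_ext; cbn;
   solve [apply: pf2_id | apply: pf2_v | apply: pfc_natl | apply: pfc_natr
         | apply: pfc_pfci | apply: pfci_pfc | apply: pfu_pfui | apply: pfui_pfu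
         | apply: pf_asc | apply: pf_lu | apply: pf_ru]).

Section Lan.
Context {X : bicat}.

(** [e : f ⇒ l ∘ j] exhibits [l] as a left Kan extension of [f] along [j]. *)
Definition is_lan (A B C : X) (j : hom A B) (f : hom A C) (l : hom B C) (e : f ⇒ l ∘ j) :
  Prop :=
  forall (g : hom B C) (t : f ⇒ g ∘ j), exists! s : l ⇒ g, (s ▷ j) • e = t.

Definition preserves_lan (A B C C' : X) (h : hom C C') (j : hom A B) (f : hom A C)
  (l : hom B C) (e : f ⇒ l ∘ j) : Prop :=
  is_lan (asci h l j • (h ◁ e)).

Definition lan_desc (A B C : X) (j : hom A B) (f : hom A C) (l : hom B C) (e : f ⇒ l ∘ j)
  (H : is_lan e) (g : hom B C) (t : f ⇒ g ∘ j) : l ⇒ g :=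
  proj1_sig (constructive_indefinite_description _ (H g t)).

Lemma lan_comm (A B C : X) (j : hom A B) (f : hom A C) (l : hom B C) (e : f ⇒ l ∘ j)
  (H : is_lan e) (g : hom B C) (t : f ⇒ g ∘ j) : (lan_desc H t ▷ j) • e = t.
Proof.
by rewrite /lan_desc; case: (constructive_indefinite_description _ _) => s [].
Qed.

Lemma lan_ext (A B C : X) (j : hom A B) (f : hom A C) (l : hom B C) (e : f ⇒ l ∘ j)
  (H : is_lan e) (g : hom B C) (s t : l ⇒ g) : (s ▷ j) • e = (t ▷ j) • e -> s = t.
Proof. by move=> E; case: (H g ((t ▷ j) • e)) => r [_ U]; rewrite -(U s E) -(U t). Qed.

Lemma lan_precomp (A B C : X) (j : hom A B) (f f' : hom A C) (l : hom B C) (e : f ⇒ l ∘ j)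
  (a : f' ⇒ f) : is_inv2 a -> is_lan e -> is_lan (e • a).
Proof.
move=> [b [ba ab]] H g t; exists (lan_desc H (t • b)); split.
- by rewrite -vassoc lan_comm vassoc ba vid_r.
- by move=> s Hs; apply: (lan_ext H); rewrite lan_comm -Hs !vassoc ab vid_r.
Qed.

Lemma lan_postcomp (A B C : X) (j : hom A B) (f : hom A C) (l l' : hom B C) (e : f ⇒ l ∘ j)
  (a : l ⇒ l') : is_inv2 a -> is_lan e -> is_lan ((a ▷ j) • e).
Proof.
move=> [b [ba ab]] H g t; exists (lan_desc H t • b); split.
- by rewrite rw_v !vassoc -(vassoc (b ▷ j)) -rw_v ba rw_id vid_l lan_comm.
- move=> s Hs; have -> : lan_desc H t = s • a.
    by apply: (lan_ext H); rewrite lan_comm rw_v vassoc.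
  by rewrite vassoc ab vid_r.
Qed.

Lemma lan_desc_inv (A B C : X) (j : hom A B) (f : hom A C) (l l' : hom B C)
  (e : f ⇒ l ∘ j) (e' : f ⇒ l' ∘ j) (H : is_lan e) : is_lan e' -> is_inv2 (lan_desc H e').
Proof.
move=> H'; exists (lan_desc H' e); split.
- by apply: (lan_ext H); rewrite rw_v vassoc !lan_comm rw_id vid_l.
- by apply: (lan_ext H'); rewrite rw_v vassoc !lan_comm rw_id vid_l.
Qed.

End Lan.

(** Lax-idempotent pseudomonads, presented by their left Kan extensions. *)
Record left_kan_pseudomonad (X : bicat) := LeftKanPseudomonad {
  lk_ob :> X -> X;
  lk_y : forall A : X, hom A (lk_ob A);
  lk_ext : forall (A B : X) (f : hom A (lk_ob B)), hom (lk_ob A) (lk_ob B);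
  lk_cell : forall (A B : X) (f : hom A (lk_ob B)), f ⇒ lk_ext f ∘ lk_y A;
  lk_cell_inv : forall (A B : X) (f : hom A (lk_ob B)), is_inv2 (lk_cell f);
  lk_lan : forall (A B : X) (f : hom A (lk_ob B)), is_lan (lk_cell f);
  lk_lan_id : forall A : X, is_lan (lui (lk_y A));
  lk_preserves : forall (A B C : X) (g : hom B (lk_ob C)) (f : hom A (lk_ob B)),
    preserves_lan (lk_ext g) (lk_cell f)
}.

Arguments lk_y {X} l A.
Arguments lk_ext {X} l {A B} f.
Arguments lk_cell {X} l {A B} f.
Arguments lk_cell_inv {X} l {A B} f.
Arguments lk_lan {X} l {A B} f.
Arguments lk_lan_id {X} l A.
Arguments lk_preserves {X} l {A B C} g f.

Section KanAlgebras.
Context {X : bicat} (D : left_kan_pseudomonad X).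

Record lk_alg := LkAlg {
  la_ob :> X;
  la_ext : forall (B : X) (f : hom B la_ob), hom (D B) la_ob;
  la_cell : forall (B : X) (f : hom B la_ob), f ⇒ la_ext f ∘ lk_y D B;
  la_cell_inv : forall (B : X) (f : hom B la_ob), is_inv2 (la_cell f);
  la_lan : forall (B : X) (f : hom B la_ob), is_lan (la_cell f);
  la_preserves : forall (A B : X) (g : hom B la_ob) (f : hom A (D B)),
    preserves_lan (la_ext g) (lk_cell D f)
}.

Arguments la_lan _ {B} f.

Record lk_mor (C C' : lk_alg) := LkMor {
  lm1 :> hom (la_ob C) (la_ob C');
  lm_preserves : forall (B : X) (f : hom B C), preserves_lan lm1 (la_cell f)
}.

Arguments lm_preserves {C C'} l {B} f.

Lemma lk_id1_preserves (C : lk_alg) (B : X) (f : hom B C) :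
  preserves_lan (id1 (la_ob C)) (la_cell f).
Proof.
rewrite /preserves_lan.
have -> : asci (id1 (la_ob C)) (la_ext f) (lk_y D B) • (id1 (la_ob C) ◁ la_cell f)
  = (lui (la_ext f) ▷ lk_y D B) • la_cell f • lu f by bicat_nf.
rewrite -vassoc; apply: (lan_precomp (inv_lu _)).
apply: (lan_postcomp (inv_lui _)); exact: la_lan.
Qed.

Lemma lk_comp1_preserves (C C' C'' : lk_alg) (k : lk_mor C' C'') (h : lk_mor C C')
  (B : X) (f : hom B C) :
  preserves_lan (lm1 k ∘ lm1 h) (la_cell f).
Proof.
rewrite /preserves_lan.
have H := lm_preserves h f; have H' := la_lan C' (h ∘ f).
set e := asci h (la_ext f) (lk_y D B) • (h ◁ la_cell f).
have E : (lan_desc H' e ▷ lk_y D B) • la_cell (h ∘ f) = e := lan_comm H' e.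
have I := lan_desc_inv H' H.
have -> : asci (k ∘ h) (la_ext f) (lk_y D B) • ((k ∘ h) ◁ la_cell f)
  = ((asci k h (la_ext f) • (k ◁ lan_desc H' e)) ▷ lk_y D B)
    • (asci k (la_ext (h ∘ f)) (lk_y D B) • (k ◁ la_cell (h ∘ f))) • asc k h f.
  rewrite /e in E *; bicat_use E E'.
  by bicat_nf; rewrite (lch (E' _ _)).
rewrite -vassoc; apply: (lan_precomp (inv_asc _ _ _)).
apply: lan_postcomp; last exact: (lm_preserves k (h ∘ f)).
by apply: inv_vcomp; [apply: inv_asci | apply: inv_lw].
Qed.

Definition lk_id1 (C : lk_alg) : lk_mor C C := @LkMor C C _ (@lk_id1_preserves C).

Definition lk_comp1 (C C' C'' : lk_alg) (k : lk_mor C' C'') (h : lk_mor C C') : lk_mor C C'' :=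
  @LkMor C C'' _ (@lk_comp1_preserves C C' C'' k h).

Program Definition lk_alg_bicat : bicat :=
  {| ob := lk_alg; hom := lk_mor; cell := fun C C' h k => lm1 h ⇒ lm1 k;
     id1 := lk_id1; comp1 := lk_comp1;
     id2 := fun _ _ h => id2 (lm1 h); vcomp := fun _ _ _ _ _ t s => t • s;
     lw := fun _ _ _ k _ _ s => lm1 k ◁ s; rw := fun _ _ _ _ _ s h => s ▷ lm1 h;
     lu := fun _ _ h => lu (lm1 h); lui := fun _ _ h => lui (lm1 h);
     ru := fun _ _ h => ru (lm1 h); rui := fun _ _ h => rui (lm1 h);
     asc := fun _ _ _ _ k h g => asc (lm1 k) (lm1 h) (lm1 g);
     asci := fun _ _ _ _ k h g => asci (lm1 k) (lm1 h) (lm1 g) |}.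
Solve All Obligations with
  (intros; cbn;
   solve [apply: vid_l | apply: vid_r | apply: vassoc | apply: lw_id | apply: lw_v
         | apply: rw_id | apply: rw_v | apply: exch | apply: lu_nat | apply: ru_nat
         | apply: asc_nat_l | apply: asc_nat_m | apply: asc_nat_r
         | apply: lu_lui | apply: lui_lu | apply: ru_rui | apply: rui_ru
         | apply: asc_asci | apply: asci_asc | apply: triangle | apply: pentagon]).

Lemma lk_idtocell (C C' : lk_alg) (h k : lk_mor C C') (s : lm1 h ⇒ lm1 k) :
  (exists e : lm1 h = lm1 k, s = idtocell e) ->
  exists e : h = k, s = @idtocell lk_alg_bicat C C' h k e.
Proof.
case: h k s => h Hh [k Hk] s /= [e ->]; destruct e.
by rewrite (proof_irrelevance _ Hk Hh); exists (eq_refl _).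
Qed.

Definition free_lk_alg (A : X) : lk_alg :=
  @LkAlg (D A) (fun B f => lk_ext D f) (fun B f => lk_cell D f)
    (fun B f => lk_cell_inv D f) (fun B f => lk_lan D f)
    (fun B C g f => lk_preserves D g f).

Definition free_lk_mor (A B : X) (f : hom A B) : lk_mor (free_lk_alg A) (free_lk_alg B) :=
  @LkMor (free_lk_alg A) (free_lk_alg B) (lk_ext D (lk_y D B ∘ f))
    (fun Z g => lk_preserves D (lk_y D B ∘ f) g).

Definition jm (A B : X) (f : hom A B) : hom (D A) (D B) := lk_ext D (lk_y D B ∘ f).

Definition jc (A B : X) (f : hom A B) : lk_y D B ∘ f ⇒ jm f ∘ lk_y D A :=
  lk_cell D (lk_y D B ∘ f).

Definition jc_lan (A B : X) (f : hom A B) : is_lan (jc f) := lk_lan D _.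

Definition jc2 (A B C : X) (g : hom B C) (f : hom A B) :
  lk_y D C ∘ (g ∘ f) ⇒ (jm g ∘ jm f) ∘ lk_y D A :=
  asci _ _ _ • (jm g ◁ jc f) • asc _ _ _ • (jc g ▷ f) • asci _ _ _.

Definition jc0 (A : X) : lk_y D A ∘ id1 A ⇒ id1 (D A) ∘ lk_y D A := lui _ • ru _.

Lemma jc2_lan (A B C : X) (g : hom B C) (f : hom A B) : is_lan (jc2 g f).
Proof.
rewrite /jc2 -(vassoc (asci _ _ _)); apply: lan_precomp; last exact: lk_preserves.
by move: (lk_cell_inv D (lk_y D C ∘ g)); rewrite -/(jc g); auto 10 with inv2.
Qed.

Lemma jc0_lan (A : X) : is_lan (jc0 A).
Proof. exact: lan_precomp (inv_ru _) (lk_lan_id D A). Qed.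

Arguments jc_lan {A B} f.
Arguments jc2_lan {A B C} g f.
Arguments jc0_lan : clear implicits.

Definition j2 (A B : X) (f g : hom A B) (s : f ⇒ g) : jm f ⇒ jm g :=
  lan_desc (jc_lan f) (jc g • (lk_y D B ◁ s)).

Definition jpfc (A B C : X) (g : hom B C) (f : hom A B) : jm (g ∘ f) ⇒ jm g ∘ jm f :=
  lan_desc (jc_lan (g ∘ f)) (jc2 g f).

Definition jpfu (A : X) : jm (id1 A) ⇒ id1 (D A) := lan_desc (jc_lan (id1 A)) (jc0 A).

Definition jpfci (A B C : X) (g : hom B C) (f : hom A B) : jm g ∘ jm f ⇒ jm (g ∘ f) :=
  lan_desc (jc2_lan g f) (jc (g ∘ f)).

Definition jpfui (A : X) : id1 (D A) ⇒ jm (id1 A) := lan_desc (jc0_lan A) (jc (id1 A)).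

Lemma j2E (A B : X) (f g : hom A B) (s : f ⇒ g) :
  (j2 s ▷ lk_y D A) • jc f = jc g • (lk_y D B ◁ s).
Proof. exact: lan_comm. Qed.

Lemma jpfcE (A B C : X) (g : hom B C) (f : hom A B) :
  (jpfc g f ▷ lk_y D A) • jc (g ∘ f)
  = asci _ _ _ • (jm g ◁ jc f) • asc _ _ _ • (jc g ▷ f) • asci _ _ _.
Proof. exact: lan_comm. Qed.

Lemma jpfuE (A : X) : (jpfu A ▷ lk_y D A) • jc (id1 A) = lui _ • ru _.
Proof. exact: lan_comm. Qed.

Lemma j2_id (A B : X) (f : hom A B) : j2 (id2 f) = id2 (jm f).
Proof. by apply: (lan_ext (jc_lan f)); rewrite j2E lw_id rw_id vid_l vid_r. Qed.

Lemma j2_v (A B : X) (f g h : hom A B) (t : g ⇒ h) (s : f ⇒ g) : j2 (t • s) = j2 t • j2 s.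
Proof.
apply: (lan_ext (jc_lan f)).
by rewrite j2E rw_v lw_v vassoc j2E -!vassoc j2E.
Qed.

Lemma jpfc_natl (A B C : X) (g : hom B C) (f f' : hom A B) (s : f ⇒ f') :
  jpfc g f' • j2 (g ◁ s) = (jm g ◁ j2 s) • jpfc g f.
Proof.
apply: (lan_ext (jc_lan _)).
bicat_use (j2E (g ◁ s)) E1; bicat_use (j2E s) E2.
bicat_use (jpfcE g f) E3; bicat_use (jpfcE g f') E4.
bicat_nat (jc g) N Nk.
bicat_nf; rewrite E1 (ch2 (E4 _ _)) E3; simp2.
by rewrite (ch2 (lch (E2 _ _))); simp2; rewrite N.
Qed.

Lemma jpfc_natr (A B C : X) (g g' : hom B C) (s : g ⇒ g') (f : hom A B) :
  jpfc g' f • j2 (s ▷ f) = (j2 s ▷ jm f) • jpfc g f.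
Proof.
apply: (lan_ext (jc_lan _)).
bicat_use (j2E (s ▷ f)) E1; bicat_use (j2E s) E2.
bicat_use (jpfcE g f) E3; bicat_use (jpfcE g' f) E4.
bicat_nat (j2 s) N Nk.
bicat_nf; rewrite E1 (ch2 (E4 _ _)) E3; simp2.
by rewrite Nk E2.
Qed.

Lemma jpfc_inv1 (A B C : X) (g : hom B C) (f : hom A B) : jpfc g f • jpfci g f = id2 _.
Proof.
apply: (lan_ext (jc2_lan g f)).
by rewrite rw_v vassoc !lan_comm rw_id vid_l.
Qed.

Lemma jpfc_inv2 (A B C : X) (g : hom B C) (f : hom A B) : jpfci g f • jpfc g f = id2 _.
Proof.
apply: (lan_ext (jc_lan (g ∘ f))).
by rewrite rw_v vassoc !lan_comm rw_id vid_l.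
Qed.

Lemma jpfu_inv1 (A : X) : jpfu A • jpfui A = id2 _.
Proof.
apply: (lan_ext (jc0_lan A)).
by rewrite rw_v vassoc !lan_comm rw_id vid_l.
Qed.

Lemma jpfu_inv2 (A : X) : jpfui A • jpfu A = id2 _.
Proof.
apply: (lan_ext (jc_lan (id1 A))).
by rewrite rw_v vassoc !lan_comm rw_id vid_l.
Qed.

Lemma j_asc (A B C E : X) (h : hom C E) (g : hom B C) (f : hom A B) :
  asc _ _ _ • (jpfc h g ▷ jm f) • jpfc (h ∘ g) f
  = (jm h ◁ jpfc g f) • jpfc h (g ∘ f) • j2 (asc h g f).
Proof.
apply: (lan_ext (jc_lan _)).
bicat_use (j2E (asc h g f)) E1.
bicat_use (jpfcE h g) E2; bicat_use (jpfcE (h ∘ g) f) E3.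
bicat_use (jpfcE g f) E4; bicat_use (jpfcE h (g ∘ f)) E5.
bicat_nat (jpfc h g) N Nk.
bicat_nf; rewrite E1 E5 E3; simp2.
by rewrite Nk E2 (ch2 (lch (E4 _ _))); simp2.
Qed.

Lemma j_lu (A B : X) (f : hom A B) :
  lu _ • (jpfu B ▷ jm f) • jpfc (id1 B) f = j2 (lu f).
Proof.
apply: (lan_ext (jc_lan _)).
bicat_use (j2E (lu f)) E1.
bicat_use (jpfcE (id1 B) f) E2; bicat_use (jpfuE B) E3.
bicat_nat (jpfu B) N Nk.
by bicat_nf; rewrite E1 E2; simp2; rewrite Nk E3; simp2.
Qed.

Lemma j_ru (A B : X) (f : hom A B) :
  ru _ • (jm f ◁ jpfu A) • jpfc f (id1 A) = j2 (ru f).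
Proof.
apply: (lan_ext (jc_lan _)).
bicat_use (j2E (ru f)) E1.
bicat_use (jpfcE f (id1 A)) E2; bicat_use (jpfuE A) E3.
by bicat_nf; rewrite E1 E2; simp2; rewrite (ch2 (lch (E3 _ _))); simp2.
Qed.

End KanAlgebras.

Lemma lk_alg_strict (X : two_cat) (D : left_kan_pseudomonad X) : is_strict (lk_alg_bicat D).
Proof.
split=> *; apply: lk_idtocell.
- exact: strict_lu (tc_strict X) _ _ _.
- exact: strict_ru (tc_strict X) _ _ _.
- exact: strict_asc (tc_strict X) _ _ _ _ _ _ _.
Qed.

Definition lk_alg_cat (X : two_cat) (D : left_kan_pseudomonad X) : two_cat :=
  TwoCat (lk_alg_strict D).

Definition lk_kleisli (X : two_cat) (D : left_kan_pseudomonad X) : two_cat :=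
  @full_sub (lk_alg_cat D) X (free_lk_alg D).

(** [A ↦ D A], [f ↦ (y ∘ f)^D]; the action on 2-cells and the comparison cells are
    those given by the universal property of the left Kan extensions. *)
Definition lk_free_pf (X : two_cat) (D : left_kan_pseudomonad X) :
  pseudofunctor X (lk_kleisli D) :=
  @Pseudofunctor X (lk_kleisli D)
    (@Prefun X (lk_kleisli D) (fun A => A) (free_lk_mor D))
    (@j2 X D) (@jpfc X D) (@jpfci X D) (@jpfu X D) (@jpfui X D)
    (@j2_id X D) (@j2_v X D) (@jpfc_natl X D) (@jpfc_natr X D)
    (@jpfc_inv1 X D) (@jpfc_inv2 X D) (@jpfu_inv1 X D) (@jpfu_inv2 X D)
    (@j_asc X D) (@j_lu X D) (@j_ru X D).

(* Main.v *)
From Stdlib Require Import ssreflect IndefiniteDescription.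
Require Import Defs.
Set Implicit Arguments.
Unset Strict Implicit.
Unset Printing Implicit Defensive.

(** Write [J] for both free-algebra pseudofunctors. The pseudofunctor [U] is [J] after [V],
    where [V] is the forgetful pseudofunctor [kleisli T → L] followed by [R].

    Since [Fsharp J = J F], and biadjunctions compose, [V] is a right biadjoint of [Fsharp J].
    Its counit [e : Fsharp J V ⇒ 1] serves unchanged as the counit of the colax adjunction, and
    the unit [eta_A] is [J] of the unit of the biadjunction. For this to work, the functors [w ↦
    e_B ∘ Fsharp w] must be left adjoint to [u ↦ U u ∘ eta_A]; that is, a transposition from
    2-cells [w ⇒ U u ∘ eta_A] to 2-cells [e_B ∘ Fsharp w ⇒ u] must be bijective. They are not
    equivalences in general, as not every 1-cell between free algebras is isomorphic to a free
    one; this is why [eta] is only colax.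

    A colax adjunction follows formally from these bijections ([colax_of_transposition]): the
    2-cells of [eta] and the modification [Phi] are the 2-cells with the transposes that make
    [Psi] a modification and the second swallowtail equation true, and every other axiom is an
    equation between 2-cells that have the same transpose.

    The bijections come from lax idempotency ([cells_to_free_bij]). Since [U u ∘ eta_A] is
    isomorphic to some [J v], the claim is that [Fsharp] induces a bijection from the 2-cells [w
    ⇒ J v] to the 2-cells [e_B ∘ Fsharp w ⇒ e_B ∘ Fsharp J v]. Now [w] is isomorphic to [mult ∘
    J h] for a 1-cell [h : A → D V B] of [K], and [V B] has a [D]-algebra structure [a : D V B →
    V B], which is left adjoint to the unit [y]. So 2-cells [w ⇒ J v] correspond to 2-cells [h ⇒
    y ∘ v], hence to 2-cells [a ∘ h ⇒ v], hence by the biadjunction to 2-cells [e_B ∘ Fsharp J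
    (a ∘ h) ⇒ e_B ∘ Fsharp J v], and [e_B ∘ Fsharp J (a ∘ h) ≅ e_B ∘ Fsharp w]. Lax idempotency
    enters as the adjunction [J y ⊣ mult].

    The biadjunctions enter through the fact that [v ↦ e_B ∘ Fsharp J v] is an equivalence
    between hom-categories ([biuniversal]), a property that passes to composites. For the
    Kleisli 2-category of [T] this property requires that the action [T A → A] is a
    pseudomorphism, which rests on the unit law [act_unit], and that every pseudomorphism [f]
    between free algebras is isomorphic to [m ∘ T (f ∘ u)] ([retraction_iso]). *)

(** * Bijections on sets of 2-cells, invertible 2-cells *)

Definition bij (S T : Type) (f : S -> T) : Prop := forall t, exists! s, f s = t.

Lemma bij_inj S T (f : S -> T) s s' : bij f -> f s = f s' -> s = s'.
Proof. by move=> H E; case: (H (f s')) => r [_ U]; rewrite -(U s) // -(U s'). Qed.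

Lemma bij_comp S T T' (f : S -> T) (g : T -> T') : bij f -> bij g -> bij (fun s => g (f s)).
Proof.
move=> Hf Hg t; case: (Hg t) => r [gr _]; case: (Hf r) => s [fs _].
exists s; split; first by rewrite fs.
by move=> s' E; apply: (bij_inj Hf); apply: (bij_inj Hg); rewrite E fs.
Qed.

(** An equivalence of categories is fully faithful: for functors [P] and [Q] with [Q P] and [P
    Q] isomorphic to identities, [f] and [g] are their actions on 2-cells; [g] is injective
    because [P Q] is, and [g ∘ f] is a conjugate of the identity. *)
Lemma bij_cancel S T T' (f : S -> T) (g : T -> T') :
  bij (fun s => g (f s)) -> (forall t t', g t = g t' -> t = t') -> bij f.
Proof.
move=> H I t; case: (H (g t)) => s [E U]; exists s; split; first exact: I.
by move=> s' Es; apply: U; rewrite Es.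
Qed.

Lemma bij_id T : bij (fun t : T => t).
Proof. by move=> t; exists t; split. Qed.

Lemma bij_section S T T' (f : S -> T) (g : T -> T') :
  bij (fun s => g (f s)) -> (forall t, exists s, f s = t) -> bij g.
Proof.
move=> H Sj t'; case: (H t') => s [E U]; exists (f s); split=> // t.
by case: (Sj t) => r <- Er; rewrite (U r Er).
Qed.

Lemma ch4 (X : bicat) (A B : X) (e f g h k l : hom A B) (a : k ⇒ l) (b : h ⇒ k) (c : g ⇒ h)
  (d : f ⇒ g) (r : f ⇒ l) : a • b • c • d = r ->
  forall s : e ⇒ f, a • b • c • d • s = r • s.
Proof. by move=> <- s; rewrite !vassoc. Qed.

Lemma inv_mono (X : bicat) (A B : X) (f g h : hom A B) (a : g ⇒ h) (s t : f ⇒ g) :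
  is_inv2 a -> a • s = a • t -> s = t.
Proof. by move=> [b [ba _]] /(f_equal (fun z => b • z)); rewrite -!vassoc ba !vid_l. Qed.

Lemma inv_epi (X : bicat) (A B : X) (f g h : hom A B) (a : f ⇒ g) (s t : g ⇒ h) :
  is_inv2 a -> s • a = t • a -> s = t.
Proof. by move=> [b [_ ab]] /(f_equal (fun z => z • b)); rewrite !vassoc ab !vid_r. Qed.

(** Carries full faithfulness along a natural isomorphism of functors between hom-categories. *)
Lemma bij_conj (X : bicat) (A B : X) (p q p' q' : hom A B) (a : p ⇒ p') (b : q ⇒ q')
  S (f : S -> (p ⇒ q)) (g : S -> (p' ⇒ q')) :
  is_inv2 a -> is_inv2 b -> (forall s, g s • a = b • f s) -> bij f -> bij g.
Proof.
move=> Ia Ib E H t; case: (Ib) => b' [b'b bb']; case: (H (b' • t • a)) => s [fs _].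
have gs : g s = t by apply: (inv_epi Ia); rewrite E fs -vassoc bb' vid_l.
exists s; split=> // s' gs'; apply: (bij_inj H); apply: (inv_mono Ib).
by rewrite -!E gs gs'.
Qed.

Lemma bij_postcomp (Z : bicat) (P Q : Z) (f g h : hom P Q) (a : g ⇒ h) :
  is_inv2 a -> bij (fun s : f ⇒ g => a • s).
Proof.
move=> [b [ba ab]] t; exists (b • t); split; first by rewrite -vassoc ab vid_l.
by move=> s <-; rewrite -vassoc ba vid_l.
Qed.

Definition inverse (X : bicat) (A B : X) (f g : hom A B) (s : f ⇒ g) (I : is_inv2 s) : g ⇒ f :=
  proj1_sig (constructive_indefinite_description _ I).

Lemma inverse_l (X : bicat) (A B : X) (f g : hom A B) (s : f ⇒ g) (I : is_inv2 s) :
  inverse I • s = id2 f.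
Proof. by rewrite /inverse; case: (constructive_indefinite_description _ _) => t []. Qed.

Lemma inverse_r (X : bicat) (A B : X) (f g : hom A B) (s : f ⇒ g) (I : is_inv2 s) :
  s • inverse I = id2 g.
Proof. by rewrite /inverse; case: (constructive_indefinite_description _ _) => t []. Qed.

Lemma inverse_inv (X : bicat) (A B : X) (f g : hom A B) (s : f ⇒ g) (I : is_inv2 s) :
  is_inv2 (inverse I).
Proof. by exists s; rewrite inverse_l inverse_r. Qed.

Lemma inv_pfci (X Y : bicat) (K : pseudofunctor Y X) (A B C : Y) (g : hom B C) (f : hom A B) :
  is_inv2 (pfci K g f).
Proof. by exists (pfc K g f); rewrite pfc_pfci pfci_pfc. Qed.

Lemma inv_pf2 (X Y : bicat) (K : pseudofunctor Y X) (A B : Y) (f g : hom A B) (s : f ⇒ g) :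
  is_inv2 s -> is_inv2 (pf2 K s).
Proof. by move=> [t [H1 H2]]; exists (pf2 K t); rewrite -!pf2_v H1 H2 !pf2_id. Qed.

#[export] Hint Resolve inv_pfci inv_pf2 : inv2.

Ltac inv2 := repeat first [ assumption
  | exact: inv_id2 | exact: inv_asc | exact: inv_asci | exact: inv_lu | exact: inv_lui
  | exact: inv_ru | exact: inv_rui | exact: inv_pfc | exact: inv_pfci | exact: inv_pfu
  | apply: inv_vcomp | apply: inv_lw | apply: inv_rw | apply: inv_pf2 ].

Definition iso1 (X : bicat) (A B : X) (f g : hom A B) : Prop := exists s : f ⇒ g, is_inv2 s.

Section Iso1.
Context {X : bicat}.

Lemma iso1_sym (A B : X) (f g : hom A B) : iso1 f g -> iso1 g f.
Proof. by move=> [s [t [ts st]]]; exists t, s. Qed.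

Lemma iso1_trans (A B : X) (f g h : hom A B) : iso1 f g -> iso1 g h -> iso1 f h.
Proof. by move=> [s Is] [t It]; exists (t • s); apply: inv_vcomp. Qed.

Lemma iso1_lw (A B C : X) (g : hom B C) (f f' : hom A B) : iso1 f f' -> iso1 (g ∘ f) (g ∘ f').
Proof. by move=> [s Is]; exists (g ◁ s); apply: inv_lw. Qed.

Lemma iso1_rw (A B C : X) (g g' : hom B C) (f : hom A B) : iso1 g g' -> iso1 (g ∘ f) (g' ∘ f).
Proof. by move=> [s Is]; exists (s ▷ f); apply: inv_rw. Qed.

Lemma iso1_asc (A B C E : X) (h : hom C E) (g : hom B C) (f : hom A B) :
  iso1 ((h ∘ g) ∘ f) (h ∘ (g ∘ f)).
Proof. by exists (asc h g f); apply: inv_asc. Qed.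

Lemma iso1_lu (A B : X) (f : hom A B) : iso1 (id1 B ∘ f) f.
Proof. by exists (lu f); apply: inv_lu. Qed.

Lemma iso1_ru (A B : X) (f : hom A B) : iso1 (f ∘ id1 A) f.
Proof. by exists (ru f); apply: inv_ru. Qed.

Lemma iso1_pfu (Y : bicat) (K : pseudofunctor X Y) (A : X) : iso1 (fm K (id1 A)) (id1 (K A)).
Proof. by exists (pfu K A); apply: inv_pfu. Qed.

Lemma iso1_pf (Y : bicat) (K : pseudofunctor X Y) (A B : X) (f g : hom A B) :
  iso1 f g -> iso1 (fm K f) (fm K g).
Proof.
move=> [s [t [ts st]]]; exists (pf2 K s), (pf2 K t).
by rewrite -!pf2_v ts st !pf2_id.
Qed.

(** The isomorphism [i : c ≅ 1] makes [s ▷ c] a conjugate of [s]. *)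
Lemma rw_iso_bij (A C : X) (c : hom A A) (h k : hom A C) :
  iso1 c (id1 A) -> bij (fun s : h ⇒ k => s ▷ c).
Proof.
move=> /iso1_sym [i Ii].
have I (g : hom A C) : is_inv2 ((g ◁ i) • rui g) by auto with inv2.
apply: (bij_conj (I h) (I k) _ (@bij_id _)) => s.
bicat_nat s N Nk.
by bicat_nf; rewrite N.
Qed.

Lemma rw_iso_inv (A C : X) (c : hom A A) (h k : hom A C) (s : h ⇒ k) :
  iso1 c (id1 A) -> is_inv2 (s ▷ c) -> is_inv2 s.
Proof.
move=> Ic [t' [ts st]]; have [t [Et _]] := rw_iso_bij (h := k) (k := h) Ic t'.
by exists t; split; apply: (bij_inj (f := fun s => s ▷ c) (rw_iso_bij Ic)); rewrite rw_v Et rw_id.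
Qed.

End Iso1.

(** * Pseudofunctors and squares of 2-cells *)

Lemma pf_rui (X Y : bicat) (G : pseudofunctor X Y) (A B : X) (f : hom A B) :
  (fm G f ◁ pfu G A) • pfc G f (id1 A) • pf2 G (rui f) = rui (fm G f).
Proof.
rewrite -[LHS]vid_l -rui_ru !vassoc (ch3 (pf_ru G f)) -pf2_v ru_rui pf2_id.
by rewrite vid_r.
Qed.

(** The image of a square of 2-cells under a pseudofunctor, as in the 2-cells of [cx_post]; in
    this form it commutes with the pasting of squares. *)
Definition conj_pf (W W' : bicat) (H : pseudofunctor W W') (A B B' C : W) (a : hom A B)
  (f' : hom B C) (f : hom A B') (b : hom B' C) (s : b ∘ f ⇒ f' ∘ a) :
  fm H b ∘ fm H f ⇒ fm H f' ∘ fm H a := pfc H f' a • pf2 H s • pfci H b f.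

Lemma conj_pf_postcomp (W W' : bicat) (H : pseudofunctor W W') (A B B' C : W) (a : hom A B)
  (f' g' : hom B C) (f : hom A B') (b : hom B' C) (s : b ∘ f ⇒ f' ∘ a) (t : f' ⇒ g') :
  conj_pf H ((t ▷ a) • s) = (pf2 H t ▷ fm H a) • conj_pf H s.
Proof. by rewrite /conj_pf pf2_v vassoc (ch2 (pfc_natr H _ _)) vassoc. Qed.

Lemma conj_pf_precomp (W W' : bicat) (H : pseudofunctor W W') (A B B' C : W) (a : hom A B)
  (f' : hom B C) (f g : hom A B') (b : hom B' C) (s : b ∘ f ⇒ f' ∘ a) (t : g ⇒ f) :
  conj_pf H (s • (b ◁ t)) = conj_pf H s • (fm H b ◁ pf2 H t).
Proof.
apply: (inv_epi (inv_pfc H _ _)).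
by rewrite /conj_pf !pf2_v !vassoc -pfc_natl pfci_pfc vid_r (ch2 (pfci_pfc H _ _)) vid_l.
Qed.

Lemma conj_pf_comp (W W' : bicat) (H : pseudofunctor W W') (A B C A' B' C' : W)
  (a : hom A A') (b : hom B B') (c : hom C C') (f : hom A B) (g : hom B C) (h : hom A C)
  (f' : hom A' B') (g' : hom B' C') (s : b ∘ f ⇒ f' ∘ a) (t : c ∘ g ⇒ g' ∘ b) (r : h ⇒ g ∘ f) :
  (pfc H g' f' ▷ fm H a) • conj_pf H (asci g' f' a • (g' ◁ s) • asc g' b f
      • (t ▷ f) • asci c g f • (c ◁ r))
  = asci _ _ _ • (fm H g' ◁ conj_pf H s) • asc _ _ _ • (conj_pf H t ▷ fm H f)
    • asci _ _ _ • (fm H c ◁ (pfc H g f • pf2 H r)).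
Proof.
have -> : asci g' f' a • (g' ◁ s) • asc g' b f • (t ▷ f) • asci c g f • (c ◁ r)
   = (asci g' f' a • (g' ◁ s) • asc g' b f • (t ▷ f) • asci c g f) • (c ◁ r).
  by rewrite !vassoc.
rewrite conj_pf_precomp.
rewrite /conj_pf !pf2_v !vassoc (ch3 (pf_asci H _ _ _)) !vassoc (ch2 (pfc_natl H _ _)) vassoc.
rewrite (ch2 (pf_asc' H _ _ _)) !vassoc (ch2 (pfc_natr H _ _)) vassoc.
rewrite (ch2 (pf_asci' H _ _ _)) !vassoc.
by rewrite (ch2 (pfc_pfci H _ _)) vid_l !(lw_v, rw_v) !vassoc.
Qed.

Lemma conj_pf_id (W W' : bicat) (H : pseudofunctor W W') (A B : W) (a : hom A B) :
  (pfu H B ▷ fm H a) • conj_pf H (lui a • ru a) = lui _ • ru _ • (fm H a ◁ pfu H A).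
Proof.
rewrite /conj_pf pf2_v !vassoc (ch3 (pf_lui H a)) -pf_ru !vassoc.
by rewrite pfc_pfci vid_r.
Qed.

Section CounitCell.
Context (X Y : bicat) (G : pseudofunctor X Y) (U : pseudofunctor Y X).
Context (eps : colax_nat (pf_comp G U) (pf_id Y)).

(** [cx2 eps k] with the composite pseudofunctors in its type unfolded. *)
Definition counit_cell (B C : Y) (k : hom B C) :
  eps C ∘ fm G (fm U k) ⇒ k ∘ eps B := cx2 eps k.

Lemma counit_cell_id (B : Y) :
  counit_cell (id1 B) = lui _ • ru _ • (eps B ◁ (pfu G (U B) • pf2 G (pfu U B))).
Proof. by have /= := cn_unit eps B; rewrite rw_id vid_l. Qed.

Lemma counit_cell_comp (B C E : Y) (k : hom C E) (u : hom B C) :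
  counit_cell (k ∘ u) = asci _ _ _ • (k ◁ counit_cell u) • asc _ _ _
      • (counit_cell k ▷ fm G (fm U u))
      • asci _ _ _ • (eps E ◁ (pfc G (fm U k) (fm U u) • pf2 G (pfc U k u))).
Proof. by have /= := cn_comp eps k u; rewrite rw_id vid_l. Qed.

Lemma counit_cell_nat (B C : Y) (u u' : hom B C) (t : u ⇒ u') :
  (t ▷ eps B) • counit_cell u = counit_cell u' • (eps C ◁ pf2 G (pf2 U t)).
Proof. exact: (cn_nat eps t). Qed.

End CounitCell.

(** * Colax adjunctions from a transposition bijection *)

Section ColaxFromTransposition.
Context (X Y : bicat) (G : pseudofunctor X Y) (U : pseudofunctor Y X).
Context (eps : colax_nat (pf_comp G U) (pf_id Y)).
Context (eta : forall A : X, hom A (U (G A))).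
Context (psi : forall A : X, eps (G A) ∘ fm G (eta A) ⇒ id1 (G A)).

(** The composite [e_B ∘ G w ⇒ e_B ∘ G (U u ∘ eta_A) ≅ (e_B ∘ G U u) ∘ G eta_A ⇒ u ∘ e ∘ G eta_A
    ⇒ u]. If it is a bijection for all [w] and [u], then [w ↦ e_B ∘ G w] is left adjoint to [u ↦
    U u ∘ eta_A]; these local adjunctions are all that a colax adjunction needs. *)
Definition transpose (A : X) (B : Y) (u : hom (G A) B) (w : hom A (U B))
  (s : w ⇒ fm U u ∘ eta A) : eps B ∘ fm G w ⇒ u :=
  ru u • (u ◁ psi A) • asc u (eps (G A)) (fm G (eta A)) • (counit_cell eps u ▷ fm G (eta A))
  • asci _ _ _ • (eps B ◁ (pfc G (fm U u) (eta A) • pf2 G s)).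

Lemma transpose_precomp (A : X) (B : Y) (u : hom (G A) B) (w w' : hom A (U B))
  (s : w ⇒ fm U u ∘ eta A) (r : w' ⇒ w) :
  transpose (s • r) = transpose s • (eps B ◁ pf2 G r).
Proof. by rewrite /transpose pf2_v !lw_v !vassoc. Qed.

Lemma transpose_postcomp (A : X) (B : Y) (u u' : hom (G A) B) (w : hom A (U B))
  (s : w ⇒ fm U u ∘ eta A) (t : u ⇒ u') :
  transpose ((pf2 U t ▷ eta A) • s) = t • transpose s.
Proof.
rewrite /transpose pf2_v (ch2 (pfc_natr G _ _)).
bicat_use (counit_cell_nat eps t) E.
bicat_nat t N Nk.
by bicat_nf; rewrite Nk (ch2 (E _ _)) !vassoc.
Qed.

(** How transposition interacts with composition in [Y]: this and [transpose_rw] below compute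
    the transposes of all pasting composites in the axioms of a colax adjunction. *)
Lemma transpose_lw (A : X) (B C : Y) (k : hom B C) (u : hom (G A) B) (w : hom A (U B))
  (s : w ⇒ fm U u ∘ eta A) :
  transpose (u := k ∘ u) ((pfci U k u ▷ eta A) • asci _ _ _ • (fm U k ◁ s))
  = (k ◁ transpose s) • asc _ _ _ • (counit_cell eps k ▷ fm G w) • asci _ _ _
    • (eps C ◁ pfc G (fm U k) w).
Proof.
rewrite /transpose counit_cell_comp !pf2_v.
have A1 : pfc G (fm U (k ∘ u)) (eta A) • pf2 G (pfci U k u ▷ eta A)
    • pf2 G (asci (fm U k) (fm U u) (eta A)) • pf2 G (fm U k ◁ s)
  = (pf2 G (pfci U k u) ▷ fm G (eta A))
   • (pfci G (fm U k) (fm U u) ▷ fm G (eta A)) • asci _ _ _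
   • (fm G (fm U k) ◁ (pfc G (fm U u) (eta A) • pf2 G s)) • pfc G (fm U k) w.
  rewrite lw_v !vassoc -pfc_natl (ch2 (pfc_natr G _ _)) !vassoc.
  by rewrite !(ch2 (pf_asci' G _ _ _)) !vassoc.
rewrite A1.
have A2 : (pfc G (fm U k) (fm U u) • pf2 G (pfc U k u))
    • pf2 G (pfci U k u) • pfci G (fm U k) (fm U u) = id2 _.
  by rewrite !vassoc (ch2 (eq_sym (pf2_v G _ _))) pfc_pfci pf2_id vid_l pfc_pfci.
bicat_use A2 E.
bicat_nat (counit_cell eps k) N Nk.
by bicat_nf; rewrite (ch4 (lch4 (E _ _))) !(lw_id, vid_l) !Nk.
Qed.

Lemma transpose_id (A : X) :
  transpose (u := id1 (G A)) ((pfui U (G A) ▷ eta A) • lui (eta A)) = psi A.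
Proof.
rewrite /transpose counit_cell_id pf2_v (ch2 (pfc_natr G _ _)) !vassoc.
have A1 : (pfu G (U (G A)) ▷ fm G (eta A)) • pfc G (id1 (U (G A))) (eta A)
   • pf2 G (lui (eta A)) = lui _ by exact: pf_lui.
have A2 : (pfu G (U (G A)) • pf2 G (pfu U (G A))) • pf2 G (pfui U (G A)) = pfu G (U (G A)).
  by rewrite !vassoc -pf2_v pfu_pfui pf2_id vid_r.
bicat_use A1 E1. bicat_use A2 E2. bicat_nat (psi A) N Nk.
by bicat_nf; rewrite (ch3 (lch3 (E2 _ _))) (lch3 (E1 _ _)) lw_id vid_r.
Qed.

Context (transpose_bij : forall A B (u : hom (G A) B) (w : hom A (U B)),
  bij (@transpose A B u w)).

Definition untranspose (A : X) (B : Y) (u : hom (G A) B) (w : hom A (U B))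
  (t : eps B ∘ fm G w ⇒ u) : w ⇒ fm U u ∘ eta A :=
  proj1_sig (constructive_indefinite_description _ (@transpose_bij A B u w t)).

Lemma untransposeK (A : X) (B : Y) (u : hom (G A) B) (w : hom A (U B))
  (t : eps B ∘ fm G w ⇒ u) : transpose (untranspose t) = t.
Proof.
by rewrite /untranspose; case: (constructive_indefinite_description _ _) => s [].
Qed.

Lemma transpose_inj (A : X) (B : Y) (u : hom (G A) B) (w : hom A (U B))
  (s s' : w ⇒ fm U u ∘ eta A) : transpose s = transpose s' -> s = s'.
Proof. exact: (bij_inj (@transpose_bij A B u w)). Qed.

(** The choice that makes [psi] a modification: the transpose of [eta2 f] is prescribed to be
    [psi_B ▷ G f], and naturality of [psi] at [f] says the same after unfolding. *)
Definition eta2 (A B : X) (f : hom A B) : eta B ∘ f ⇒ fm U (fm G f) ∘ eta A :=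
  untranspose (lu (fm G f) • (psi B ▷ fm G f) • asci _ _ _ • (eps (G B) ◁ pfc G (eta B) f)).

(** The choice that makes the second swallowtail composite an identity: its transpose is
    prescribed to be the identity of [e_B], up to structural cells. *)
Definition colax_Phi (B : Y) : id1 (U B) ⇒ fm U (eps B) ∘ eta (U B) :=
  untranspose (ru (eps B) • (eps B ◁ pfu G (U B))).

Lemma transpose_rw (A A' : X) (B : Y) (f : hom A' A) (u : hom (G A) B) (w : hom A (U B))
  (s : w ⇒ fm U u ∘ eta A) :
  transpose (u := u ∘ fm G f)
    ((pfci U u (fm G f) ▷ eta A') • asci _ _ _ • (fm U u ◁ eta2 f) • asc _ _ _ • (s ▷ f))
  = (transpose s ▷ fm G f) • asci _ _ _ • (eps B ◁ pfc G w f).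
Proof.
set a := _ ▷ eta A'; set b := asci _ _ _; set c := _ ◁ eta2 f.
have -> : a • b • c • asc (fm U u) (eta A) f • (s ▷ f) = (a • b • c) • (asc _ _ _ • (s ▷ f)).
  by rewrite !vassoc.
rewrite transpose_precomp {}/a {}/b {}/c transpose_lw /eta2 untransposeK.
rewrite /transpose pf2_v !vassoc -(lw_v _ (pfc G (fm U u) _)) (ch2 (pf_asc' G _ _ _)) !vassoc.
rewrite pfc_natr.
bicat_use (pfc_pfci G (eta A) f) E.
bicat_nat (counit_cell eps u) N Nk. bicat_nat (psi A) M Mk.
bicat_nf.
by rewrite -!Nk (ch2 (lch (lch (E _ _)))) !lw_id vid_l.
Qed.

Definition eta_data : colax_data (pf_id X) (pf_comp U G) :=
  @ColaxData X X (pf_id X) (pf_comp U G) eta eta2.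

(** For this and the later axioms that concern [eta2] or [colax_Phi], the invertible cells [pfc
    U] and [pfu U] are first moved to the other side, so that both sides become 2-cells into
    some [U u ∘ eta]; then their transposes are compared. *)
Lemma eta_unit (A : X) :
  (pfu (pf_comp U G) A ▷ eta A) • eta2 (id1 A) = lui _ • ru _ • (eta A ◁ pfu (pf_id X) A).
Proof.
have H : (pf2 U (pfu G A) ▷ eta A) • eta2 (id1 A)
    = ((pfui U (G A) ▷ eta A) • lui _) • ru _.
  apply: transpose_inj; rewrite transpose_postcomp transpose_precomp transpose_id untransposeK.
  rewrite -pf_ru.
  bicat_nat (psi A) N Nk.
  by bicat_nf; rewrite Nk.
by rewrite /= rw_v vassoc H lw_id vid_r -!vassoc -rw_v pfu_pfui rw_id vid_l.
Qed.

Lemma eta_comp (A B C : X) (g : hom B C) (f : hom A B) :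
  (pfc (pf_comp U G) g f ▷ eta A) • eta2 (g ∘ f)
    = asci _ _ _ • (fm (pf_comp U G) g ◁ eta2 f) • asc _ _ _ • (eta2 g ▷ f)
      • asci _ _ _ • (eta C ◁ pfc (pf_id X) g f).
Proof.
have H : (pf2 U (pfc G g f) ▷ eta A) • eta2 (g ∘ f)
    = ((pfci U (fm G g) (fm G f) ▷ eta A) • asci _ _ _ • (fm U (fm G g) ◁ eta2 f)
        • asc _ _ _ • (eta2 g ▷ f)) • asci _ _ _.
  apply: transpose_inj; rewrite transpose_postcomp transpose_precomp transpose_rw !untransposeK.
  bicat_use (pf_asci G (eta C) g f) E.
  bicat_nat (psi C) N Nk.
  by bicat_nf; rewrite (lch3 (E _ _)) -Nk lw_v.
by rewrite /= rw_v vassoc H lw_id vid_r -!vassoc -rw_v pfc_pfci rw_id vid_l.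
Qed.

Lemma eta_nat (A B : X) (f g : hom A B) (s : f ⇒ g) :
  (pf2 U (pf2 G s) ▷ eta A) • eta2 f = eta2 g • (eta B ◁ s).
Proof.
apply: transpose_inj; rewrite transpose_postcomp transpose_precomp !untransposeK.
bicat_use (pfc_natl G (eta B) s) E.
bicat_nat (psi B) N Nk.
by bicat_nf; rewrite (lch (E _ _)) lw_v Nk.
Qed.

Definition eta_colax : colax_nat (pf_id X) (pf_comp U G) :=
  @ColaxNat X X (pf_id X) (pf_comp U G) eta_data eta_unit eta_comp eta_nat.

Lemma psi_mod (A B : X) (f : hom A B) :
  (fm G f ◁ psi A) • cx2 (cx_comp (cx_pre eps G) (cx_post G eta_colax)) f
  = cx2 (cx_id G) f • (psi B ▷ fm G f).
Proof.
have := untransposeK (lu (fm G f) • (psi B ▷ fm G f) • asci _ _ _ • (eps (G B) ◁ pfc G (eta B) f)).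
rewrite -/(eta2 f) /transpose /= -/(counit_cell eps (fm G f)).
bicat_use (pfc_pfci G (eta B) f) E.
move=> H. bicat_use H E'.
bicat_nf.
by rewrite (ch4 (E' _ _)) vassoc (lch (E _ _)) lw_id vid_r.
Qed.

Lemma colax_Phi_mod (B B' : Y) (f : hom B B') :
  (fm U f ◁ colax_Phi B) • cx2 (cx_id U) f
  = cx2 (cx_comp (cx_post U eps) (cx_pre eta_colax U)) f • (colax_Phi B' ▷ fm U f).
Proof.
have H : ((pfci U f (eps B) ▷ eta (U B)) • asci _ _ _ • (fm U f ◁ colax_Phi B)) • rui _ • lu _
   = (pf2 U (counit_cell eps f) ▷ eta (U B)) • (pfci U (eps B') (fm G (fm U f)) ▷ eta (U B))
     • asci _ _ _ • (fm U (eps B') ◁ eta2 (fm U f)) • asc _ _ _ • (colax_Phi B' ▷ fm U f).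
  apply: transpose_inj; rewrite transpose_postcomp transpose_precomp transpose_lw.
  rewrite transpose_rw !untransposeK.
  rewrite pf2_v -pf_lu.
  bicat_use (pf_rui G (fm U f)) E. bicat_nat (counit_cell eps f) N Nk.
  by bicat_nf; rewrite -Nk (ch3 (lch3 (E _ _))) lw_id vid_l.
rewrite /= -/(counit_cell eps f) !rw_v !vassoc.
bicat_use (pfc_pfci U f (eps B)) E.
bicat_use H E'.
by bicat_nf; rewrite -(E' _ _) (ch2 (E _ _)) vid_l.
Qed.

Lemma colax_swallowtail1 (A : X) : lu (eta A)
    • ((pfu U (G A) • pf2 U (psi A) • pfci U (eps (G A)) (fm G (eta A)))
       ▷ eta A)
    • asci _ _ _
    • (fm U (eps (G A)) ◁ eta2 (eta A))
    • asc _ _ _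
    • (colax_Phi (G A) ▷ eta A)
    • lui (eta A)
    = id2 (eta A).
Proof.
have H : (pf2 U (psi A) ▷ eta A) •
  ((pfci U (eps (G A)) (fm G (eta A)) ▷ eta A) • asci _ _ _ • (fm U (eps (G A)) ◁ eta2 (eta A))
    • asc _ _ _ • (colax_Phi (G A) ▷ eta A)) • lui (eta A) = (pfui U (G A) ▷ eta A) • lui _.
  apply: transpose_inj; rewrite transpose_postcomp transpose_precomp transpose_rw.
  rewrite transpose_id !untransposeK.
  bicat_use (pf_lui G (eta A)) E.
  bicat_nat (psi A) N Nk.
  by bicat_nf; rewrite (lch3 (E _ _)) lw_id vid_r.
bicat_use H E.
bicat_use (pfu_pfui U (G A)) E'.
by bicat_nf; rewrite (E _ _) E'.
Qed.

Lemma colax_swallowtail2 (B : Y) :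
    ru (eps B)
    • (eps B ◁ psi (U B))
    • asc _ _ _
    • (cx2 eps (eps B) ▷ fm G (eta (U B)))
    • asci _ _ _
    • (eps B
       ◁ (pfc G (fm U (eps B)) (eta (U B)) • pf2 G (colax_Phi B) • pfui G (U B)))
    • rui (eps B)
    = id2 (eps B).
Proof.
have /= H := untransposeK (ru (eps B) • (eps B ◁ pfu G (U B))).
rewrite /transpose -/(colax_Phi B) in H.
bicat_use H E.
rewrite -/(counit_cell eps (eps B)).
bicat_use (pfu_pfui G (U B)) E'.
by bicat_nf; rewrite (ch4 (E _ _)) (lch (E' _ _)) lw_id.
Qed.

Definition colax_of_transposition : colax_adjunction G U :=
  @ColaxAdjunction X Y G U eta_colax eps
    (@Modification X Y G G (cx_comp (cx_pre eps G) (cx_post G eta_colax)) (cx_id G) psi psi_mod)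
    (@Modification Y X U U (cx_id U) (cx_comp (cx_post U eps) (cx_pre eta_colax U))
      colax_Phi colax_Phi_mod)
    colax_swallowtail1 colax_swallowtail2.

End ColaxFromTransposition.

(** * Biuniversal counits *)

(** The data of a biadjunction that survive when only its counit [e] is kept: every functor [v ↦
    e_B ∘ P v] between hom-categories is an equivalence. Unlike a biadjunction with its
    swallowtail equations, this notion is closed under composition without further coherence. *)
Record biuniversal (X Y : bicat) (P : pseudofunctor X Y) (V : pseudofunctor Y X) := {
  bu_counit :> colax_nat (pf_comp P V) (pf_id Y);
  bu_inv : is_pseudonatural bu_counit;
  bu_ess : forall (A : X) (B : Y) (f : hom (P A) B),
    exists v : hom A (V B), iso1 (bu_counit B ∘ fm P v) f;
  bu_ff : forall (A : X) (B : Y) (v w : hom A (V B)),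
    bij (fun s : v ⇒ w => bu_counit B ◁ pf2 P s)
}.

Lemma bu_reflect (X Y : bicat) (P : pseudofunctor X Y) (V : pseudofunctor Y X)
  (e : biuniversal P V) (A : X) (B : Y) (v w : hom A (V B)) (s : v ⇒ w) :
  is_inv2 (e B ◁ pf2 P s) -> is_inv2 s.
Proof.
move=> [t' [ts st]]; have [t [Et _]] := bu_ff t'.
by exists t; split; apply: (bij_inj (@bu_ff _ _ _ _ e A B _ _)); rewrite pf2_v lw_v Et pf2_id lw_id.
Qed.

Section BiadjunctionBiuniversal.
Context (X Y : bicat) (F : pseudofunctor X Y) (R : pseudofunctor Y X).
Context (H : biadjunction F R).

Local Notation e := (ca_counit H).
Local Notation n := (ca_unit H).

(** With [ba_transpose] below, the natural isomorphisms between identities and the two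
    composites of [v ↦ e ∘ F v] and [f ↦ R f ∘ n]; they exhibit these functors as mutually
    inverse equivalences. *)
Definition ba_return (A : X) (B : Y) (v : hom A (R B)) : v ⇒ fm R (e B ∘ fm F v) ∘ n A :=
  (pfci R (e B) (fm F v) ▷ n A) • asci _ _ _ • (fm R (e B) ◁ cx2 n v) • asc _ _ _
  • (ca_Phi H B ▷ v) • lui v.

Lemma ba_return_inv (A : X) (B : Y) (v : hom A (R B)) : is_inv2 (ba_return v).
Proof.
rewrite /ba_return; have := ba_unit_inv H v; have := ba_Phi_inv H B => /=.
auto 10 with inv2.
Qed.

Lemma ba_return_nat (A : X) (B : Y) (v w : hom A (R B)) (s : v ⇒ w) :
  (pf2 R (e B ◁ pf2 F s) ▷ n A) • ba_return v = ba_return w • s.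
Proof.
rewrite /ba_return.
have E : pf2 R (e B ◁ pf2 F s) • pfci R (e B) (fm F v) =
   pfci R (e B) (fm F w) • (fm R (e B) ◁ pf2 R (pf2 F s)).
  apply: (inv_mono (inv_pfc R _ _)).
  by rewrite -!vassoc pfc_natl pfc_pfci vid_l vassoc pfc_pfci vid_r.
bicat_use E E1.
have /= E2 := cn_nat n s.
bicat_use E2 E3.
bicat_nat (ca_Phi H B) N Nk.
by bicat_nf; rewrite (ch2 (E1 _ _)) vassoc (ch2 (lch (E3 _ _))) lw_v vassoc -N.
Qed.

Definition ba_transpose (A : X) (B : Y) (f : hom (F A) B) : e B ∘ fm F (fm R f ∘ n A) ⇒ f :=
  ru _ • (f ◁ ca_Psi H A) • asc f (e (F A)) (fm F (n A)) • (cx2 e f ▷ fm F (n A)) • asci _ _ _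
  • (e B ◁ pfc F (fm R f) (n A)).

Lemma ba_transpose_inv (A : X) (B : Y) (f : hom (F A) B) : is_inv2 (ba_transpose f).
Proof.
rewrite /ba_transpose; have := ba_counit_inv H f; have := ba_Psi_inv H A => /=.
auto 10 with inv2.
Qed.

Lemma ba_transpose_nat (A : X) (B : Y) (f g : hom (F A) B) (s : f ⇒ g) :
  ba_transpose g • (e B ◁ pf2 F (pf2 R s ▷ n A)) = s • ba_transpose f.
Proof.
rewrite /ba_transpose.
bicat_use (pfc_natr F (pf2 R s) (n A)) E1.
have /= E2 := cn_nat e s.
bicat_use E2 E3.
bicat_nat s N Nk.
by bicat_nf; rewrite (lch (E1 _ _)) lw_v Nk (ch2 (E3 _ _)) vassoc.
Qed.

Lemma ba_ff (A : X) (B : Y) (v w : hom A (R B)) : bij (fun s : v ⇒ w => e B ◁ pf2 F s).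
Proof.
apply: (@bij_cancel _ _ _ _ (fun t => pf2 R t ▷ n A)).
  (* the composite with [t ↦ R t ▷ n] is conjugate to the identity *)
  apply: (bij_conj (ba_return_inv v) (ba_return_inv w) _ (@bij_id _)) => s.
  exact: ba_return_nat.
move=> t t' E; apply: (inv_epi (ba_transpose_inv _)).
by rewrite -!ba_transpose_nat E.
Qed.

Definition biadjunction_biuniversal : biuniversal F R :=
  {| bu_counit := e; bu_inv := ba_counit_inv H;
     bu_ess := fun A B f => ex_intro _ _ (ex_intro _ _ (ba_transpose_inv f));
     bu_ff := ba_ff |}.
End BiadjunctionBiuniversal.

Section Composite.
Context (X Y Z : bicat) (F1 : pseudofunctor X Y) (V1 : pseudofunctor Y X)
  (F2 : pseudofunctor Y Z) (V2 : pseudofunctor Z Y).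
Context (e1 : biuniversal F1 V1) (e2 : biuniversal F2 V2).

Definition comp_counit (C : Z) : hom (F2 (F1 (V1 (V2 C)))) C := e2 C ∘ fm F2 (e1 (V2 C)).

Definition comp_counit_cell (C C' : Z) (k : hom C C') :
  comp_counit C' ∘ fm F2 (fm F1 (fm V1 (fm V2 k))) ⇒ k ∘ comp_counit C :=
  asc _ _ _ • (counit_cell e2 k ▷ fm F2 (e1 (V2 C))) • asci _ _ _
  • (e2 C' ◁ conj_pf F2 (counit_cell e1 (fm V2 k))) • asc _ _ _.

Local Notation F21 := (pf_comp F2 F1).
Local Notation V12 := (pf_comp V1 V2).

Definition comp_counit_data : colax_data (pf_comp F21 V12) (pf_id Z) :=
  @ColaxData Z Z (pf_comp F21 V12) (pf_id Z) comp_counit comp_counit_cell.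

(** In the three axioms of a colax natural transformation, the part lying in [Y] is an axiom for
    [e1] at a 1-cell [V2 k], transported along [F2] with [conj_pf]; it is stated first, as [E0].
    *)
Lemma comp_counit_unit (C : Z) :
    (pfu (pf_id Z) C ▷ comp_counit C) • comp_counit_cell (id1 C)
    = lui _ • ru _ • (comp_counit C ◁ pfu (pf_comp F21 V12) C).
Proof.
rewrite /comp_counit_cell /comp_counit /= counit_cell_id rw_id vid_l.
have E0 : (pfu F2 (V2 C) ▷ fm F2 (e1 (V2 C))) • (pf2 F2 (pfu V2 C) ▷ fm F2 (e1 (V2 C)))
  • conj_pf F2 (counit_cell e1 (fm V2 (id1 C))) = lui _ • ru _ •
   (fm F2 (e1 (V2 C)) ◁ ((pfu F2 (F1 (V1 (V2 C))) • pf2 F2 (pfu F1 (V1 (V2 C))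
   • pf2 F1 (pfu V1 (V2 C) • pf2 V1 (pfu V2 C)))))).
  rewrite -conj_pf_postcomp (counit_cell_nat e1) counit_cell_id.
  rewrite (conj_pf_precomp F2) -(vassoc (lui _)) (conj_pf_precomp F2).
  rewrite -2!(vassoc (pfu _ _ ▷ _)).
  by rewrite conj_pf_id !pf2_v !(lw_v, pf2_v) !vassoc.
rewrite !pf2_v in E0 *; bicat_use E0 E.
by bicat_nf; rewrite (lch3 (E _ _)) !lw_v.
Qed.

Lemma comp_counit_comp (A B C : Z) (g : hom B C) (f : hom A B) :
    (pfc (pf_id Z) g f ▷ comp_counit A) • comp_counit_cell (g ∘ f)
    = asci _ _ _ • (g ◁ comp_counit_cell f) • asc _ _ _
      • (comp_counit_cell g ▷ fm F2 (fm F1 (fm V1 (fm V2 f)))) • asci _ _ _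
      • (comp_counit C ◁ pfc (pf_comp F21 V12) g f).
Proof.
rewrite /comp_counit_cell /comp_counit /= counit_cell_comp rw_id vid_l.
have E0 : (pfc F2 (fm V2 g) (fm V2 f) ▷ fm F2 (e1 (V2 A)))
  • (pf2 F2 (pfc V2 g f) ▷ fm F2 (e1 (V2 A)))
  • conj_pf F2 (counit_cell e1 (fm V2 (g ∘ f))) =
  asci _ _ _ • (fm F2 (fm V2 g) ◁ conj_pf F2 (counit_cell e1 (fm V2 f)))
  • asc _ _ _ • (conj_pf F2 (counit_cell e1 (fm V2 g)) ▷ _)
  • asci _ _ _ • (fm F2 (e1 (V2 C)) ◁ (pfc F2 _ _ • pf2 F2 (pfc F1 _ _
   • pf2 F1 (pfc V1 (fm V2 g) (fm V2 f) • pf2 V1 (pfc V2 g f))))).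
  rewrite -conj_pf_postcomp (counit_cell_nat e1) counit_cell_comp.

  rewrite (conj_pf_precomp F2) -(vassoc (pfc _ _ _ ▷ _)) conj_pf_comp.
  by rewrite !(lw_v, pf2_v) !vassoc.
rewrite !pf2_v in E0 *; bicat_use E0 E.
bicat_nat (counit_cell e2 g) N Nk.
by bicat_nf; rewrite (lch3 (E _ _)) !lw_v !Nk.
Qed.

Lemma comp_counit_nat (C C' : Z) (k k' : hom C C') (t : k ⇒ k') :
  (pf2 (pf_id Z) t ▷ comp_counit C) • comp_counit_cell k
  = comp_counit_cell k' • (comp_counit C' ◁ pf2 (pf_comp F21 V12) t).
Proof.
have E0 : conj_pf F2 (counit_cell e1 (fm V2 k'))
    • (fm F2 (e1 (V2 C')) ◁ pf2 F2 (pf2 F1 (pf2 V1 (pf2 V2 t))))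
  = (pf2 F2 (pf2 V2 t) ▷ fm F2 (e1 (V2 C))) • conj_pf F2 (counit_cell e1 (fm V2 k)).
  by rewrite -(conj_pf_precomp F2) -(counit_cell_nat e1) conj_pf_postcomp.
rewrite /comp_counit_cell /comp_counit /=.
have E1 := counit_cell_nat e2 t.
bicat_use E0 E. bicat_use E1 E2.
bicat_nf.
by rewrite (lch (E _ _)) lw_v (ch2 (E2 _ _)) vassoc.
Qed.

Definition comp_counit_colax : colax_nat (pf_comp F21 V12) (pf_id Z) :=
  @ColaxNat Z Z (pf_comp F21 V12) (pf_id Z) comp_counit_data
    comp_counit_unit comp_counit_comp comp_counit_nat.

Lemma comp_counit_inv : is_pseudonatural comp_counit_colax.
Proof.
move=> C C' k; rewrite /= /comp_counit_cell /conj_pf /counit_cell.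
have I2 := bu_inv e2 k; have I1 := bu_inv e1 (fm V2 k).
apply: inv_vcomp; first exact: inv_asc.
apply: inv_vcomp; first exact: (inv_rw _ I2).
apply: inv_vcomp; first exact: inv_asci.
apply: inv_vcomp; last exact: inv_asc.
apply: inv_lw; apply: inv_vcomp; first exact: inv_pfc.
by apply: inv_vcomp; [exact: (inv_pf2 _ I1) | exact: inv_pfci].
Qed.

(** Exhibits [v ↦ comp_counit ∘ F2 (F1 v)] as the composite of the equivalences [v ↦ e1 ∘ F1 v]
    and [w ↦ e2 ∘ F2 w], up to isomorphism. *)
Definition comp_counit_assoc (A : X) (C : Z) (v : hom A (V1 (V2 C))) :
  e2 C ∘ fm F2 (e1 (V2 C) ∘ fm F1 v) ⇒ comp_counit C ∘ fm F2 (fm F1 v) :=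
  asci _ _ _ • (e2 C ◁ pfc F2 (e1 (V2 C)) (fm F1 v)).

Lemma comp_counit_assoc_inv (A : X) (C : Z) (v : hom A (V1 (V2 C))) : is_inv2 (comp_counit_assoc v).
Proof. by apply: inv_vcomp; [exact: inv_asci | apply: inv_lw; exact: inv_pfc]. Qed.

Lemma comp_counit_ff (A : X) (C : Z) (v w : hom A (V1 (V2 C))) :
  bij (fun s : v ⇒ w => comp_counit C ◁ pf2 F2 (pf2 F1 s)).
Proof.
apply: (bij_conj (comp_counit_assoc_inv v) (comp_counit_assoc_inv w) _
  (bij_comp (@bu_ff _ _ _ _ e1 _ _ v w) (@bu_ff _ _ _ _ e2 _ _ _ _))) => s /=.
rewrite /comp_counit_assoc /comp_counit.
bicat_use (pfc_natl F2 (e1 (V2 C)) (pf2 F1 s)) E.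
by bicat_nf; rewrite (lch (E _ _)) !lw_v.
Qed.

Lemma comp_counit_ess (A : X) (C : Z) (f : hom (F2 (F1 A)) C) :
  exists v : hom A (V1 (V2 C)), iso1 (comp_counit C ∘ fm F2 (fm F1 v)) f.
Proof.
have [w iw] := bu_ess e2 f; have [v iv] := bu_ess e1 w.
exists v; apply: iso1_trans iw; apply: iso1_trans (iso1_lw _ (iso1_pf F2 iv)).
by apply: iso1_sym; exists (comp_counit_assoc v); apply: comp_counit_assoc_inv.
Qed.

Definition biuniversal_comp : biuniversal F21 V12 :=
  {| bu_counit := comp_counit_colax; bu_inv := comp_counit_inv;
     bu_ess := comp_counit_ess; bu_ff := comp_counit_ff |}.

End Composite.

(** * The unit law of an action morphism *)

Section UnitLaw.
Context (X : bicat) (T : pseudomonad X) (A : ps_alg T).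
Local Notation a := (pa_act A).
Local Notation u := (pm_unit T).
Local Notation m := (pm_mult T).

(** [s] is recovered from [a ◁ T s] by precomposition with the unit, as [a ∘ T s ∘ u ≅ a ∘ u ∘ s
    ≅ s]. *)
Lemma alg_faithful (Z : X) (f g : hom Z (pa_ob A)) (s t : f ⇒ g) :
  a ◁ pf2 T s = a ◁ pf2 T t -> s = t.
Proof.
move=> E.
have F (r : f ⇒ g) : (a ◁ cx2 u g) • (a ◁ (u A ◁ r)) = (a ◁ (pf2 T r ▷ u Z)) • (a ◁ cx2 u f).
  by have /= N := cn_nat u r; rewrite -!lw_v N.
have G : a ◁ (u A ◁ s) = a ◁ (u A ◁ t).
  apply: (inv_mono (inv_lw a (pm_unit_inv T g))) => /=.
  rewrite !F; congr (_ • _).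
  bicat_use E E'.
  by bicat_nf; rewrite E'.
bicat_nat (pa_unit A) N Nk.
bicat_use G G'.
have H (r : f ⇒ g) : r • (lu f • (pa_unit A ▷ f) • asci _ _ _) =
   lu g • (pa_unit A ▷ g) • asci _ _ _ • (a ◁ (u A ◁ r)).
  by bicat_nf; rewrite N.
apply: (@inv_epi _ _ _ _ _ _ (lu f • (pa_unit A ▷ f) • asci _ _ _)).
  by have := pa_unit_inv A; auto with inv2.
by rewrite !H G.
Qed.

(** The image of [act_unit] under [a ◁ T(-)], up to comparison cells. As for the redundant unit
    axiom of a monoidal category, postcompose with the invertible [a ∘ T a ⇒ a ∘ m], replace [T]
    of the left unit cell by the triangle of [T] at [A], and apply the pentagon of [A]
    precomposed with the unit: what remains is the naturality of the right unit cell at [a] and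
    the triangle of [A]. *)
Lemma act_unit_conj :
  a ◁ ((fm T a ◁ (pfu T (T A) • pf2 T (pm_lunit T A) • pfci T (m A) (u (T A))))
    • asc _ _ _ • (conj_pf T (pa_mult A) ▷ fm T (u (T A)))
    • asci _ _ _ • (fm T a ◁ conj_pf T (cx2 u a)))
  = a ◁ (rui _ • lu _ • ((pfu T A • pf2 T (pa_unit A) • pfci T a (u A)) ▷ fm T a)
      • asci _ _ _).
Proof.
have I : is_inv2 ((pa_mult A ▷ id1 (T (T A))) • asci a (fm T a) (id1 _)).
  by have := pa_mult_inv A; auto with inv2.
apply: (inv_mono I).
have /= E1 := md_nat (pm_runit T) a.
rewrite -/(conj_pf T (cx2 u a)) in E1.
have E2 := pa_pentagon A.
rewrite -/(conj_pf T (pa_mult A)) in E2.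
have E3 := pa_triangle A.
have E4 := pm_triangle T A.
bicat_use E1 F1. bicat_use E2 F2. bicat_use E3 F3. bicat_use E4 F4.
bicat_nat (pa_mult A) N Nk.
bicat_nf.
rewrite !Nk (ch3 (lch3 (eq_sym (F4 _ _)))) lw_v vassoc (ch3 (eq_sym (F2 _ _))) !vassoc.
rewrite N -Nk (ch3 (lch3 (F1 _ _))).
by rewrite (F3 _ _).
Qed.

(** The second unit law of a pseudoalgebra, which is not an axiom; it says that [a] is
    compatible with units, so that [a : T A → A] is a pseudomorphism from the free algebra. *)
Lemma act_unit : (a ◁ pm_lunit T A)
    • asc a (m A) (u (T A)) • (pa_mult A ▷ u (T A)) • asci _ _ _ • (a ◁ cx2 u a)
    = rui a • lu a • (pa_unit A ▷ a) • asci a (u A) a.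
Proof.
apply: alg_faithful.
have E1 : (fm T a ◁ pfu T (T A)) • pfc T a (id1 (T A)) • pf2 T ((a ◁ pm_lunit T A)
    • asc a (m A) (u (T A)) • (pa_mult A ▷ u (T A)) • asci _ _ _ • (a ◁ cx2 u a))
  = ((fm T a ◁ (pfu T (T A) • pf2 T (pm_lunit T A) • pfci T (m A) (u (T A))))
    • asc _ _ _ • (conj_pf T (pa_mult A) ▷ fm T (u (T A)))
    • asci _ _ _ • (fm T a ◁ conj_pf T (cx2 u a)))
    • (fm T a ◁ pfc T (u A) a) • pfc T a (u A ∘ a).
  rewrite /conj_pf !pf2_v (ch2 (pfc_natl T _ _)) !vassoc (ch2 (pf_asc' T _ _ _)) !vassoc.
  rewrite (ch2 (pfc_natr T _ _)) !vassoc (ch2 (pf_asci' T _ _ _)) !vassoc pfc_natl.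
  rewrite !rw_v !lw_v !vassoc.
  do 10 f_equal.
  by rewrite -(vassoc (_ ◁ pfci T _ _)) -lw_v pfci_pfc lw_id vid_l.
have E2 : (fm T a ◁ pfu T (T A)) • pfc T a (id1 (T A)) • pf2 T (
     rui a • lu a • (pa_unit A ▷ a) • asci a (u A) a)
  = (rui _ • lu _ • ((pfu T A • pf2 T (pa_unit A) • pfci T a (u A)) ▷ fm T a)
      • asci _ _ _) • (fm T a ◁ pfc T (u A) a) • pfc T a (u A ∘ a).
  rewrite !pf2_v (ch3 (pf_rui _ _)) -pf_lu !vassoc (ch2 (pfc_natr T _ _)) !vassoc.
  by rewrite pf_asci' !rw_v !vassoc.
have I : is_inv2 (a ◁ ((fm T a ◁ pfu T (T A)) • pfc T a (id1 (T A)))) by auto 10 with inv2.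
apply: (inv_mono I).
by rewrite -!lw_v !vassoc E1 E2 [LHS]lw_v act_unit_conj -[LHS]lw_v.
Qed.

Definition act_mor : ps_mor (free_alg T (pa_ob A)) A :=
  @PsMor X T (free_alg T (pa_ob A)) A a (pa_mult A) (pa_mult_inv A)
    (eq_sym (pa_pentagon A)) act_unit.

End UnitLaw.

(** * Free algebras of a pseudomonad *)

Section ActionCell.
Context (X : bicat) (T : pseudomonad X).

(** The structure cell of a pseudomorphism is itself an algebra 2-cell: it provides the
    naturality of the counit [J (T A) → A]. *)
Lemma act_cell_eq (A B : ps_alg T) (f : ps_mor A B) :
  @is_alg_cell X T _ _ (ps_comp1 (act_mor B) (free_mor T (pm1 f))) (ps_comp1 f (act_mor A)) (pm2 f).
Proof.
rewrite /is_alg_cell /= /ps_comp1_cell /=.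
bicat_use (pm2_mult f) E.
bicat_use (pfci_pfc T (pa_act B) (fm T f)) E1.
by bicat_nf; rewrite (ch3 (eq_sym (E _ _))) !vassoc (lch (E1 _ _)) lw_id vid_r.
Qed.

Definition act_cell (A B : ps_alg T) (f : ps_mor A B) :
  ps_cell (ps_comp1 (act_mor B) (free_mor T (pm1 f))) (ps_comp1 f (act_mor A)) :=
  PsCell (act_cell_eq f).

Lemma ps_cell_inv2 (A B : ps_alg_bicat T) (f g : hom A B) (s : f ⇒ g) :
  is_inv2 (pc s) -> is_inv2 s.
Proof.
move=> [t [ts st]]; exists (PsCell (ps_cell_inv ts st)).
by split; apply: ps_cell_ext.
Qed.

Lemma act_iso (A B : ps_alg_bicat T) (f : hom A B) :
  iso1 (comp1 (b := ps_alg_bicat T) (act_mor B) (free_mor T (pm1 f)))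
    (comp1 (b := ps_alg_bicat T) f (act_mor A)).
Proof. by exists (act_cell f); apply: ps_cell_inv2; apply: pm2_inv. Qed.

(** Algebra 2-cells can be recognised after precomposition with a pseudomorphism [c] such that
    precomposition with [T c] is faithful, because the structure cell of [c] is invertible. *)
Lemma is_alg_cell_cancel (A A' B : ps_alg T) (c : ps_mor A A') (f g : ps_mor A' B)
  (s : pm1 f ⇒ pm1 g) :
  (forall h k : hom (T (pa_ob A')) (pa_ob B), forall p q : h ⇒ k,
    p ▷ fm T (pm1 c) = q ▷ fm T (pm1 c) -> p = q) ->
  @is_alg_cell X T _ _ (ps_comp1 f c) (ps_comp1 g c) (s ▷ pm1 c) ->
  is_alg_cell s.
Proof.
move=> faith; rewrite /is_alg_cell /= /ps_comp1_cell => E; apply: faith.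
have Ia : is_inv2 ((g ◁ pm2 c) • asc g (pa_act A') (fm T c)).
  by have := pm2_inv c; auto with inv2.
have Ib : is_inv2 (asci (pa_act B) (fm T f) (fm T c) • (pa_act B ◁ pfc T f c)) by auto with inv2.
apply: (inv_mono Ia); apply: (inv_epi Ib).
bicat_use E E1.
bicat_use (pfc_natr T s c) E2.
bicat_nat s N Nk.
by bicat_nf; rewrite -Nk (E1 _ _) (lch (E2 _ _)) lw_v.
Qed.

Section Retraction.
Context (A : X).

(** The pseudomorphism [m ∘ T u]. Its 1-cell is isomorphic to the identity by the right unit
    cell; that the isomorphism can be chosen to be an algebra 2-cell is the point of
    [retraction_iso]. *)
Definition retraction : @hom (ps_alg_bicat T) (free_alg T A) (free_alg T A) :=
  @comp1 (ps_alg_bicat T) _ _ _ (act_mor (free_alg T A)) (free_mor T (pm_unit T A)).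

Lemma retraction_unit : iso1 (pm1 retraction ∘ pm_unit T A) (pm_unit T A).
Proof.
apply: iso1_trans (iso1_asc _ _ _) _.
apply: iso1_trans (iso1_lw _ (iso1_sym _)) _.
  by exists (cx2 (pm_unit T) (pm_unit T A)); apply: pm_unit_inv.
apply: iso1_trans (iso1_sym (iso1_asc _ _ _)) _.
apply: iso1_trans (iso1_rw _ _) (iso1_lu _).
by exists (pm_lunit T A); apply: pm_lunit_inv.
Qed.

Lemma free_mor_iso (Z : X) (f g : hom A Z) : iso1 f g ->
  @iso1 (ps_alg_bicat T) _ _ (free_mor T f) (free_mor T g).
Proof.
move=> [s Is]; exists (free_cell T s); apply: ps_cell_inv2.
exact: inv_pf2.
Qed.

Lemma free_mor_comp_iso (Z W : X) (g : hom Z W) (f : hom A Z) :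
  @iso1 (ps_alg_bicat T) _ _ (free_mor T (g ∘ f))
    (@comp1 (ps_alg_bicat T) _ _ _ (free_mor T g) (free_mor T f)).
Proof. by exists (free_pfc T g f); apply: ps_cell_inv2; apply: inv_pfc. Qed.

(** A pseudomorphism [f] out of a free algebra is, up to [retraction], the extension of its
    restriction [f ∘ u]. *)
Lemma act_restrict_iso (B : ps_alg_bicat T) (f : @hom (ps_alg_bicat T) (free_alg T A) B) :
  @iso1 (ps_alg_bicat T) _ _
    (@comp1 (ps_alg_bicat T) _ _ _ (act_mor B) (free_mor T (pm1 f ∘ pm_unit T A)))
    (@comp1 (ps_alg_bicat T) _ _ _ f retraction).
Proof.
apply: iso1_trans (iso1_lw _ (free_mor_comp_iso _ _)) _.
apply: iso1_trans (iso1_sym (iso1_asc _ _ _)) _.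
apply: iso1_trans (iso1_rw _ (act_iso f)) _.
exact: iso1_asc.
Qed.

Lemma retraction_idem :
  @iso1 (ps_alg_bicat T) _ _ (@comp1 (ps_alg_bicat T) _ _ _ retraction retraction) retraction.
Proof.
apply: iso1_trans (iso1_sym (act_restrict_iso retraction)) _.
exact: iso1_lw _ (free_mor_iso retraction_unit).
Qed.

Lemma retraction_iso_base : iso1 (pm1 retraction) (id1 (T A)).
Proof. by exists (pm_runit T A); apply: pm_runit_inv. Qed.

Lemma T_retraction_bij (C : X) (h k : hom (T (T A)) C) :
  bij (fun s : h ⇒ k => s ▷ fm T (pm1 retraction)).
Proof.
apply: rw_iso_bij; apply: iso1_trans (iso1_pf T retraction_iso_base) _.
exact: iso1_pfu.
Qed.

(** The algebra condition expresses [t ▷ m] through [T t], hence [t ▷ (m ∘ T u)] through [T (t ▷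
    u)]; and [m ∘ T u ≅ 1]. *)
Lemma restrict_faithful (B : ps_alg T) (f g : ps_mor (free_alg T A) B) (t t' : ps_cell f g) :
  pc t ▷ pm_unit T A = pc t' ▷ pm_unit T A -> t = t'.
Proof.
move=> E; apply: ps_cell_ext.
apply: (bij_inj (f := fun s => s ▷ pm1 retraction) (rw_iso_bij retraction_iso_base)).
have I : is_inv2 (asc (pm1 f) (pm_mult T A) (fm T (pm_unit T A))
    • (pm2 f ▷ fm T (pm_unit T A)) • asci _ _ _ • (pa_act B ◁ pfc T (pm1 f) (pm_unit T A))).
  by have := pm2_inv f; auto 10 with inv2.
apply: (inv_epi I).
have H (s : ps_cell f g) : (pc s ▷ pm1 retraction) • (asc (pm1 f) (pm_mult T A) (fm T (pm_unit T A))
    • (pm2 f ▷ fm T (pm_unit T A)) • asci _ _ _ • (pa_act B ◁ pfc T (pm1 f) (pm_unit T A)))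
  = asc (pm1 g) (pm_mult T A) (fm T (pm_unit T A))
    • (pm2 g ▷ fm T (pm_unit T A)) • asci _ _ _ • (pa_act B ◁ pfc T (pm1 g) (pm_unit T A))
    • (pa_act B ◁ pf2 T (pc s ▷ pm_unit T A)).
  have /= E1 := pc_eq s; have E2 := pfc_natr T (pc s) (pm_unit T A).
  rewrite /=; bicat_use E1 F1; bicat_use E2 F2.
  by bicat_nf; rewrite (ch2 (F1 _ _)) vassoc (lch (F2 _ _)) lw_v.
by rewrite !H E.
Qed.

(** [retraction] is idempotent up to an invertible algebra 2-cell [r]. As it is isomorphic to
    the identity in the base, [r] has the form [x ▷ retraction] for a unique 2-cell [x] to the
    identity, which is invertible and, by cancellation, an algebra 2-cell. *)
Lemma retraction_iso : @iso1 (ps_alg_bicat T) _ _ retraction (@id1 (ps_alg_bicat T) (free_alg T A)).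
Proof.
have [r Ir] := retraction_idem.
have [x [Ex _]] := rw_iso_bij (k := id1 (T A)) retraction_iso_base (lui (pm1 retraction) • pc r).
have Hx : @is_alg_cell X T _ _ retraction (ps_id1 (free_alg T A)) x.
  apply: (@is_alg_cell_cancel _ _ _ retraction).
    move=> h k p q; apply: (bij_inj (f := fun s => s ▷ fm T (pm1 retraction))).
    exact: T_retraction_bij.
  rewrite Ex.
  exact: (pc_eq (@vcomp (ps_alg_bicat T) _ _ _ _ _ (@lui (ps_alg_bicat T) _ _ retraction) r)).
exists (PsCell Hx); apply: ps_cell_inv2 => /=.
apply: (rw_iso_inv retraction_iso_base); rewrite Ex; apply: inv_vcomp; first exact: inv_lui.
case: Ir => r' [H1 H2]; exists (pc r').
by split; [move: H1 | move: H2] => /(f_equal (@pc _ _ _ _ _ _)).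
Qed.

End Retraction.
End ActionCell.

Section FreeForget.
Context (X : two_cat) (T : pseudomonad X).

Program Definition forget_pf : pseudofunctor (kleisli T) X :=
  @Pseudofunctor (kleisli T) X
    (@Prefun (kleisli T) X (fun A => T A) (fun A B f => pm1 f))
    (fun _ _ _ _ s => pc s) (fun _ _ _ g f => id2 _) (fun _ _ _ g f => id2 _)
    (fun A => id2 _) (fun A => id2 _) _ _ _ _ _ _ _ _ _ _ _.
Solve All Obligations with (intros; cbn; by rewrite ?(rw_id, lw_id, vid_l, vid_r)).

Local Notation M := (kleisli T).
Local Notation J := (free_pf T).

Definition action_data : colax_data (pf_comp J forget_pf) (pf_id M) :=
  @ColaxData M M (pf_comp J forget_pf) (pf_id M) (fun C => act_mor (free_alg T C))
    (fun _ _ f => act_cell f).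

Program Definition action_counit : colax_nat (pf_comp J forget_pf) (pf_id M) :=
  @ColaxNat M M (pf_comp J forget_pf) (pf_id M) action_data _ _ _.
Next Obligation.
apply: ps_cell_ext => /=.
by rewrite rw_id vid_l pf2_id vid_r.
Qed.
Next Obligation.
apply: ps_cell_ext => /=.
by rewrite rw_id vid_l pf2_id vid_r.
Qed.
Next Obligation.
apply: ps_cell_ext => /=.
exact: (pc_eq s).
Qed.

Lemma action_inv : is_pseudonatural action_counit.
Proof. by move=> A B f; exact: (ps_cell_inv2 (s := act_cell f) (pm2_inv f)). Qed.

Lemma action_ess (A : X) (B : M) (f : @hom M A B) :
  exists v : hom A (T B), @iso1 M A B (@comp1 M _ _ _ (act_mor (free_alg T B)) (free_mor T v)) f.
Proof.
exists (pm1 f ∘ pm_unit T A).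
apply: iso1_trans (act_restrict_iso f) _.
apply: iso1_trans (iso1_lw (X := ps_alg_bicat T) _ (retraction_iso T A)) _.
exact: iso1_ru.
Qed.

(** Restriction along the unit is left inverse to [v ↦ m ∘ T v]. *)
Definition restrict_iso (A : X) (B : M) (v : hom A (T B)) :
  v ⇒ (pm_mult T B ∘ fm T v) ∘ pm_unit T A :=
  asci _ _ _ • (pm_mult T B ◁ cx2 (pm_unit T) v) • asc _ _ _ •
  (inverse (pm_lunit_inv T B) ▷ v) • lui v.

Lemma restrict_iso_inv (A : X) (B : M) (v : hom A (T B)) : is_inv2 (restrict_iso v).
Proof.
rewrite /restrict_iso; have := inverse_inv (pm_lunit_inv T B); have := pm_unit_inv T v.
by auto 10 with inv2.
Qed.

Lemma action_ff (A : X) (B : M) (v w : hom A (T B)) :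
  bij (fun s : v ⇒ w => @lw M _ _ _ (act_mor (free_alg T B)) _ _ (free_cell T s)).
Proof.
pose P (z : hom A (T B)) := ps_comp1 (act_mor (free_alg T B)) (free_mor T z).
apply: (@bij_cancel (v ⇒ w) (ps_cell (P v) (P w)) _
  (fun s => ps_lw (act_mor (free_alg T B)) (free_cell T s))
  (fun t => pc t ▷ pm_unit T A)) => /=.
  apply: (bij_conj (restrict_iso_inv v) (restrict_iso_inv w) _ (@bij_id _)) => s.
  rewrite /restrict_iso; move: (inverse _) => j.
  have /= E := cn_nat (pm_unit T) s.
  bicat_use E F.
  bicat_nat j N Nk.
  by bicat_nf; rewrite (ch2 (lch (F _ _))) lw_v vassoc -N.
exact: restrict_faithful.
Qed.

Definition kleisli_biuniversal : biuniversal J forget_pf :=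
  {| bu_counit := action_counit; bu_inv := action_inv; bu_ess := action_ess;
     bu_ff := action_ff |}.
End FreeForget.

(** * Extension along a lax-idempotent biadjunction *)

Section Extension.
(** [J] has a right biadjoint [d] with unit [y] and counit [mu], given by the equivalences [h ↦
    mu ∘ J h], and [J y] is left adjoint to [mu] with unit the inverse of [z] and counit [c].
    The existence of [c] is lax idempotency. The goal is that [w ↦ e_B ∘ G w] is bijective on
    2-cells into the 1-cells [J v]. *)
Context (K X M : bicat) (J : pseudofunctor K X) (d : K -> K).
Context (y : forall A : K, hom A (d A)) (mu : forall A : K, hom (J (d A)) (J A)).
Context (z : forall A : K, mu A ∘ fm J (y A) ⇒ id1 (J A)) (z_inv : forall A, is_inv2 (z A)).
Context (c : forall A : K, fm J (y A) ∘ mu A ⇒ id1 (J (d A))).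
Context (c_mu : forall A : K, ru (mu A) • (mu A ◁ c A) • asc _ _ _ = lu (mu A) • (z A ▷ mu A)).
Context (c_y : forall A : K,
  lu (fm J (y A)) • (c A ▷ fm J (y A)) = ru (fm J (y A)) • (fm J (y A) ◁ z A) • asc _ _ _).
Context (mu_ess : forall (A B : K) (w : hom (J A) (J B)),
  exists h : hom A (d B), iso1 (mu B ∘ fm J h) w).
Context (mu_ff : forall (A B : K) (h h' : hom A (d B)),
  bij (fun s : h ⇒ h' => mu B ◁ pf2 J s)).
Context (G : pseudofunctor X M) (V : pseudofunctor M K) (e : biuniversal (pf_comp G J) V).

Section Reflection.
(** [a] is the algebra structure that [V B] acquires from [e]: it corresponds to [e_B ∘ G mu],
    as [alpha] records. *)
Context (B : M) (a : hom (d (V B)) (V B)) (alpha : e B ∘ fm G (fm J a) ⇒ e B ∘ fm G (mu (V B))).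
Context (alpha_inv : is_inv2 alpha).
(** The reflection isomorphism [a ∘ y ≅ 1]; [xi_def] says that it corresponds to [z] under
    [alpha]. *)
Context (xi : a ∘ y (V B) ⇒ id1 (V B)) (xi' : id1 (V B) ⇒ a ∘ y (V B)).
Context (xi_xi' : xi • xi' = id2 _).

Definition unit_ay : id1 (J (V B)) ⇒ fm J a ∘ fm J (y (V B)) :=
  pfc J a (y (V B)) • pf2 J xi' • pfui J (V B).

Context (xi_def : (e B ◁ pf2 G (z (V B))) • (e B ◁ pfci G (mu (V B)) (fm J (y (V B)))) • asc _ _ _
   • (alpha ▷ fm G (fm J (y (V B)))) • asci _ _ _ • (e B ◁ pfc G (fm J a) (fm J (y (V B))))
   • (e B ◁ pf2 G unit_ay) = id2 _).

(** [mu ≅ J a ∘ J y ∘ mu ⇒ J a]. It restricts to an isomorphism along [J y] by [kappa_y], and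
    becomes inverse to [alpha] after [e_B ∘ G (-)] by [alpha_kappa]: one triangle identity for
    each. *)
Definition kappa : mu (V B) ⇒ fm J a :=
  ru _ • (fm J a ◁ c (V B)) • asc _ _ _ • (unit_ay ▷ mu (V B)) • lui _.

Lemma kappa_y : kappa ▷ fm J (y (V B)) = unit_ay • z (V B).
Proof.
rewrite /kappa.
have Ey := c_y (V B).
bicat_use Ey E.
bicat_nat unit_ay N Nk.
by bicat_nf; rewrite (E _ _) N.
Qed.

Lemma c_mu_G (A : K) : ru _ • (fm G (mu A) ◁ (pfu G _ • pf2 G (c A) • pfci G (fm J (y A)) (mu A)))
  • asc _ _ _ = lu _ • ((pfu G _ • pf2 G (z A) • pfci G (mu A) (fm J (y A))) ▷ fm G (mu A)).
Proof.
have I : is_inv2 ((pfc G (mu A) (fm J (y A)) ▷ fm G (mu A)) • pfc G (mu A ∘ fm J (y A)) (mu A)).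
  by auto with inv2.
apply: (inv_epi I).
have /(f_equal (pf2 G)) := c_mu A.
rewrite !pf2_v -pf_lu -pf_ru !vassoc (ch2 (pfc_natl G _ _)) vassoc.
rewrite (pf_asc' G _ _ _) (pfc_natr G) => E1.
rewrite !lw_v !rw_v !vassoc E1.
by rewrite -(vassoc (pfci _ _ _ ▷ _)) -rw_v pfci_pfc rw_id vid_l.
Qed.

Lemma alpha_kappa : alpha • (e B ◁ pf2 G kappa) = id2 _.
Proof.
rewrite /kappa; move: unit_ay xi_def => om om_def; set kap := (X in pf2 G X).
have E : pf2 G kap = ru _
  • (fm G (fm J a) ◁ (pfu G _ • pf2 G (c (V B)) • pfci G (fm J (y (V B))) (mu (V B))))
  • asc _ _ _ • ((pfc G (fm J a) (fm J (y (V B))) • pf2 G om • pfui G (J (V B))) ▷ fm G (mu (V B)))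
  • lui _.
  have E1 : pfc G (id1 (J (V B))) (mu (V B)) • pf2 G (lui (mu (V B)))
     = (pfui G (J (V B)) ▷ fm G (mu (V B))) • lui _.
    by rewrite -pf_lui -(vassoc (pfui _ _ ▷ _)) -rw_v pfui_pfu rw_id vid_l.
  rewrite /kap !pf2_v -pf_ru !vassoc (ch2 (pfc_natl G _ _)) vassoc.
  rewrite (ch2 (pf_asc' G _ _ _)) !vassoc (ch2 (pfc_natr G _ _)) vassoc E1.
  by rewrite !lw_v !rw_v !vassoc.
rewrite E.
have E2 := c_mu_G (V B).
bicat_use E2 F2. bicat_use om_def F3. bicat_use (pfu_pfui G (J (V B))) F4.
bicat_nat alpha N Nk.
bicat_nf; rewrite !Nk (ch3 (lch3 (F2 _ _))) !lw_v !vassoc.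
by rewrite (ch5 (F3 _ _)) vid_l (lch (F4 _ _)) lw_id.
Qed.

Lemma kappa_inv : is_inv2 (e B ◁ pf2 G kappa).
Proof.
have [b [ba ab]] := alpha_inv.
have -> : e B ◁ pf2 G kappa = b by rewrite -[LHS]vid_l -ba vassoc alpha_kappa vid_r.
by exists alpha.
Qed.

Definition kappa_at (A : K) (h : hom A (d (V B))) : mu (V B) ∘ fm J h ⇒ fm J (a ∘ h) :=
  pfci J a h • (kappa ▷ fm J h).

Lemma kappa_at_inv (A : K) (h : hom A (d (V B))) : is_inv2 (e B ◁ pf2 G (kappa_at h)).
Proof.
rewrite /kappa_at pf2_v lw_v; apply: inv_vcomp.
  by apply: inv_lw; apply: inv_pf2; apply: inv_pfci.
have H (f : hom (J (d (V B))) (J (V B))) :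
  is_inv2 (asci (e B) (fm G f) (fm G (fm J h)) • (e B ◁ pfc G f (fm J h))) by inv2.
have E : (asci _ _ _ • (e B ◁ pfc G (fm J a) (fm J h))) • (e B ◁ pf2 G (kappa ▷ fm J h))
   = ((e B ◁ pf2 G kappa) ▷ fm G (fm J h)) • (asci _ _ _ • (e B ◁ pfc G (mu (V B)) (fm J h))).
  have E1 := pfc_natr G kappa (fm J h).
  bicat_use E1 F1.
  by bicat_nf; rewrite (lch (F1 _ _)) lw_v.
have [r [r1 r2]] := H (fm J a).
rewrite -[_ ◁ _]vid_l -r1 vassoc E; apply: inv_vcomp.
  by exists (asci (e B) (fm G (fm J a)) (fm G (fm J h)) • (e B ◁ pfc G (fm J a) (fm J h))).
by apply: inv_vcomp; [apply: inv_rw; apply: kappa_inv | apply: H].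
Qed.

Definition z_at (A : K) (v : hom A (V B)) : mu (V B) ∘ fm J (y (V B) ∘ v) ⇒ fm J v :=
  lu _ • (z (V B) ▷ fm J v) • asci _ _ _ • (mu (V B) ◁ pfc J (y (V B)) v).

Lemma z_at_inv (A : K) (v : hom A (V B)) : is_inv2 (z_at v).
Proof. by rewrite /z_at; have := z_inv (V B); auto with inv2. Qed.

(** Every 2-cell [mu ∘ J h ⇒ J v] has the form [z_at v • (mu ◁ J s)], and this shows that it
    factors through [kappa_at h] as the image of a 2-cell [a ∘ h ⇒ v]. *)
Lemma z_at_kappa (A : K) (h : hom A (d (V B))) (v : hom A (V B)) (s : h ⇒ y (V B) ∘ v) :
  z_at v • (mu (V B) ◁ pf2 J s)
  = pf2 J (lu v • (xi ▷ v) • asci a (y (V B)) v • (a ◁ s)) • kappa_at h.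
Proof.
have E1 : pf2 J (lu v • (xi ▷ v) • asci a (y (V B)) v)
  = lu _ • ((pfu J _ • pf2 J xi • pfci J a (y (V B))) ▷ fm J v) • asci _ _ _
    • (fm J a ◁ pfc J (y (V B)) v) • pfc J a (y (V B) ∘ v).
  by rewrite !pf2_v -pf_lu !vassoc (ch2 (pfc_natr J _ _)) vassoc pf_asci' !rw_v !vassoc.
have -> : lu v • (xi ▷ v) • asci a (y (V B)) v • (a ◁ s)
  = (lu v • (xi ▷ v) • asci a (y (V B)) v) • (a ◁ s) by rewrite !vassoc.
rewrite pf2_v E1 !vassoc (ch2 (pfc_natl J _ _)) /kappa_at !vassoc (ch2 (pfc_pfci J _ _)) vid_l.
have E2 := kappa_y; bicat_use E2 F2.
have E3 : (pfu J _ • pf2 J xi • pfci J a (y (V B))) • unit_ay = id2 _.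
  rewrite /unit_ay !vassoc (ch2 (pfci_pfc J _ _)) vid_l -(vassoc (pf2 J xi)) -pf2_v xi_xi'.
  by rewrite pf2_id vid_l pfu_pfui.
bicat_use E3 F3.
bicat_nat kappa N Nk.
rewrite /z_at; bicat_nf.
by rewrite -N -Nk F2 !vassoc (ch4 (F3 _ _)) vid_l.
Qed.

(** For [w ≅ mu ∘ J h], the 2-cells [t : a ∘ h ⇒ v] parametrise the 2-cells [w ⇒ J v] by [t ↦ J
    t • kappa_at h], onto by [z_at_kappa]. After [e_B ∘ G (-)] this becomes the bijection given
    by the biuniversality of [e], because [kappa_at h] becomes invertible. *)
Lemma cells_to_free_bij_of (A : K) (w : hom (J A) (J (V B))) (v : hom A (V B)) :
  bij (fun s : w ⇒ fm J v => e B ◁ pf2 G s).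
Proof.
have [h [i Ii]] := mu_ess w; have [i' [i'i ii']] := Ii.
apply: (@bij_section _ _ _ (fun t : a ∘ h ⇒ v => pf2 J t • kappa_at h • i')).
  have I : is_inv2 (e B ◁ pf2 G (kappa_at h • i')).
    rewrite pf2_v lw_v; apply: inv_vcomp; first exact: kappa_at_inv.
    by apply: inv_lw; apply: inv_pf2; exists i.
  have [r [r1 r2]] := I.
  apply: (@bij_conj _ _ _ _ _ _ _ r (id2 _) _ _ _ _ (inv_id2 _) _ (@bu_ff _ _ _ _ e A B (a ∘ h) v)).
    by exists (e B ◁ pf2 G (kappa_at h • i')).
  by move=> s; rewrite pf2_v lw_v vassoc r2 vid_l vid_r.
move=> s; have [zi [z1 z2]] := z_at_inv v.
have [t [Et _]] := mu_ff (zi • s • i).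
(* the adjunct of [t : h ⇒ y ∘ v] under [a ⊣ y] *)
exists (lu v • (xi ▷ v) • asci a (y (V B)) v • (a ◁ t)).
by rewrite -vassoc -z_at_kappa Et !(vassoc _ _ i') ii' vid_r (ch2 z2) vid_l.
Qed.

End Reflection.

(** The essential surjectivity of [v ↦ e_B ∘ G J v] at [e_B ∘ G mu] provides [a] and [alpha],
    and its full faithfulness provides [xi]. *)
Lemma cells_to_free_bij (A : K) (B : M) (w : hom (J A) (J (V B))) (v : hom A (V B)) :
  bij (fun s : w ⇒ fm J v => e B ◁ pf2 G s).
Proof.
have [a [alpha Ia]] : exists a : hom (d (V B)) (V B),
  iso1 (e B ∘ fm G (fm J a)) (e B ∘ fm G (mu (V B))) by exact: (bu_ess e).
set zz := (e B ◁ pf2 G (z (V B))) • (e B ◁ pfci G (mu (V B)) (fm J (y (V B)))) • asc _ _ _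
   • (alpha ▷ fm G (fm J (y (V B)))) • asci _ _ _ • (e B ◁ pfc G (fm J a) (fm J (y (V B)))).
have Iz : is_inv2 zz by have Iz := z_inv (V B); rewrite /zz; inv2.
(* the isomorphism [e ∘ G J (a ∘ y) ≅ e ∘ G mu ∘ G J y ≅ e], of which [xi] is to be the preimage *)
pose t := (e B ◁ pf2 G (pfui J (V B))) • zz • (e B ◁ pf2 G (pfc J a (y (V B)))).
have Iu : is_inv2 (pfui J (V B)) by exists (pfu J (V B)); rewrite pfu_pfui pfui_pfu.
have [xi [Exi _]] := @bu_ff _ _ _ _ e (V B) B (a ∘ y (V B)) (id1 (V B)) t.
have Ixi : is_inv2 xi.
  apply: (@bu_reflect _ _ _ _ e); rewrite [_ ◁ _]Exi.
  apply: inv_vcomp; first exact: (inv_lw _ (inv_pf2 G Iu)).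
  by apply: inv_vcomp; [exact: Iz | exact: (inv_lw _ (inv_pf2 G (inv_pfc J _ _)))].
have [xi' [x1 x2]] := Ixi.
apply: (@cells_to_free_bij_of _ _ _ Ia xi xi' x2).
have Iu2 : is_inv2 (e B ◁ pf2 G (pfui J (V B))) by inv2.
have Et : zz • (e B ◁ pf2 G (unit_ay xi')) = id2 _.
  apply: (inv_mono Iu2); rewrite vid_r.
  have -> : e B ◁ pf2 G (unit_ay xi') = (e B ◁ pf2 G (pfc J a (y (V B))))
    • (e B ◁ pf2 G (pf2 J xi')) • (e B ◁ pf2 G (pfui J (V B))).
    by rewrite /unit_ay !pf2_v !lw_v.
  have Exi' : (e B ◁ pf2 G (pfui J (V B))) • zz • (e B ◁ pf2 G (pfc J a (y (V B))))
    = e B ◁ pf2 G (pf2 J xi) by rewrite -[LHS]/t -Exi.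
  by rewrite (ch3 Exi') -vassoc -lw_v -!pf2_v x2 !pf2_id lw_id vid_l.
by rewrite -Et /zz !vassoc.
Qed.
End Extension.

Section Reassociation.
Context (K X M : bicat) (J : pseudofunctor K X) (G : pseudofunctor X M) (V : pseudofunctor M K).
Context (e : colax_nat (pf_comp (pf_comp G J) V) (pf_id M)).

(** [(G J) V] and [G (J V)] have equal 1-cell parts by conversion, but their comparison cells
    differ by an associativity of vertical composition. *)
Definition counit_reassoc_data : colax_data (pf_comp G (pf_comp J V)) (pf_id M) :=
  @ColaxData M M (pf_comp G (pf_comp J V)) (pf_id M) (fun B => e B) (fun _ _ f => cx2 e f).

Program Definition counit_reassoc : colax_nat (pf_comp G (pf_comp J V)) (pf_id M) :=
  @ColaxNat M M (pf_comp G (pf_comp J V)) (pf_id M) counit_reassoc_data _ _ _.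
Next Obligation. by have := cn_unit e A; rewrite /= !pf2_v !vassoc. Qed.
Next Obligation. by have := cn_comp e g f; rewrite /= !pf2_v !vassoc. Qed.
Next Obligation. exact: (cn_nat e s). Qed.

End Reassociation.

(** * Free algebras of a left Kan pseudomonad *)

Section KanExtension.
Context (K : two_cat) (D : left_kan_pseudomonad K).
Local Notation y := (lk_y D).

(** [w] preserves the left Kan extension of [y_A] along itself, which is the identity; so [w] is
    the left Kan extension of [w ∘ y_A]. *)
Lemma restrict_bij (A B : K) (w : lk_mor (free_lk_alg D A) (free_lk_alg D B))
  (g : hom (D A) (D B)) : bij (fun s : lm1 w ⇒ g => s ▷ y A).
Proof.
pose j := lan_desc (lk_lan D (y A)) (lui (y A)).
have Ej : (j ▷ y A) • lk_cell D (y A) = lui (y A) := lan_comm _ _.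
have Ij : is_inv2 j := lan_desc_inv _ (lk_lan_id D A).
have H := @lm_preserves _ _ _ _ w A (y A).
have L : is_lan (((ru (lm1 w) • (lm1 w ◁ j)) ▷ y A) • asci _ _ _ • (lm1 w ◁ lk_cell D (y A))).
  by apply: lan_postcomp H; inv2.
have E : ((ru (lm1 w) • (lm1 w ◁ j)) ▷ y A) • asci _ _ _ • (lm1 w ◁ lk_cell D (y A)) = id2 _.
  bicat_use Ej F.
  by bicat_nf; rewrite (lch (F _ _)) lw_id.
move=> t; case: (L g t) => s [Es U]; move: Es U; rewrite E => Es U.
exists s; split; first by rewrite -Es vid_r.
by move=> s' Es'; apply: U; rewrite vid_r.
Qed.

Lemma restrict_inj (A B : K) (w : lk_mor (free_lk_alg D A) (free_lk_alg D B))
  (g : hom (D A) (D B)) (s s' : lm1 w ⇒ g) : s ▷ y A = s' ▷ y A -> s = s'.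
Proof. exact: (bij_inj (restrict_bij (g := g))). Qed.

Lemma restrict_inv (A B : K) (w w' : lk_mor (free_lk_alg D A) (free_lk_alg D B))
  (s : lm1 w ⇒ lm1 w') : is_inv2 (s ▷ y A) -> is_inv2 s.
Proof.
move=> [t' [ts st]]; have [t [Et _]] := @restrict_bij _ _ w' (lm1 w) t'.
exists t; split.
  by apply: (restrict_inj (w := w)); rewrite rw_v Et rw_id.
by apply: (restrict_inj (w := w')); rewrite rw_v Et rw_id.
Qed.

Definition lift (A B : K) (w : lk_mor (free_lk_alg D A) (free_lk_alg D B))
  (g : hom (D A) (D B)) (t : lm1 w ∘ y A ⇒ g ∘ y A) : lm1 w ⇒ g :=
  proj1_sig (constructive_indefinite_description _ (restrict_bij t)).

Lemma lift_y (A B : K) (w : lk_mor (free_lk_alg D A) (free_lk_alg D B))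
  (g : hom (D A) (D B)) (t : lm1 w ∘ y A ⇒ g ∘ y A) : lift t ▷ y A = t.
Proof.
by rewrite /lift; case: (constructive_indefinite_description _ _) => s [].
Qed.

Definition mult (A : K) : lk_mor (free_lk_alg D (D A)) (free_lk_alg D A) :=
  @LkMor K D (free_lk_alg D (D A)) (free_lk_alg D A) (lk_ext D (id1 (D A)))
    (fun Z f => lk_preserves D (id1 (D A)) f).

Definition mult_y (A : K) : lm1 (mult A) ∘ y (D A) ⇒ id1 (D A) :=
  inverse (lk_cell_inv D (id1 (D A))).

Lemma mult_y_inv (A : K) : is_inv2 (mult_y A).
Proof. exact: inverse_inv. Qed.

Definition jci (A B : K) (f : hom A B) : jm D f ∘ y A ⇒ y B ∘ f :=
  inverse (lk_cell_inv D (y B ∘ f)).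

Lemma jc_jci (A B : K) (f : hom A B) : jc D f • jci f = id2 _.
Proof. exact: inverse_r. Qed.

Lemma jci_jc (A B : K) (f : hom A B) : jci f • jc D f = id2 _.
Proof. exact: inverse_l. Qed.

Lemma jci_inv (A B : K) (f : hom A B) : is_inv2 (jci f).
Proof. exact: inverse_inv. Qed.

Definition ext_y (A B : K) (h : hom A (D B)) : (lm1 (mult B) ∘ jm D h) ∘ y A ⇒ h :=
  lu h • (mult_y B ▷ h) • asci _ _ _ • (lm1 (mult B) ◁ jci h) • asc _ _ _.

Lemma ext_y_inv (A B : K) (h : hom A (D B)) : is_inv2 (ext_y h).
Proof. by have I1 := mult_y_inv B; have I2 := jci_inv h; rewrite /ext_y; inv2. Qed.

(** As [lift] needs to know that the source of its 2-cell is a pseudomorphism, composites of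
    1-cells are also named as pseudomorphisms. *)
Definition mult_free (A B : K) (h : hom A (D B)) : lk_mor (free_lk_alg D A) (free_lk_alg D B) :=
  lk_comp1 (mult B) (free_lk_mor D h).

Definition mult_free_y (A : K) : lm1 (mult A) ∘ jm D (y A) ⇒ id1 (D A) :=
  @lift A A (mult_free (y A)) (id1 (D A)) (lui (y A) • ext_y (y A)).

Lemma mult_free_y_y (A : K) : mult_free_y A ▷ y A = lui (y A) • ext_y (y A).
Proof. exact: (@lift_y _ _ (mult_free (y A)) _ _). Qed.

Lemma mult_free_y_inv (A : K) : is_inv2 (mult_free_y A).
Proof.
apply: (@restrict_inv _ _ (mult_free (y A)) (lk_id1 (free_lk_alg D A)) (mult_free_y A)).
by rewrite mult_free_y_y; have I := ext_y_inv (y A); inv2.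
Qed.

(** The comparison [D y ⇒ y D] from which lax idempotency derives the adjunction [D y ⊣ mult].
    *)
Definition free_y_to_y (A : K) : jm D (y A) ⇒ y (D A) :=
  @lift A (D A) (free_lk_mor D (y A)) (y (D A)) (jci (y A)).

Lemma free_y_to_y_y (A : K) : free_y_to_y A ▷ y A = jci (y A).
Proof. exact: (@lift_y _ _ (free_lk_mor D (y A)) _ _). Qed.

Definition free_mult (A : K) : lk_mor (free_lk_alg D (D A)) (free_lk_alg D (D A)) :=
  lk_comp1 (free_lk_mor D (y A)) (mult A).

(** The counit of [D y ⊣ mult]: restricted along [y_DA] it is [D y ∘ (mult ∘ y_DA) ≅ D y ⇒
    y_DA]. *)
Definition y_mult (A : K) : jm D (y A) ∘ lm1 (mult A) ⇒ id1 (D (D A)) :=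
  @lift (D A) (D A) (free_mult A) (id1 (D (D A)))
   (lui _ • free_y_to_y A • ru _ • (jm D (y A) ◁ mult_y A) • asc _ _ _).

Lemma y_mult_y (A : K) : y_mult A ▷ y (D A) =
   lui _ • free_y_to_y A • ru _ • (jm D (y A) ◁ mult_y A) • asc _ _ _.
Proof. exact: (@lift_y _ _ (free_mult A) _ _). Qed.

Lemma mult_y_free_y_to_y (A : K) : mult_y A • (lm1 (mult A) ◁ free_y_to_y A) = mult_free_y A.
Proof.
apply: (restrict_inj (w := mult_free (y A))).
rewrite mult_free_y_y /ext_y.
have E := free_y_to_y_y A; bicat_use E F.
by bicat_nf; rewrite F.
Qed.

Lemma y_mult_triangle_mult (A : K) :
  ru (lm1 (mult A)) • (lm1 (mult A) ◁ y_mult A) • asc _ _ _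
  = lu (lm1 (mult A)) • (mult_free_y A ▷ lm1 (mult A)).
Proof.
apply: (restrict_inj (w := lk_comp1 (mult_free (y A)) (mult A))).
apply: (inv_mono (mult_y_inv A)).
have E := y_mult_y A; bicat_use E F.
rewrite -mult_y_free_y_to_y.
have Ed := mult_y_free_y_to_y A; bicat_use Ed Fd.
bicat_nat (mult_free_y A) N Nk.
by bicat_nf; rewrite F lw_v (ch2 (Fd _ _)) N Fd.
Qed.

Lemma y_mult_triangle_free (A : K) :
  lu (jm D (y A)) • (y_mult A ▷ jm D (y A))
  = ru (jm D (y A)) • (jm D (y A) ◁ mult_free_y A) • asc _ _ _.
Proof.
apply: (restrict_inj (w := lk_comp1 (free_mult A) (free_lk_mor D (y A)))).
have I : is_inv2 (asci _ _ _ • ((jm D (y A) ∘ lm1 (mult A)) ◁ jc D (y A))).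
  have I : is_inv2 (jc D (y A)) by exists (jci (y A)); rewrite jc_jci jci_jc.
  inv2.
apply: (inv_epi I).
have E := y_mult_y A; bicat_use E F.
have E1 := free_y_to_y_y A; bicat_use E1 F1.
have E2 := mult_free_y_y A; rewrite /ext_y in E2; bicat_use E2 F2.
bicat_use (jc_jci (y A)) F3.
bicat_use (jci_jc (y A)) F4.
bicat_nat (y_mult A) N Nk.
bicat_nf.
by rewrite N F F1 F2 (ch2 (F3 _ _)) vid_l !lw_v !vassoc (lch (lch (F4 _ _))) !lw_id vid_r.
Qed.

Lemma mult_ess (A B : K) (w : lk_mor (free_lk_alg D A) (free_lk_alg D B)) :
  exists h : hom A (D B), iso1 (lm1 (mult B) ∘ jm D h) (lm1 w).
Proof.
exists (lm1 w ∘ y A), (@lift A B (mult_free (lm1 w ∘ y A)) (lm1 w) (ext_y (lm1 w ∘ y A))).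
apply: (@restrict_inv _ _ (mult_free (lm1 w ∘ y A)) w).
by rewrite (@lift_y _ _ (mult_free _)); apply: ext_y_inv.
Qed.

(** Restriction along [y] is left inverse to [h ↦ mult ∘ D h], and it is faithful. *)
Lemma mult_ff (A B : K) (h h' : hom A (D B)) : bij (fun s : h ⇒ h' => lm1 (mult B) ◁ j2 D s).
Proof.
apply: (@bij_cancel _ _ _ _ (fun s => s ▷ y A)).
  have [i [i1 i2]] := ext_y_inv h; have [i' [i'1 i'2]] := ext_y_inv h'.
  apply: (@bij_conj _ _ _ _ _ _ _ i i' _ _ _ _ _ _ (@bij_id _)).
    by exists (ext_y h).
    by exists (ext_y h').
  move=> s.
  have E : ext_y h' • ((lm1 (mult B) ◁ j2 D s) ▷ y A) = s • ext_y h.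
    rewrite /ext_y.
    have E1 : jci h' • (j2 D s ▷ y A) = (y (D B) ◁ s) • jci h.
      apply: (inv_epi (a := jc D h)); first by exists (jci h); rewrite jc_jci jci_jc.
      by rewrite !vassoc j2E jci_jc vid_r (ch2 (jci_jc _)) vid_l.
    bicat_use E1 F1. bicat_nat (mult_y B) N Nk.
    by bicat_nf; rewrite (lch (F1 _ _)) lw_v Nk.
  by rewrite -[LHS]vid_l -i'1 vassoc -(vassoc (ext_y h')) E vassoc i2 vid_r.
by move=> t t' E; apply: (restrict_inj (w := mult_free h)).
Qed.

(** * The induced colax adjunction *)

Section Main.
Context (M : bicat) (G : pseudofunctor (lk_kleisli D) M) (V : pseudofunctor M K).
Local Notation J := (lk_free_pf D).
Context (e : biuniversal (pf_comp G J) V).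

Lemma cells_to_lk_free_bij (A : K) (B : M) (w : @hom (lk_kleisli D) A (V B)) (v : hom A (V B)) :
  bij (fun s : w ⇒ fm J v => e B ◁ pf2 G s).
Proof.
exact: (@cells_to_free_bij K (lk_kleisli D) M J (fun A => D A) (lk_y D) mult
  mult_free_y mult_free_y_inv y_mult y_mult_triangle_mult y_mult_triangle_free
  mult_ess mult_ff G V e A B w v).
Qed.

Local Notation U := (pf_comp J V).
Local Notation lk_counit := (counit_reassoc e).

Lemma lk_unit_ex (A : K) :
  exists v : hom A (V (G A)), iso1 (e (G A) ∘ fm G (fm J v)) (id1 (G A)).
Proof. exact: (bu_ess e (id1 (G (J A)))). Qed.

Definition lk_unit (A : K) : hom A (V (G A)) :=
  proj1_sig (constructive_indefinite_description _ (lk_unit_ex A)).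

Lemma lk_unit_iso (A : K) : iso1 (e (G A) ∘ fm G (fm J (lk_unit A))) (id1 (G A)).
Proof. exact: (proj2_sig (constructive_indefinite_description _ (lk_unit_ex A))). Qed.

Definition lk_psi (A : K) : e (G A) ∘ fm G (fm J (lk_unit A)) ⇒ id1 (G A) :=
  proj1_sig (constructive_indefinite_description _ (lk_unit_iso A)).

Lemma lk_psi_inv (A : K) : is_inv2 (lk_psi A).
Proof. exact: (proj2_sig (constructive_indefinite_description _ (lk_unit_iso A))). Qed.

Definition lk_eta (A : lk_kleisli D) : hom A (U (G A)) := fm J (lk_unit A).

(** [U u ∘ lk_eta A ≅ J (V u ∘ lk_unit A)], so a transpose is [e_B ◁ G s] up to invertible
    cells, where [s] is a 2-cell into a 1-cell in the image of [J]. *)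
Lemma lk_transpose_bij (A : lk_kleisli D) (B : M) (u : hom (G A) B) (w : hom A (U B)) :
  bij (@transpose _ _ G U lk_counit lk_eta lk_psi A B u w).
Proof.
have H1 : bij (fun s : w ⇒ fm U u ∘ lk_eta A => pfci J (fm V u) (lk_unit A) • s).
  exact: (bij_postcomp (inv_pfci J (fm V u) (lk_unit A))).
have H2 := bij_comp H1 (@cells_to_lk_free_bij A B w (fm V u ∘ lk_unit A)).
pose iso := ru u • (u ◁ lk_psi A) • asc u (e (G A)) (fm G (lk_eta A))
  • (counit_cell lk_counit u ▷ fm G (lk_eta A)) • asci _ _ _
  • (e B ◁ (pfc G (fm U u) (lk_eta A) • pf2 G (pfc J (fm V u) (lk_unit A)))).
have Ii : is_inv2 iso.
  have I1 := lk_psi_inv A; have I2 : is_inv2 (counit_cell lk_counit u) := bu_inv e u.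
  by rewrite /iso; inv2; exact: (inv_pfc J).
have H3 := bij_comp H2 (bij_postcomp Ii).
have E (s : w ⇒ fm U u ∘ lk_eta A) :
  iso • (e B ◁ pf2 G (pfci J (fm V u) (lk_unit A) • s)) = transpose (eps := lk_counit) lk_psi s.
  have E1 : pf2 G (pfc J (fm V u) (lk_unit A)) • pf2 G (pfci J (fm V u) (lk_unit A) • s) = pf2 G s.
    rewrite -pf2_v; congr (pf2 G _).
    by rewrite -[RHS]vid_l -(pfc_pfci J (fm V u) (lk_unit A)); apply: eq_sym; apply: vassoc.
  by rewrite /iso /transpose !vassoc -lw_v vassoc E1.
by move=> t; have [s [Es Us]] := H3 t; exists s; split=> [|s']; rewrite -E //; exact: Us.
Qed.

Definition lk_colax_adjunction : colax_adjunction G U :=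
  colax_of_transposition lk_transpose_bij.

End Main.
End KanExtension.

Theorem corollary4p18 (K L : two_cat)
  (D : left_kan_pseudomonad K) (T : pseudomonad L)
  (F : pseudofunctor K L) (R : pseudofunctor L K)
  (F_R_biadjunction : biadjunction F R)
  (Fsharp : pseudofunctor (lk_kleisli D) (kleisli T))
  (Fsharp_extends : pf_comp Fsharp (lk_free_pf D) = pf_comp (free_pf T) F) :
  exists U : pseudofunctor (kleisli T) (lk_kleisli D),
    inhabited (colax_adjunction Fsharp U).
Proof.
have := biuniversal_comp (biadjunction_biuniversal F_R_biadjunction) (kleisli_biuniversal T).
rewrite -Fsharp_extends => e.
by exists (pf_comp (lk_free_pf D) (pf_comp R (forget_pf T))); split; apply: lk_colax_adjunction.
Qed.
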